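(* Let $\omega$ be a nondecreasing continuous function on $[0,\infty)$ with $\omega(0)=0$, and suppose that $\omega(2\delta)<2\omega(\delta)$ for all sufficiently small $\delta>0$. Then there exists a bounded domain $D\subseteq\mathbb R^2$ with $\partial D\in C^{1,\omega}$ such that $1_D\in A_p(\mathbb R^2)$ for all $p$, $1<p<2$, satisfying $$ \int_0^1\frac{\delta^{2p-3}}{\omega(\delta)^{2-p}}\,d\delta<\infty, $$ and, in addition, the boundary of $D$ does not contain (nondegenerate) straight line intervals.
   Context: A domain is a (nonempty) open connected set. $1_D$ denotes the characteristic function of $D$. The Fourier transform is $\widehat f(\xi)=\int_{\mathbb R^n} f(t)e^{-i(\xi,t)}\,dt$ for integrable $f$, where $(\cdot,\cdot)$ is the inner product in $\mathbb R^n$, and is extended to tempered distributions as usual. For $1\leq p\leq\infty$, $A_p(\mathbb R^n)$ is the space of tempered distributions $f$ on $\mathbb R^n$ such that $\widehat f\in L^p(\mathbb R^n)$, with norm $\|f\|_{A_p(\mathbb R^n)}=\|\widehat f\|_{L^p(\mathbb R^n)}$. For a domain $D\subseteq\mathbb R^n$, the boundary $\partial D$ is $C^1$-smooth if in an appropriate neighborhood of each of its points $\partial D$ is (after a suitable choice of orthonormal coordinates) the graph of a real function of class $C^1$. For $D$ with $C^1$-smooth boundary let $\nu_D(x)\in S^{n-1}$ be the outer unit normal vector to $\partial D$ at $x\in\partial D$, and let $$ \omega(\nu_D,\delta)=\sup_{x,y\in\partial D;\ |x-y|\leq\delta}|\nu_D(x)-\nu_D(y)|,\qquad \delta\geq 0.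 $$ The notation $\partial D\in C^{1,\omega}$ means that $\partial D$ is $C^1$-smooth and $\omega(\nu_D,\delta)=O(\omega(\delta))$ as $\delta\to+0$. *)

(* Defs.v *)
From HB Require Import structures.
From mathcomp Require Import all_boot all_order all_algebra.
From mathcomp Require Import all_classical all_reals all_analysis.
From mathcomp Require Import complex.

Set Implicit Arguments.
Unset Strict Implicit.
Unset Printing Implicit Defensive.
Import Order.TTheory GRing.Theory Num.Theory.
Import numFieldNormedType.Exports.
Local Open Scope classical_set_scope.
Local Open Scope complex_scope.
Local Open Scope ring_scope.

Section plane.
Context {R : realType}.
Implicit Types (x y : R * R) (D : set (R * R)).

Definition dot x y : R := x.1 * y.1 + x.2 * y.2.

(* The library norm on the product R * R is the max norm; the topology is the
   same, but Euclidean lengths have to be introduced separately. *)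
Definition enorm x : R := Num.sqrt (dot x x).

Definition lebesgue2 := (@lebesgue_measure R \x @lebesgue_measure R)%E.

Definition domain D := [/\ D !=set0, open D & connected D].

Definition boundary D : set (R * R) := closure D `\` D°.

Definition segment x y : set (R * R) :=
  [set (1 - t) *: x + t *: y | t in `[0, 1]%classic].

End plane.

Section smooth_boundary.
Context {R : realType}.
Implicit Types (x y v e : R * R) (D S : set (R * R)) (g : R -> R).

Definition C1_function g :=
  (forall s, derivable g s 1) /\ continuous (derive1 g).

(* Since only a neighborhood of x matters, taking g of class C^1 on the whole
   line (rather than on an interval) is no restriction. *)
Definition local_C1_graph S x e1 e2 g :=
  [/\ [/\ enorm e1 = 1, enorm e2 = 1 & dot e1 e2 = 0], C1_function g &
      \forall y \near x, S y <-> dot y e2 = g (dot y e1)].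

Definition C1_boundary D :=
  forall x, boundary D x -> exists e1 e2 g, local_C1_graph (boundary D) x e1 e2 g.

Definition normal_at S x v :=
  exists e1 e2 g, local_C1_graph S x e1 e2 g /\
    dot v (e1 + derive1 g (dot x e1) *: e2) = 0.

Definition is_outer_normal D x v :=
  [/\ enorm v = 1, normal_at (boundary D) x v &
      \forall t \near (0 : R)^'+, ~ D (x + t *: v) /\ D (x - t *: v)].

(* The last clause of is_outer_normal excludes one of the two unit normals, so
   there is at most one candidate for get to choose. *)
Definition outer_normal D x : R * R := get (is_outer_normal D x).

Definition normal_modulus D (delta : R) : R :=
  sup [set enorm (outer_normal D z.1 - outer_normal D z.2) |
       z in [set z | [/\ boundary D z.1, boundary D z.2 &
                         enorm (z.1 - z.2) <= delta]]].

Definition C1_omega_boundary (omega : R -> R) D :=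
  C1_boundary D /\
    (normal_modulus D : R -> R^o) =O_ ((0 : R)^'+) (omega : R -> R^o).

End smooth_boundary.

Section tempered_distributions.
Context {R : realType}.
Implicit Types (u : R * R -> R) (f g phi psi : R * R -> R[i]).

Definition dersn (s : seq (R * R)) u : R * R -> R :=
  foldr (fun v (w : R * R -> R) => 'D_v w : R * R -> R) u s.

Definition cdersn (s : seq (R * R)) phi (x : R * R) : R[i] :=
  dersn s (fun y => complex.Re (phi y)) x
    +i* dersn s (fun y => complex.Im (phi y)) x.

Definition smooth u :=
  forall (s : seq (R * R)) (x : R * R), differentiable (dersn s u : R * R -> R^o) x.

Definition schwartz_weight (k : nat) (s : seq (R * R)) phi (x : R * R) : R :=
  enorm x ^+ k * ComplexField.Normc.normc (cdersn s phi x).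

Definition schwartz phi :=
  [/\ smooth (fun y => complex.Re (phi y)), smooth (fun y => complex.Im (phi y)) &
      forall k s, exists M : R, forall x, schwartz_weight k s phi x <= M].

Definition schwartz_seminorm (k : nat) (s : seq (R * R)) phi : R :=
  sup (range (schwartz_weight k s phi)).

Definition schwartz_cvg (phi_ : nat -> R * R -> R[i]) phi :=
  forall k s,
    schwartz_seminorm k s (fun x => phi_ n x - phi x) @[n --> \oo] --> (0 : R).

(* A distribution is represented by a functional on all functions, of which
   only the values on Schwartz functions are meaningful.  The Schwartz space is
   metrizable, so sequential continuity is continuity. *)
Definition tempered (T : (R * R -> R[i]) -> R[i]) :=
  (forall (a : R[i]) phi psi, schwartz phi -> schwartz psi ->
     T (fun x => a * phi x + psi x) = a * T phi + T psi) /\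
  (forall (phi_ : nat -> R * R -> R[i]) phi,
     (forall n, schwartz (phi_ n)) -> schwartz phi -> schwartz_cvg phi_ phi ->
     ComplexField.Normc.normc (T (phi_ n) - T phi) @[n --> \oo] --> (0 : R)).

Definition cintegral f : R[i] :=
  (\int[lebesgue2]_x complex.Re (f x)) +i* (\int[lebesgue2]_x complex.Im (f x)).

Definition cexpi (theta : R) : R[i] := cos theta +i* sin theta.

Definition fourier f (xi : R * R) : R[i] :=
  cintegral (fun t => f t * cexpi (- dot xi t)).

Definition distr_of f phi : R[i] := cintegral (fun x => f x * phi x).

(* This extends fourier: for integrable f, Fubini's theorem gives
   int (fourier f) phi = int f (fourier phi). *)
Definition fourier_distr (T : (R * R -> R[i]) -> R[i]) phi : R[i] :=
  T (fourier phi).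

(* Borel representatives suffice, every Lebesgue measurable function being
   a.e. equal to a Borel one. *)
Definition in_Lp (p : \bar R) g :=
  [/\ measurable_fun [set: measurableTypeR R * measurableTypeR R]
        (fun x => complex.Re (g x)),
      measurable_fun [set: measurableTypeR R * measurableTypeR R]
        (fun x => complex.Im (g x)) &
      finite_norm lebesgue2 p (fun x => ComplexField.Normc.normc (g x))].

(* The space A_p, for 1 <= p <= +oo. *)
Definition A_ (p : \bar R) (T : (R * R -> R[i]) -> R[i]) :=
  tempered T /\
  exists2 g, in_Lp p g &
    forall phi, schwartz phi -> fourier_distr T phi = distr_of g phi.

Definition char_fun (D : set (R * R)) (x : R * R) : R[i] := (\1_D x : R)%:C.

End tempered_distributions.

(* Main.v *)
Require Import Defs.
From HB Require Import structures.
From mathcomp Require Import all_boot all_order all_algebra.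
From mathcomp Require Import all_classical all_reals all_analysis.
From mathcomp Require Import complex measurable_realfun ring lra.
Import Order.TTheory GRing.Theory Num.Theory.
Import numFieldNormedType.Exports.
Local Open Scope classical_set_scope.
Local Open Scope ring_scope.

Set Implicit Arguments.
Unset Strict Implicit.
Unset Printing Implicit Defensive.

(*BODY*)

(** Scales [delta j] are chosen with omega([delta j]) = 2^-j omega(rho) ([dyadic_levels]). The
    condition on omega gives 2 [delta j.+1] <= [delta j], which is what a Cantor construction with
    2^j intervals of length [delta j] requires. Its Cantor function has modulus of continuity
    O(omega). To remove the flat pieces, translates by a dense sequence are added with weights
    2^-(i+1): the resulting [slope] keeps the modulus and increases strictly from 0 to 1 on [0, 2
    [delta 0]]. Let [oslope] be its odd extension, phi the even convex antiderivative with phi(0) =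
    0, and a = 2 [delta 0]. The domain is phi(x) + phi(y) < 2 phi(a). Its normal at z is
    proportional to ([oslope] z.1, [oslope] z.2), a vector of length at least 1 on the boundary, so
    [oslope_modulus] and [normal_modulus_region] give the smoothness of the boundary. Strict
    monotonicity excludes segments ([region_no_segment]).

    For the Fourier transform let xi = (l s, l) with s = [slope] x0. Slicing the convex domain by
    lines orthogonal to xi leaves an oscillatory integral of a concave function, bounded by a
    multiple of 1/l times the width of the cap that the tangent to phi at x0, raised by 2 pi/l, cuts
    off ([oscillation_bound], [region_integral_bound]). The cap is narrow when the slope grows
    quickly on both sides of x0 ([convex_cap]). Let x0 = [sample i t] be the point with parameter t
    of the i-th translated Cantor set, and d_j(t) the distance from t to the grid of step 2^-j.
    Moving t by d_j(t)/2 displaces the point by at most [delta j] but changes the slope by at least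
    2^-(i+2) d_j(t). Hence the transform at xi is at most (K/l) ([delta j] + 1/(l 2^-(i+1) d_j(t)))
    for every j ([transform_norm_sample]).

    These directions carry the whole integral: the mixture of the translated Cantor measures has
    distribution function [slope], so [slope] maps it to Lebesgue measure on [0, 1], and an integral
    over 0 <= xi.1 <= l is controlled by a weighted sum over i of integrals over t ([slope_cdf],
    [slope_integral_le]). Integrating over l with the best j ([frequency_integral_bound]) and then
    over t gives, for each i, 2^(-(i+1)(p-2)) times the sum over j of [delta j]^(2p-2) 2^(j(2-p)),
    up to constants and a shift of index. With the weights 2^-(i+1) the sum over i is geometric
    because p > 1 ([slope_region_integral]), and the sum over j is dominated by the integral in the
    hypothesis ([omega_summable]). The symmetries of the domain reduce all frequencies to the octant
    0 <= xi.1 <= xi.2 ([integral_octant_bound]). *)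

Section cantor_quantile.
Context {R : realType}.
Variable delta : nat -> R.
Hypothesis delta_gt0 : forall j, 0 < delta j.
Hypothesis delta_half : forall j, 2 * delta j.+1 <= delta j.

(** Left end of the k-th interval of generation j: an interval of length [delta j] keeps its two
    extreme subintervals of length [delta j.+1], and the children of k are 2k and 2k+1. Indices k >=
    2^j describe copies translated by multiples of [delta 0], so no side condition on k arises. *)
Fixpoint cantor_left (j k : nat) : R :=
  if j is j'.+1 then
    cantor_left j' k./2 + (odd k)%:R * (delta j' - delta j)
  else k%:R * delta 0.

Lemma cantor_leftS j k : cantor_left j k + delta j <= cantor_left j k.+1.
Proof.
elim: j k => [|j IH] k; first by rewrite /= -[k.+1%:R]natr1 mulrDl mul1r.
rewrite /= uphalf_half; case: (odd k) => /=.
  by rewrite mul1r mul0r addr0 -addrA subrK; exact: IH.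
rewrite add0n mul0r mul1r addr0 lerD2l.
by have := delta_half j; lra.
Qed.

Lemma cantor_left_ltn j k k' : (k < k')%N ->
  cantor_left j k + delta j <= cantor_left j k'.
Proof.
elim: k' => // k' IH; rewrite ltnS leq_eqVlt => /orP[/eqP ->|/IH h].
  exact: cantor_leftS.
by rewrite (le_trans h)// (le_trans _ (cantor_leftS j k'))// lerDl ltW.
Qed.

Lemma cantor_left0 j : cantor_left j 0 = 0.
Proof. by elim: j => [|j IH] /=; rewrite ?IH ?mul0r ?add0r. Qed.

Lemma cantor_left_half j k : cantor_left j k./2 <= cantor_left j.+1 k.
Proof.
rewrite /= lerDl mulr_ge0// subr_ge0.
by have := delta_half j; have := delta_gt0 j.+1; lra.
Qed.

Lemma cantor_right_half j k :
  cantor_left j.+1 k + delta j.+1 <= cantor_left j k./2 + delta j.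
Proof.
rewrite /=; case: (odd k) => /=.
  by rewrite mul1r -addrA lerD2l; lra.
rewrite mul0r addr0 lerD2l.
by have := delta_half j; have := delta_gt0 j.+1; lra.
Qed.

Definition grid_index (j : nat) (t : R) : nat := Num.truncn (2 ^+ j * t).

Lemma grid_index_itv j t : 0 <= t ->
  (grid_index j t)%:R <= 2 ^+ j * t < (grid_index j t).+1%:R.
Proof. by move=> t0; apply: truncn_itv; rewrite mulr_ge0// exprn_ge0. Qed.

Lemma grid_index_eq j t k : k%:R <= 2 ^+ j * t < k.+1%:R -> grid_index j t = k.
Proof. exact: truncn_def. Qed.

Lemma grid_indexS j t : 0 <= t -> (grid_index j.+1 t)./2 = grid_index j t.
Proof.
move=> t0; apply/esym/grid_index_eq.
have := grid_index_itv j.+1 t0; set k := grid_index _ _ => /andP[k1 k2].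
have k3 : 2 ^+ j.+1 * t = (2 ^+ j * t) *+ 2 by rewrite exprS -mulrA mulr_natl.
rewrite k3 in k1 k2.
have h1 : (k./2.*2 <= k)%N by rewrite -{2}(odd_double_half k) leq_addl.
have h2 : (k < k./2.+1.*2)%N.
  by rewrite -{1}(odd_double_half k) doubleS; case: odd; rewrite ?add1n ?add0n ltnS.
move: h1 h2; rewrite -!(ler_nat R) -!mul2n !natrM => h1 h2.
apply/andP; split; first by rewrite -mulr_natl in k1; lra.
by move: k2 h2; rewrite -mulr_natl -!natr1; lra.
Qed.

Lemma le_grid_index j s t : 0 <= s -> s <= t -> (grid_index j s <= grid_index j t)%N.
Proof. by move=> s0 st; apply: le_truncn; rewrite ler_pM2l// exprn_gt0. Qed.

(** The point of the Cantor set whose binary address is t: the intervals of indices [grid_index j t]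
    are nested, and the supremum of their left ends is their common point. *)
Definition quantile (t : R) : R :=
  sup (range (fun j => cantor_left j (grid_index j t))).

Let lefts t j := cantor_left j (grid_index j t).

Lemma lefts_nd t i j : 0 <= t -> (i <= j)%N -> lefts t i <= lefts t j.
Proof.
move=> t0; elim: j => [|j IH]; first by rewrite leqn0 => /eqP ->.
rewrite leq_eqVlt => /orP[/eqP -> //|/IH h]; apply: (le_trans h).
by rewrite /lefts -grid_indexS//; exact: cantor_left_half.
Qed.

Lemma rights_ni t i j : 0 <= t -> (i <= j)%N ->
  lefts t j + delta j <= lefts t i + delta i.
Proof.
move=> t0; elim: j => [|j IH]; first by rewrite leqn0 => /eqP ->.
rewrite leq_eqVlt => /orP[/eqP -> //|/IH h]; apply: le_trans h.
by rewrite /lefts -(grid_indexS j)//; exact: cantor_right_half.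
Qed.

Lemma lefts_le_rights t i j : 0 <= t -> lefts t i <= lefts t j + delta j.
Proof.
move=> t0; have [ij|/ltnW ji] := leqP i j.
  by rewrite (le_trans (lefts_nd t0 ij))// lerDl ltW.
by rewrite (le_trans _ (rights_ni t0 ji))// lerDl ltW.
Qed.

Lemma quantile_ge j t : 0 <= t -> cantor_left j (grid_index j t) <= quantile t.
Proof.
move=> t0; apply: ub_le_sup; last by exists j.
by exists (lefts t 0%N + delta 0%N) => _ [i _ <-]; exact: lefts_le_rights.
Qed.

Lemma quantile_le j t : 0 <= t ->
  quantile t <= cantor_left j (grid_index j t) + delta j.
Proof.
move=> t0; apply: ge_sup; first by exists (lefts t 0%N); exists 0%N.
by move=> _ [i _ <-]; exact: lefts_le_rights.
Qed.

Lemma quantile_ge0 t : 0 <= t -> 0 <= quantile t.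
Proof. by move=> t0; rewrite (le_trans _ (quantile_ge 0 t0))//= mulr_ge0// ltW. Qed.

Lemma quantile_le1 t : 0 <= t < 1 -> quantile t <= delta 0.
Proof.
move=> /andP[t0 t1]; rewrite (le_trans (quantile_le 0 t0))//.
rewrite (_ : grid_index 0 t = 0%N) ?cantor_left0 ?add0r//.
by apply: grid_index_eq; rewrite expr0 mul1r t0.
Qed.

(** The indices of s and t at level j differ by at least 2, so a full interval of length [delta j]
    separates the intervals containing the two quantiles. This is the source of the modulus of
    continuity of the Cantor function. *)
Lemma quantile_gap j s t : 0 <= s -> s + 2 * 2 ^- j <= t ->
  quantile s + delta j <= quantile t.
Proof.
move=> s0 st; have t0 : 0 <= t by rewrite (le_trans _ st)// addr_ge0// mulr_ge0// invr_ge0 exprn_ge0.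
have e0 : 0 < 2 ^+ j :> R by rewrite exprn_gt0.
have st2 : 2 ^+ j * s + 2 <= 2 ^+ j * t.
  have : 2 ^+ j * (s + 2 * 2 ^- j) <= 2 ^+ j * t by rewrite ler_pM2l.
  by rewrite mulrDr mulrCA divff ?mulr1// gt_eqF.
have kk : ((grid_index j s).+1 < grid_index j t)%N.
  have /andP[a b] := grid_index_itv j s0; have /andP[c d] := grid_index_itv j t0.
  by rewrite -ltnS -(ltr_nat R) (le_lt_trans _ d)//; move: st2 a; rewrite -!natr1; lra.
have := cantor_left_ltn j kk; have := cantor_leftS j (grid_index j s).
have := quantile_le j s0; have := quantile_ge j t0; lra.
Qed.

Lemma quantile_lt s t : 0 <= s -> s < t -> quantile s < quantile t.
Proof.
move=> s0 st; have st2 : 0 < (t - s) / 2 by rewrite divr_gt0// subr_gt0.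
have [j _ hj] : \forall j \near \oo, 2 ^- j < (t - s) / 2.
  have : (fun j => (2^-1 : R) ^+ j) @ \oo --> (0 : R).
    by apply: cvg_expr; rewrite ger0_norm ?invr_ge0// invf_lt1// ltr1n.
  move=> /cvgrPdist_lt /(_ _ st2); apply: filterS => j /=.
  by rewrite sub0r normrN exprVn ger0_norm// invr_ge0 exprn_ge0.
have {}hj := hj j (leqnn j).
have := @quantile_gap j s t s0; have := delta_gt0 j => dj h.
by apply: lt_le_trans (h _); [rewrite ltrDl | lra].
Qed.

Lemma quantile_nd s t : 0 <= s -> s <= t -> quantile s <= quantile t.
Proof.
by move=> s0; rewrite le_eqVlt => /predU1P[->//|st]; rewrite ltW// quantile_lt.
Qed.

Lemma quantile_close j s t : 0 <= s -> 0 <= t -> grid_index j s = grid_index j t ->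
  quantile t - quantile s <= delta j.
Proof.
move=> s0 t0 e; have := quantile_le j t0; have := quantile_ge j s0; rewrite e; lra.
Qed.

End cantor_quantile.

(** * The Cantor function as generalized inverse of the quantile function *)

Section cantor_function.
Context {R : realType}.
Variable delta : nat -> R.
Hypothesis delta_gt0 : forall j, 0 < delta j.
Hypothesis delta_half : forall j, 2 * delta j.+1 <= delta j.
Let q := quantile delta.

(** For x < 0 the set is empty and its supremum is 0 by convention, the value wanted there; the
    restriction t < 1 caps the function at 1 to the right of the Cantor set. *)
Definition cantor_fun (x : R) : R :=
  sup [set t | 0 <= t < 1 /\ quantile delta t <= x].

Lemma delta_le j : delta j <= 2 ^- j * delta 0.
Proof.
elim: j => [|j IH]; first by rewrite expr0 invr1 mul1r.
have := delta_half j; rewrite exprS invfM => h.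
have h2 : delta j.+1 <= 2^-1 * delta j by lra.
by rewrite (le_trans h2)// -mulrA ler_pM2l// invr_gt0.
Qed.

Lemma exp2V_small (e : R) : 0 < e -> exists j, 2 ^- j < e.
Proof.
move=> e0; have : (fun j => (2^-1 : R) ^+ j) @ \oo --> (0 : R).
  by apply: cvg_expr; rewrite ger0_norm ?invr_ge0// invf_lt1// ltr1n.
move=> /cvgrPdist_lt /(_ _ e0) [j _ /(_ j (leqnn j))] /=.
rewrite sub0r normrN exprVn ger0_norm ?invr_ge0 ?exprn_ge0// => h.
by exists j.
Qed.

Lemma delta_small (e : R) : 0 < e -> exists j, delta j < e.
Proof.
move=> e0; have [j hj] := exp2V_small (divr_gt0 e0 (delta_gt0 0)).
exists j; rewrite (le_lt_trans (delta_le j))//.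
by rewrite -ltr_pdivlMr.
Qed.

Let S x := [set t | 0 <= t < 1 /\ q t <= x].

Let ubS x : has_ubound (S x).
Proof. by exists 1 => t [/andP[_ /ltW]]. Qed.

Lemma quantile0 : q 0 = 0.
Proof.
apply/eqP; rewrite eq_le quantile_ge0// andbT; apply/ler_addgt0Pr => e e0.
have [j hj] := delta_small e0.
rewrite add0r (le_trans _ (ltW hj))// (le_trans (quantile_le delta_gt0 delta_half j _))//.
by rewrite /grid_index mulr0 truncn0 cantor_left0 add0r.
Qed.

Lemma cantor_fun_ge x t : 0 <= t < 1 -> q t <= x -> t <= cantor_fun x.
Proof. by move=> t01 qx; apply: ub_le_sup => //; exact: ubS. Qed.

Lemma cantor_fun_lt x t : 0 <= t -> t < cantor_fun x -> q t <= x.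
Proof.
move=> t0 tx; have [ne|/nonemptyPn e] := pselect (S x !=set0); last first.
  by move: tx; rewrite /cantor_fun -/(S x) e sup0 ltNge t0.
have hs : has_sup (S x) by split; [|exact: ubS].
have d0 : 0 < cantor_fun x - t by rewrite subr_gt0.
have [s [/andP[s0 s1] qs] ts] := sup_adherent d0 hs.
move: ts; rewrite /cantor_fun -/(S x) subKr => ts.
by rewrite (le_trans _ qs)// quantile_nd// ltW.
Qed.

Lemma cantor_fun_ge0 x : 0 <= cantor_fun x.
Proof.
have [[t [/andP[t0 t1] qt]]|/nonemptyPn e] := pselect (S x !=set0); last first.
  by rewrite /cantor_fun -/(S x) e sup0.
by rewrite (le_trans t0)// cantor_fun_ge// t0.
Qed.

Lemma cantor_fun_le1 x : cantor_fun x <= 1.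
Proof.
have [ne|/nonemptyPn e] := pselect (S x !=set0); last first.
  by rewrite /cantor_fun -/(S x) e sup0.
by apply: ge_sup => // t [/andP[_ /ltW]].
Qed.

Lemma cantor_fun_nd x y : x <= y -> cantor_fun x <= cantor_fun y.
Proof.
move=> xy; have [ne|/nonemptyPn e] := pselect (S x !=set0); last first.
  by rewrite {1}/cantor_fun -/(S x) e sup0 cantor_fun_ge0.
apply: ge_sup => // t [t01 qt]; apply: cantor_fun_ge => //.
exact: le_trans xy.
Qed.

Lemma cantor_fun_quantile t : 0 <= t < 1 -> cantor_fun (q t) = t.
Proof.
move=> t01; have /andP[t0 t1] := t01; apply/eqP.
rewrite eq_le cantor_fun_ge// andbT leNgt; apply/negP => h.
have m0 : 0 <= (t + cantor_fun (q t)) / 2 by lra.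
have := @cantor_fun_lt (q t) ((t + cantor_fun (q t)) / 2) m0.
have lt1 : (t + cantor_fun (q t)) / 2 < cantor_fun (q t) by lra.
move=> /(_ lt1); apply/negP; rewrite -ltNge quantile_lt//; lra.
Qed.

Lemma cantor_fun0 x : x <= 0 -> cantor_fun x = 0.
Proof.
move=> x0; apply/eqP; rewrite eq_le cantor_fun_ge0 andbT.
by rewrite -[leRHS](@cantor_fun_quantile 0) ?lexx//= cantor_fun_nd// quantile0.
Qed.

Lemma cantor_fun1 x : delta 0 <= x -> cantor_fun x = 1.
Proof.
move=> x0; apply/eqP; rewrite eq_le cantor_fun_le1 leNgt; apply/negP => h.
have c0 := cantor_fun_ge0 x.
have : (1 + cantor_fun x) / 2 <= cantor_fun x; last by lra.
apply: cantor_fun_ge; first by apply/andP; split; lra.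
by rewrite (le_trans _ x0)// quantile_le1//; apply/andP; split; lra.
Qed.

(** Otherwise parameters s < t with t - s = 2 * 2^-j fit strictly between the two values; by
    [quantile_gap] their quantiles differ by at least [delta j], which forces the quantile of s
    below x and s below [cantor_fun x]. *)
Lemma cantor_fun_close j x y : y <= x + delta j ->
  cantor_fun y <= cantor_fun x + 2 * 2 ^- j.
Proof.
move=> yx; rewrite leNgt; apply/negP => h.
have c0 := cantor_fun_ge0 x; have d0 : 0 < 2 ^- j :> R by rewrite invr_gt0 exprn_gt0.
pose e := (cantor_fun y - cantor_fun x - 2 * 2 ^- j) / 3.
have e0 : 0 < e by rewrite divr_gt0// subr_gt0 ltrBrDl.
pose s := cantor_fun x + e; pose t := cantor_fun x + e + 2 * 2 ^- j.
have s0 : 0 <= s by rewrite addr_ge0// ltW.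
have t0 : 0 <= t by rewrite addr_ge0// mulr_ge0// ltW.
have ty : t < cantor_fun y by rewrite /t /e; rewrite /e in e0; lra.
have qt := cantor_fun_lt t0 ty.
have qg : q s + delta j <= q t by apply: quantile_gap.
have c1 := cantor_fun_le1 y.
have qx : q s <= x by lra.
have : s <= cantor_fun x by apply: cantor_fun_ge => //; rewrite s0; rewrite /s /t in ty *; lra.
by rewrite /s; lra.
Qed.

Lemma cantor_fun_gt0 x : 0 < x -> 0 < cantor_fun x.
Proof.
move=> x0; have [j hj] := delta_small x0.
have p0 : 0 < 2 ^- j :> R by rewrite invr_gt0 exprn_gt0.
have p1 : 2 ^- j <= 1 :> R by rewrite invf_le1 ?exprn_gt0// exprn_ege1// ler1n.
apply: (@lt_le_trans _ _ (2 ^- j / 2)); first by rewrite divr_gt0.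
have h0 : 0 <= 2 ^- j / 2 :> R by rewrite divr_ge0// ltW.
apply: cantor_fun_ge; first by apply/andP; split; lra.
rewrite (le_trans (quantile_le delta_gt0 delta_half j h0))//.
rewrite (@grid_index_eq _ _ _ 0) ?cantor_left0 ?add0r; first exact: ltW.
apply/andP; split; first by rewrite mulr_ge0 ?exprn_ge0.
by rewrite mulrA divff ?mul1r ?gt_eqF ?exprn_gt0// invf_lt1// ltr1n.
Qed.

Lemma cantor_left_last j : cantor_left delta j (2 ^ j).-1 = delta 0 - delta j.
Proof.
elim: j => [|j IH]; first by rewrite expn0 /= mul0r subrr.
have -> : (2 ^ j.+1).-1 = (true + ((2 ^ j).-1).*2)%N.
  by have := expn_gt0 2 j; case: (2 ^ j)%N (expnS 2 j) => // m ->; rewrite mul2n.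
by rewrite [LHS]/= uphalf_double odd_double/= IH mul1r addrA subrK.
Qed.

Lemma cantor_fun_lt1 x : x < delta 0 -> cantor_fun x < 1.
Proof.
move=> x0; have xd : 0 < delta 0 - x by rewrite subr_gt0.
have [j hj] := delta_small xd.
have p0 : 0 < 2 ^+ j :> R by rewrite exprn_gt0.
have p1 : 1 <= 2 ^+ j :> R by rewrite exprn_ege1// ler1n.
have hp : ((2 ^ j).-1%:R : R) = 2 ^+ j - 1 by rewrite -subn1 natrB ?expn_gt0// natrX.
pose t : R := (2 ^ j).-1%:R * 2 ^- j.
have t0 : 0 <= t by rewrite mulr_ge0// invr_ge0 ltW.
have ht : 2 ^+ j * t = (2 ^ j).-1%:R by rewrite /t mulrC divfK// gt_eqF.
have t1 : t < 1 by rewrite /t ltr_pdivrMr// mul1r hp; lra.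
rewrite (le_lt_trans _ t1)// leNgt; apply/negP => h.
have := cantor_fun_lt t0 h; apply/negP; rewrite -ltNge.
apply: (@lt_le_trans _ _ (cantor_left delta j (grid_index j t))); last exact: quantile_ge.
rewrite (@grid_index_eq _ _ _ (2 ^ j).-1) ?cantor_left_last; first by lra.
by rewrite ht lexx ltr_nat ltnS /=.
Qed.

End cantor_function.

(** * Convex combinations with weights 2^-(i+1) *)

Section dyadic_mixture.
Context {R : realType}.
Implicit Types u v : nat -> R.

Definition mixture u : R := limn (series (fun i => 2 ^- i.+1 * u i)).

Let weight_ge0 i : 0 <= 2 ^- i :> R. Proof. by rewrite invr_ge0 exprn_ge0. Qed.

Lemma series_weight n : series (fun i => 2 ^- i.+1 : R) n = 1 - 2 ^- n.
Proof.
elim: n => [|n IH]; first by rewrite /series/= big_geq// expr0 invr1 subrr.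
have -> : series (fun i => 2 ^- i.+1 : R) n.+1 = series (fun i => 2 ^- i.+1 : R) n + 2 ^- n.+1.
  by rewrite /series/= big_nat_recr.
by rewrite IH exprS invfM; lra.
Qed.

Lemma mixture_cvg u : (forall i, 0 <= u i <= 1) ->
  series (fun i => 2 ^- i.+1 * u i) @ \oo --> mixture u.
Proof.
move=> u01; apply: nondecreasing_is_cvgn.
  by apply: nondecreasing_series => i _ _; have /andP[u0 _] := u01 i; rewrite mulr_ge0.
exists 1 => _ [n _ <-].
apply: (@le_trans _ _ (series (fun i => 2 ^- i.+1 : R) n)).
  apply: ler_sum => i _; have /andP[_ u1] := u01 i.
  by rewrite ler_piMr.
by rewrite series_weight gerBl.
Qed.

Lemma mixture_le_add u v K : (forall i, 0 <= u i <= 1) -> (forall i, 0 <= v i <= 1) ->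
  0 <= K -> (forall i, u i <= v i + K) -> mixture u <= mixture v + K.
Proof.
move=> u01 v01 K0 uv.
have cv : (fun n => series (fun i => 2 ^- i.+1 * v i) n + K) @ \oo --> mixture v + K.
  by apply: cvgD; [exact: mixture_cvg | exact: cvg_cst].
rewrite -(cvg_lim _ cv)//; apply: ler_lim; first exact: mixture_cvg.
  by apply/cvg_ex; eexists; exact: cv.
near=> n.
apply: (@le_trans _ _ (series (fun i => 2 ^- i.+1 * v i + 2 ^- i.+1 * K) n)).
  by apply: ler_sum => i _; rewrite -mulrDr ler_wpM2l.
have -> : series (fun i => 2 ^- i.+1 * v i + 2 ^- i.+1 * K) n =
  series (fun i => 2 ^- i.+1 * v i) n + series (fun i => 2 ^- i.+1) n * K.
  by rewrite /series/= big_split/= mulr_suml.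
by rewrite lerD2l series_weight ler_piMl// gerBl.
Unshelve. all: by end_near. Qed.

(** All terms of the difference are nonnegative, and only the k-th is kept. *)
Lemma mixture_gap u v k : (forall i, 0 <= u i <= 1) -> (forall i, 0 <= v i <= 1) ->
  (forall i, u i <= v i) -> mixture u + 2 ^- k.+1 * (v k - u k) <= mixture v.
Proof.
move=> u01 v01 uv.
have cu : (fun n => series (fun i => 2 ^- i.+1 * u i) n + 2 ^- k.+1 * (v k - u k))
   @ \oo --> mixture u + 2 ^- k.+1 * (v k - u k).
  by apply: cvgD; [exact: mixture_cvg | exact: cvg_cst].
rewrite -(cvg_lim _ cu)//; apply: ler_lim; last 1 first.
- near=> n; have kn : (k < n)%N by near: n; exists k.+1.
  rewrite /series/= !big_mkord (bigD1 (Ordinal kn))//= [leRHS](bigD1 (Ordinal kn))//=.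
  rewrite addrAC mulrBr (addrC (_ * u k)) subrK lerD2l.
  by rewrite ler_sum// => i _; rewrite ler_wpM2l.
- by apply/cvg_ex; eexists; exact: cu.
- exact: mixture_cvg.
Unshelve. all: by end_near. Qed.

Lemma mixture_le u v : (forall i, 0 <= u i <= 1) -> (forall i, 0 <= v i <= 1) ->
  (forall i, u i <= v i) -> mixture u <= mixture v.
Proof.
move=> u01 v01 uv; rewrite -[mixture v]addr0 mixture_le_add// => i.
by rewrite addr0.
Qed.

Lemma mixture0 : mixture (fun=> 0) = 0.
Proof.
rewrite /mixture (_ : series _ = fun=> 0) ?lim_cst//.
by apply/funext => n; rewrite /series/= big1// => i _; rewrite mulr0.
Qed.

Lemma mixture1 : mixture (fun=> 1) = 1.
Proof.
have -> : mixture (fun=> 1) = limn (fun n => 1 - (2^-1 : R) ^+ n).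
  rewrite /mixture; congr (limn _); apply/funext => n.
  under eq_fun do rewrite mulr1.
  by rewrite series_weight exprVn.
apply/cvg_lim => //; rewrite -[X in _ --> X]subr0; apply: cvgB; first exact: cvg_cst.
by apply: cvg_expr; rewrite ger0_norm ?invr_ge0// invf_lt1// ltr1n.
Qed.

Lemma mixture_eseries u : (forall i, 0 <= u i <= 1) ->
  ((mixture u)%:E = \sum_(0 <= i <oo) (2 ^- i.+1 * u i)%:E)%E.
Proof.
move=> u01; apply/esym/cvg_lim => //.
rewrite (_ : (fun n => _) = EFin \o series (fun i => 2 ^- i.+1 * u i)).
  by apply: cvg_EFin; [exact: nearW | exact: mixture_cvg].
by apply/funext => n; rewrite /series/= sumEFin.
Qed.

End dyadic_mixture.

(** * The slope function: a mixture of translated Cantor functions *)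

Section slope_function.
Context {R : realType}.
Variable delta : nat -> R.
Hypothesis delta_gt0 : forall j, 0 < delta j.
Hypothesis delta_half : forall j, 2 * delta j.+1 <= delta j.

(** A dense sequence in [0, [delta 0]]: an enumeration of the rationals, clamped to [0, 1] and
    rescaled. A number that encodes no rational yields 0. *)
Definition shift (i : nat) : R :=
  delta 0 * Num.min 1 (Num.max 0 (ratr (odflt 0 (unpickle i)))).

Lemma shift_itv i : 0 <= shift i <= delta 0.
Proof.
rewrite /shift mulr_ge0 ?(ltW (delta_gt0 0))//=; last by rewrite le_min ler01 le_max lexx.
by rewrite ler_piMr ?(ltW (delta_gt0 0))// ge_min lexx.
Qed.

Lemma shift_dense x y : 0 <= x -> x < y -> y <= delta 0 -> exists i, x < shift i < y.
Proof.
move=> x0 xy y1; have d0 := delta_gt0 0.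
have xy' : x / delta 0 < y / delta 0 by rewrite ltr_pM2r// invr_gt0.
have [r] := rat_in_itvoo xy'; rewrite in_itv/= => /andP[xr ry].
exists (pickle r); rewrite /shift pickleK/=.
have r0 : 0 <= ratr r :> R by rewrite (le_trans _ (ltW xr))// divr_ge0// ltW.
have r1 : ratr r <= 1 :> R by rewrite (le_trans (ltW ry))// ler_pdivrMr// mul1r.
rewrite max_r// min_r//; move: xr ry; rewrite ltr_pdivrMr// ltr_pdivlMr//.
by rewrite mulrC => -> ->.
Qed.

(** Averaging translates preserves the modulus of continuity, while the density of the translations
    destroys the intervals of constancy that a single Cantor function may have. *)
Definition slope (x : R) : R := mixture (fun i => cantor_fun delta (x - shift i)).

Let c01 x i : 0 <= cantor_fun delta (x - shift i) <= 1.
Proof. by rewrite cantor_fun_ge0// cantor_fun_le1. Qed.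

Lemma slope_nd x y : x <= y -> slope x <= slope y.
Proof. by move=> xy; apply: mixture_le => // i; rewrite cantor_fun_nd// lerD2r. Qed.

Lemma slope0 x : x <= 0 -> slope x = 0.
Proof.
move=> x0; rewrite -[RHS]mixture0; congr (mixture _); apply/funext => i.
by rewrite cantor_fun0//; have := shift_itv i; lra.
Qed.

Lemma slope1 x : 2 * delta 0 <= x -> slope x = 1.
Proof.
move=> x0; rewrite -[RHS]mixture1; congr (mixture _); apply/funext => i.
by rewrite cantor_fun1//; have := shift_itv i; lra.
Qed.

Lemma slope_ge0 x : 0 <= slope x.
Proof. by rewrite -mixture0; apply: mixture_le => // [i|i]; rewrite ?lexx ?ler01//; case/andP: (c01 x i). Qed.

Lemma slope_le1 x : slope x <= 1.
Proof. by rewrite -mixture1; apply: mixture_le => // [i|i]; rewrite ?lexx ?ler01//; case/andP: (c01 x i). Qed.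

Lemma slope_close j x y : y <= x + delta j -> slope y <= slope x + 2 * 2 ^- j.
Proof.
move=> yx; apply: mixture_le_add; [exact: c01 | exact: c01 | | move=> i].
  by rewrite mulr_ge0// invr_ge0 exprn_ge0.
by apply: cantor_fun_close => //; lra.
Qed.

Lemma slope_gap i x y : x <= y -> slope x +
  2 ^- i.+1 * (cantor_fun delta (y - shift i) - cantor_fun delta (x - shift i)) <= slope y.
Proof.
move=> xy; apply: (@mixture_gap _ (fun i => cantor_fun delta (x - shift i)) (fun i => cantor_fun delta (y - shift i))) => // k.
by rewrite cantor_fun_nd// lerD2r.
Qed.

(** One strictly increasing term suffices. If x < [delta 0], some translated Cantor set starts
    between x and y, so its function is 0 at x and positive at y. Otherwise some translate ends
    between x and y, and its function is below 1 at x and equal to 1 at y. *)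
Lemma slope_lt x y : 0 <= x -> x < y -> y <= 2 * delta 0 -> slope x < slope y.
Proof.
move=> x0 xy y1; have d0 := delta_gt0 0.
have pos i u : 0 < u -> 0 < 2 ^- i.+1 * u :> R.
  by move=> u0; rewrite mulr_gt0// invr_gt0 exprn_gt0.
have [xd|dx] := ltP x (delta 0).
  have xm : x < Num.min y (delta 0) by rewrite lt_min xy xd.
  have md : Num.min y (delta 0) <= delta 0 by rewrite ge_min lexx orbT.
  have [i /andP[xi iy]] := shift_dense x0 xm md.
  have {}iy : shift i < y by rewrite (lt_le_trans iy)// ge_min lexx.
  apply: lt_le_trans (slope_gap i (ltW xy)); rewrite ltrDl pos//.
  rewrite (@cantor_fun0 _ _ _ _ (x - shift i))//; last by lra.
  by rewrite subr0 cantor_fun_gt0//; lra.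
have h1 : 0 <= x - delta 0 by lra.
have h2 : x - delta 0 < y - delta 0 by lra.
have h3 : y - delta 0 <= delta 0 by lra.
have [i /andP[xi iy]] := shift_dense h1 h2 h3.
apply: lt_le_trans (slope_gap i (ltW xy)); rewrite ltrDl pos//.
rewrite (@cantor_fun1 _ _ _ _ (y - shift i))//; last by lra.
by rewrite subr_gt0 cantor_fun_lt1//; lra.
Qed.

(** Along the i-th translated Cantor set the i-th term alone grows linearly in the parameter, since
    [cantor_fun] inverts [quantile]. This lower bound on the growth of the slope replaces curvature
    in the Fourier estimate. *)
Lemma slope_quantile_gap i s t : 0 <= s -> s <= t -> t < 1 ->
  slope (shift i + quantile delta s) + 2 ^- i.+1 * (t - s) <=
  slope (shift i + quantile delta t).
Proof.
move=> s0 st t1.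
have qst : shift i + quantile delta s <= shift i + quantile delta t.
  by rewrite lerD2l quantile_nd.
have := slope_gap i qst; rewrite ![shift i + _]addrC !addrK.
by rewrite !cantor_fun_quantile//; apply/andP; split; lra.
Qed.

Lemma slope_eseries x : ((slope x)%:E =
  \sum_(0 <= i <oo) (2 ^- i.+1 * cantor_fun delta (x - shift i))%:E)%E.
Proof. exact: mixture_eseries. Qed.

Lemma shift_quantile_itv i t : 0 <= t < 1 -> 0 <= shift i + quantile delta t <= 2 * delta 0.
Proof.
move=> /[dup] t01 /andP[t0 t1]; have := shift_itv i.
by have := quantile_ge0 delta_gt0 delta_half t0; have := quantile_le1 delta_gt0 delta_half t01; lra.
Qed.

Definition oslope (x : R) : R := slope x - slope (- x).

Lemma oslopeN x : oslope (- x) = - oslope x.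
Proof. by rewrite /oslope opprK opprB. Qed.

Lemma oslope_nd x y : x <= y -> oslope x <= oslope y.
Proof. by move=> xy; rewrite lerB// slope_nd// lerN2. Qed.

Lemma oslopeE x : 0 <= x -> oslope x = slope x.
Proof. by move=> x0; rewrite /oslope (slope0 (_ : - x <= 0)) ?oppr_le0// subr0. Qed.

Lemma oslope1 x : 2 * delta 0 <= x -> oslope x = 1.
Proof. by move=> x0; rewrite oslopeE ?slope1//; have := delta_gt0 0; lra. Qed.

Lemma oslope_lt x y : - (2 * delta 0) <= x -> x < y -> y <= 2 * delta 0 ->
  oslope x < oslope y.
Proof.
move=> xa xy ya; have [x0|x0] := leP 0 x.
  by rewrite !oslopeE ?slope_lt//; lra.
have [y0|y0] := leP y 0.
  by rewrite -[x]opprK -[y]opprK !(oslopeN (- _)) ltrN2 !oslopeE ?slope_lt//; lra.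
have hx : 0 < oslope (- x).
  by rewrite oslopeE ?(le_lt_trans (slope_ge0 0) _) ?slope_lt//; lra.
have hy : 0 < oslope y by rewrite oslopeE ?(le_lt_trans (slope_ge0 0) _) ?slope_lt//; lra.
by rewrite (lt_trans _ hy)// -oppr_gt0 -oslopeN.
Qed.

Lemma oslope_close j x y : y <= x + delta j -> oslope y <= oslope x + 4 * 2 ^- j.
Proof.
move=> yx; have := slope_close yx.
have : - x <= - y + delta j by lra.
by move=> /slope_close; rewrite /oslope; lra.
Qed.

Lemma oslope_continuous : continuous oslope.
Proof.
move=> x; apply/cvgrPdist_lt => e e0.
have e4 : 0 < e / 4 by rewrite divr_gt0.
have [j hj] := exp2V_small e4.
near=> y; have : `|x - y| < delta j by near: y; apply: cvgr_dist_lt => //; exact: delta_gt0.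
rewrite ltr_distl => /andP[h1 h2].
have g1 : oslope x <= oslope y + 4 * 2 ^- j by apply: oslope_close; lra.
have g2 : oslope y <= oslope x + 4 * 2 ^- j by apply: oslope_close; lra.
by rewrite ltr_distl; apply/andP; split; lra.
Unshelve. all: by end_near. Qed.

End slope_function.

(*BODY*)

Section antiderivative.
Context {R : realType}.
Implicit Types f : R -> R.
Notation mu := (@lebesgue_measure R).

Lemma antiderivative_half f b : continuous f -> (forall x, x <= b -> f x = 0) ->
  exists F : R -> R, forall x : R, is_derive x 1 F (f x).
Proof.
move=> cf f0.
exists (fun x => \int[mu]_(t in [set` Interval -oo%O (BRight x)]) f t) => x.
have xx1 : x < x + 1 by rewrite ltrDl.
have fint : mu.-integrable [set` Interval -oo%O (BRight (x + 1))] (EFin \o f).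
  rewrite integrable_mkcond//.
  have -> : (EFin \o f) \_ [set` Interval -oo%O (BRight (x + 1))] =
      (EFin \o f) \_ [set` `[Num.min b (x + 1), x + 1]].
    apply/funext => y; rewrite !patchE !mem_setE !in_itv/= ge_min.
    case: (leP y (x + 1)) => // yx; last by rewrite andbF.
    rewrite andbT; case: (leP b y) => //= yb; first by rewrite (f0 y (ltW yb)) if_same.
  rewrite -integrable_mkcond//.
  apply: continuous_compact_integrable; first exact: segment_compact.
  exact: continuous_subspaceT.
have [|h1 h2] := @continuous_FTC1 _ f -oo%O x (x + 1) xx1 fint _ (cf x).
  by rewrite ltNyr.
by split => //; rewrite -derive1E h2.
Qed.

(** The function is split at 0: f(max(x, 0)) - f(0) vanishes on the left half-line, so
    [antiderivative_half] applies; the other half is reflected, and a linear term restores f(0). *)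
Lemma continuous_antiderivative f : continuous f ->
  exists F : R -> R, F 0 = 0 /\ forall x : R, is_derive x 1 F (f x).
Proof.
move=> cf.
have cmax : continuous (fun x : R => Num.max x 0).
  by move=> x; apply: continuous_max; [exact: cvg_id | exact: cvg_cst].
have cmin : continuous (fun x : R => Num.min (- x) 0).
  move=> x; apply: continuous_min; [exact: opp_continuous | exact: cvg_cst].
have [F dF] : exists F : R -> R, forall x : R, is_derive x 1 F (f (Num.max x 0) - f 0).
  apply: (@antiderivative_half _ 0) => [x|x x0]; last by rewrite max_r// subrr.
  by apply: cvgB; [apply: continuous_comp; [exact: cmax | exact: cf] | exact: cvg_cst].
have [G dG] : exists F : R -> R, forall x : R, is_derive x 1 F (f (Num.min (- x) 0) - f 0).
  apply: (@antiderivative_half _ 0) => [x|x x0]; last by rewrite min_r ?subrr// oppr_ge0.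
  by apply: cvgB; [apply: continuous_comp; [exact: cmin | exact: cf] | exact: cvg_cst].
exists (fun x => F x - G (- x) + f 0 * x - (F 0 - G 0)); split.
  by rewrite oppr0 mulr0 addr0 subrr.
move=> x.
have dGN : is_derive x 1 (fun x => G (- x)) (- (f (Num.min x 0) - f 0)).
  have h1 := @is_deriveNid _ _ x 1.
  have := dG (- x); rewrite opprK => h2.
  have := @is_derive1_comp _ G (fun x => - x) x _ _ h2 h1.
  by rewrite mulrN1.
have := dF x => dFx.
apply: is_derive_eq.
rewrite subr0 /GRing.scale/= mulr1.
by have [h|h] := leP x 0; lra.
Qed.

(** Convexity as a tangent-line inequality, by the mean value theorem. *)
Lemma antiderivative_tangent f F : {homo f : x y / x <= y} ->
  (forall x : R, is_derive x 1 F (f x)) -> forall x y, F x + f x * (y - x) <= F y.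
Proof.
move=> nd dF x y.
have cF (z w : R) : {within `[z, w], continuous F}.
  by apply: derivable_within_continuous => u _; case: (dF u).
have [xy|yx|->] := ltgtP x y; last by rewrite subrr mulr0 addr0.
  have [c + h] := MVT xy (fun z _ => dF z) (cF _ _).
  rewrite in_itv/= => /andP[xc _].
  rewrite -lerBrDl h ler_pM2r ?subr_gt0//; exact/nd/ltW.
have [c + h] := MVT yx (fun z _ => dF z) (cF _ _).
rewrite in_itv/= => /andP[_ cx].
rewrite -lerBrDl -opprB -(opprB (F x)) h mulrN lerN2 ler_pM2r ?subr_gt0//.
exact/nd/ltW.
Qed.

Lemma is_derive1_continuous f F : (forall x : R, is_derive x 1 F (f x)) -> continuous F.
Proof.
by move=> dF x; apply: differentiable_continuous; apply/derivable1_diffP; case: (dF x).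
Qed.

Lemma antiderivative_unique f F G : (forall x : R, is_derive x 1 F (f x)) ->
  (forall x : R, is_derive x 1 G (f x)) -> F 0 = G 0 -> F =1 G.
Proof.
move=> dF dG FG0 x.
have dFG (z : R) : is_derive z 1 (F - G) 0.
  by have := dF z; have := dG z => h1 h2; apply: is_derive_eq; rewrite subrr.
have := is_derive_0_is_cst x 0 dFG; rewrite !fctE FG0 subrr => /eqP.
by rewrite subr_eq0 => /eqP.
Qed.

End antiderivative.

(** * Global inverse of a function with derivative bounded below *)

Section inverse.
Context {R : realType}.

Lemma C1_inverse (h H : R -> R) m : 0 < m -> continuous h -> (forall y, m <= h y) ->
  (forall y : R, is_derive y 1 H (h y)) ->
  exists K : R -> R, [/\ cancel K H, cancel H K &
    forall t : R, is_derive t 1 K (h (K t))^-1].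
Proof.
move=> m0 ch hm dH.
have cH : continuous H by exact: is_derive1_continuous dH.
have Hgap x y : x < y -> m * (y - x) <= H y - H x.
  move=> xy; have [c _ ->] := MVT xy (fun z _ => dH z) (continuous_subspaceT cH).
  by rewrite ler_pM2r ?subr_gt0.
have Hinj : injective H.
  move=> x y e; apply: contra_eq e; rewrite neq_lt => /orP[] xy; rewrite neq_lt.
    have := Hgap _ _ xy; have := mulr_gt0 m0 (_ : 0 < y - x); rewrite subr_gt0 => /(_ xy) h1 h2.
    by apply/orP; left; lra.
  have := Hgap _ _ xy; have := mulr_gt0 m0 (_ : 0 < x - y); rewrite subr_gt0 => /(_ xy) h1 h2.
  by apply/orP; right; lra.
have Hsurj t : exists y, H y = t.
  (* Over a distance M the function H moves by at least m * M = |t - H 0| + 1, so t lies between H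
     (- M) and H M. *)
  pose M := (`|t - H 0| + 1) / m.
  have M0 : 0 < M by rewrite divr_gt0// ltr_pwDr.
  have eM : m * M = `|t - H 0| + 1 by rewrite /M mulrC divfK// gt_eqF.
  have h1 := Hgap 0 M M0.
  have M0' : - M < 0 by rewrite oppr_lt0.
  have h2 := Hgap (- M) 0 M0'.
  rewrite subr0 eM in h1; rewrite opprK add0r eM in h2.
  have hle : - M <= M by lra.
  have h3 := ler_norm (t - H 0); have := ler_norm (- (t - H 0)); rewrite normrN => h4.
  have hv : Num.min (H (- M)) (H M) <= t <= Num.max (H (- M)) (H M).
    by rewrite ge_min le_max; apply/andP; split; apply/orP; [left|right]; lra.
  have [y _ <-] := IVT hle (continuous_subspaceT cH) hv.
  by exists y.
pose K t := get [set y | H y = t].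
have KK : cancel K H by move=> t; have := getPex (Hsurj t).
have HK : cancel H K by move=> y; apply: Hinj; rewrite KK.
exists K; split => // t.
rewrite -{1}[t]KK; apply: is_derive_inverse => //.
- by near=> z; exact: HK.
- by near=> z; exact: cH.
- by rewrite gt_eqF// (lt_le_trans m0).
Unshelve. all: by end_near. Qed.

End inverse.

(** * The convex region of a slope profile *)

Section region.
Context {R : realType}.

(** The properties of a slope function f and its antiderivative phi on which the geometry rests. The
    value 1 from a on makes the arcs of the boundary meet on the diagonals with matching tangents;
    strict growth on [-a, a] gives strict convexity. *)
Record profile (a : R) (f phi : R -> R) : Prop := Profile {
  profile_gt0 : 0 < a;
  profile_continuous : continuous f;
  profile_odd : forall x, f (- x) = - f x;
  profile_nd : {homo f : x y / x <= y};
  profile_eq1 : forall x, a <= x -> f x = 1;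
  profile_lt : forall x y, - a <= x -> x < y -> y <= a -> f x < f y;
  profile_derive : forall x : R, is_derive x 1 phi (f x);
  profile0 : phi 0 = 0 }.

Variables (a : R) (f phi : R -> R).
Hypothesis fphi : profile a f phi.

Let a_gt0 := profile_gt0 fphi.
Let f_continuous := profile_continuous fphi.
Let f_odd := profile_odd fphi.
Let f_nd := profile_nd fphi.
Let f_eq1 := profile_eq1 fphi.
Let f_lt := profile_lt fphi.
Let phi_derive := profile_derive fphi.
Let phi0 := profile0 fphi.

Lemma f0 : f 0 = 0.
Proof. by have := f_odd 0; rewrite oppr0 => h; lra. Qed.

Lemma f_gt0 x : 0 < x -> 0 < f x.
Proof.
move=> x0; have [xa|/ltW ax] := leP x a; last by rewrite f_eq1.
by rewrite -f0 f_lt// lerNl oppr0 ltW.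
Qed.

Lemma f_le1 x : f x <= 1.
Proof. by rewrite -(f_eq1 (_ : a <= Num.max a x)) ?f_nd// le_max lexx ?orbT. Qed.

Lemma phi_tangent x y : phi x + f x * (y - x) <= phi y.
Proof. exact: (antiderivative_tangent f_nd phi_derive). Qed.

Lemma phi_continuous : continuous phi.
Proof. exact: (is_derive1_continuous phi_derive). Qed.

Lemma phi_even x : phi (- x) = phi x.
Proof.
have d (z : R) : is_derive z 1 (fun x => phi (- x)) (f z).
  have h1 := @is_deriveNid _ _ z 1.
  have h2 := phi_derive (- z).
  have := @is_derive1_comp _ phi (fun x => - x) z _ _ h2 h1.
  by rewrite mulrN1 f_odd opprK.
by apply: (antiderivative_unique d phi_derive); rewrite oppr0.
Qed.

Lemma phi_ge0 x : 0 <= phi x.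
Proof. by have := phi_tangent 0 x; rewrite f0 mul0r addr0 phi0. Qed.

Lemma phi_lt x y : 0 <= x -> x < y -> phi x < phi y.
Proof.
move=> x0 xy; pose m := (x + y) / 2.
have m0 : 0 < f m by apply: f_gt0; rewrite /m; lra.
have h1 := phi_tangent m y; have h2 : phi x <= phi m.
  have := phi_tangent x m; have : 0 <= f x * (m - x).
    by rewrite mulr_ge0//; [rewrite -f0 f_nd | rewrite /m; lra].
  by lra.
have : 0 < f m * (y - m) by rewrite mulr_gt0// /m; lra.
by lra.
Qed.

Lemma phi_nd x y : 0 <= x -> x <= y -> phi x <= phi y.
Proof. by move=> x0; rewrite le_eqVlt => /predU1P[->//|/(phi_lt x0)/ltW]. Qed.

Lemma phi_norm x : phi `|x| = phi x.
Proof. by case: (ger0P x) => _ //; rewrite phi_even. Qed.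

Lemma phi_ltW x y : 0 <= x -> 0 <= y -> phi x < phi y -> x < y.
Proof. by move=> x0 y0 h; rewrite ltNge; apply: contraL h => yx; rewrite -leNgt phi_nd. Qed.

Lemma phi_out x : a <= x -> phi x = phi a + (x - a).
Proof.
move=> ax; have h1 := phi_tangent a x; have h2 := phi_tangent x a.
by rewrite !f_eq1// in h1 h2; lra.
Qed.

Lemma phi_gt0 x : 0 < x -> 0 < phi x.
Proof. by move=> x0; rewrite -phi0 phi_lt. Qed.

Lemma phi_a_le : phi a <= a.
Proof. by have := phi_tangent a 0; rewrite f_eq1// phi0; lra. Qed.

Lemma phi_scale x t : 0 <= t <= 1 -> phi (t * x) <= t * phi x.
Proof.
move=> /andP[t0 t1]; have h1 := phi_tangent (t * x) x; have h2 := phi_tangent (t * x) 0.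
rewrite phi0 in h2.
have h3 := ler_wpM2l t0 h1; have h4 : (1 - t) * (phi (t * x) + f (t * x) * (0 - t * x)) <= 0.
  by rewrite mulr_ge0_le0// subr_ge0.
by lra.
Qed.

Definition gauge (z : R * R) := phi z.1 + phi z.2.

(** A sublevel set of a convex function. As phi has slope 1 beyond a, the upper part of the boundary
    over [-a, a] is the graph y = a + phi a - phi x, and the boundary consists of four congruent
    such arcs meeting at the points with both coordinates a or -a. *)
Definition region : set (R * R) := [set z | gauge z < 2 * phi a].

Lemma gauge_continuous : continuous gauge.
Proof.
move=> z; apply: cvgD.
- by apply: (@continuous_comp _ _ _ fst phi z); [exact: cvg_fst | exact: phi_continuous].
- by apply: (@continuous_comp _ _ _ snd phi z); [exact: cvg_snd | exact: phi_continuous].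
Qed.

Lemma gauge_scale t z : 0 <= t <= 1 -> gauge (t *: z) <= t * gauge z.
Proof. by move=> t01; rewrite /gauge mulrDr lerD// phi_scale. Qed.

Lemma gaugeN z : gauge (- z) = gauge z.
Proof. by rewrite /gauge !phi_even. Qed.

Lemma gauge_tangent z w :
  gauge z + (f z.1 * (w.1 - z.1) + f z.2 * (w.2 - z.2)) <= gauge w.
Proof. by rewrite /gauge; have := phi_tangent z.1 w.1; have := phi_tangent z.2 w.2; lra. Qed.

Lemma region_open : open region.
Proof.
apply: (@open_comp _ _ gauge [set x | x < 2 * phi a]); last exact: open_lt.
by move=> z _; exact: gauge_continuous.
Qed.

Lemma region_scale t z : 0 <= t < 1 -> gauge z <= 2 * phi a -> region (t *: z).
Proof.
move=> /andP[t0 t1] gz; have t01 : 0 <= t <= 1 by rewrite t0 ltW.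
rewrite /region/= (le_lt_trans (gauge_scale z t01))//.
have h := phi_gt0 a_gt0; have := ler_wpM2l t0 gz.
by have := ltr_pM2r h t 1; rewrite t1 mul1r; lra.
Qed.

Lemma gauge_ge0 z : 0 <= gauge z.
Proof. by rewrite addr_ge0// phi_ge0. Qed.

Lemma closure_region : closure region = [set z | gauge z <= 2 * phi a].
Proof.
apply/seteqP; split.
  rewrite closureE; apply: smallest_sub; last by move=> z /ltW.
  apply: (@closed_comp _ _ gauge [set x | x <= 2 * phi a]); last exact: closed_le.
  by move=> z _; exact: gauge_continuous.
move=> z /= gz B Bz.
(* A point of the closed sublevel set is the limit of its contractions towards 0, which lie in the
   region. *)
have h : (fun t : R => (1 - t) *: z) @ 0^'+ --> z.
  rewrite -[X in _ --> X]scale1r; apply: cvgZr_tmp; rewrite -[X in _ --> X]subr0.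
  apply: cvgB; first exact: cvg_cst.
  exact: cvg_at_right_filter.
have h1 : \forall t \near 0^'+, B ((1 - t) *: z) by exact: h.
near (0 : R)^'+ => t.
exists ((1 - t) *: z); split; last by near: t.
have t0 : 0 < t by near: t; exact: nbhs_right_gt.
have t1 : t < 1 by near: t; exact: nbhs_right_lt.
by apply: region_scale => //; apply/andP; split; lra.
Unshelve. all: by end_near. Qed.

Lemma boundary_region : boundary region = [set z | gauge z = 2 * phi a].
Proof.
rewrite /boundary closure_region (interior_id region).1; last exact: region_open.
apply/seteqP; split => z /=.
  by move=> [h1 h2]; apply/eqP; rewrite eq_le h1 leNgt; apply/negP.
by move=> e; rewrite /region/= e lexx ltxx.
Qed.

Lemma region_bound z : region z -> `|z.1| <= 2 * a /\ `|z.2| <= 2 * a.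
Proof.
have b x y : phi x + phi y < 2 * phi a -> `|x| <= 2 * a.
  move=> h; have [ax|ax] := leP `|x| a; first by have := a_gt0; lra.
  have := phi_out (ltW ax); rewrite phi_norm => e.
  by have := phi_a_le; have := phi_ge0 y; lra.
by move=> h; split; [apply: b h | apply: (b _ z.1); rewrite addrC].
Qed.

Lemma region_bounded : bounded_set region.
Proof.
exists (2 * a); split; first exact: num_real.
move=> M aM z /region_bound[h1 h2] /=.
by rewrite prod_normE ge_max (le_trans h1 (ltW aM)) (le_trans h2 (ltW aM)).
Qed.

Lemma region0 : region 0.
Proof. by rewrite /region/= /gauge/= phi0 addr0 mulr_gt0// phi_gt0. Qed.

Lemma region_connected : connected region.
Proof.
(* The region is star-shaped about 0. *)
have -> : region = \bigcup_(z in region) ((fun t : R => t *: z) @` `[0, 1]).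
  apply/seteqP; split => [z Dz|_ [z Dz [t] + <-]].
    by exists z => //; exists 1; rewrite ?scale1r//= in_itv/= lexx ler01.
  rewrite /= in_itv/= => /andP[t0 t1].
  rewrite /region/= (le_lt_trans (gauge_scale z _)) ?t0//.
  by rewrite (le_lt_trans _ Dz)// ler_piMl// gauge_ge0.
apply: bigcup_connected.
  exists 0 => z _; exists 0; rewrite ?scale0r//= in_itv/= lexx ler01//.
move=> z _; apply: connected_continuous_connected; first exact: segment_connected.
apply: continuous_subspaceT => t.
by apply: cvgZr_tmp; exact: cvg_id.
Qed.

Lemma region_domain : domain region.
Proof.
by split; [exists 0; exact: region0 | exact: region_open | exact: region_connected].
Qed.

Lemma enorm_sqr (z : R * R) : enorm z ^+ 2 = z.1 ^+ 2 + z.2 ^+ 2.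
Proof. by rewrite /enorm sqr_sqrtr /dot -?expr2// addr_ge0// sqr_ge0. Qed.

Lemma enorm_eq1 (z : R * R) : z.1 ^+ 2 + z.2 ^+ 2 = 1 <-> enorm z = 1.
Proof.
rewrite -enorm_sqr; split => [/eqP|->]; last by rewrite expr1n.
rewrite -[X in _ == X](expr1n _ 2) eqrXn2// ?sqrtr_ge0// => /eqP//.
Qed.

Lemma dot_continuous (e : R * R) : continuous (fun w => dot w e).
Proof.
move=> w; apply: cvgD; apply: cvgM; do ?exact: cvg_cst.
- exact: cvg_fst.
- exact: cvg_snd.
Qed.

(** At height at least a over the e1-axis, phi can be inverted in the e2-coordinate. For a globally
    defined C^1 function g, phi is replaced by H, which agrees with phi above b = a/2 and continues
    affinely below b with slope f b > 0; then [C1_inverse] applies to H. *)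
Lemma region_local_graph z e1 e2 : enorm e1 = 1 -> enorm e2 = 1 -> dot e1 e2 = 0 ->
  (forall w, gauge w = phi (dot w e1) + phi (dot w e2)) ->
  gauge z = 2 * phi a -> a <= dot z e2 ->
  exists g, local_C1_graph (boundary region) z e1 e2 g.
Proof.
move=> n1 n2 e12 gE gz az; pose b := a / 2.
have b0 : 0 < b by rewrite divr_gt0.
have ba : b < a by rewrite /b; have := a_gt0; lra.
pose h y := f (Num.max y b).
have ch : continuous h.
  move=> y; apply: continuous_comp; last exact: f_continuous.
  by apply: continuous_max; [exact: cvg_id | exact: cvg_cst].
have hm y : f b <= h y by rewrite f_nd// le_max lexx orbT.
have [H0 [_ dH0]] := continuous_antiderivative ch.
pose H y := H0 y + (phi b - H0 b).
have dH (y : R) : is_derive y 1 H (h y).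
  by have d := dH0 y; apply: is_derive_eq; rewrite addr0.
have HE y : b < y -> H y = phi y.
  move=> hby; have dG (t : R) : is_derive t 1 (H - phi) (h t - f t) by have := dH t; have := phi_derive t => ? ?; exact: is_deriveB.
  have cG := is_derive1_continuous dG.
  have [c + e] := MVT hby (fun t _ => dG t) (continuous_subspaceT cG).
  rewrite in_itv/= => /andP[bc _]; move: e.
  by rewrite /h max_l ?ltW// subrr mul0r !fctE /H; lra.
have [K [KH HK dK]] := C1_inverse (f_gt0 b0) ch hm dH.
have cK : continuous K by exact: is_derive1_continuous dK.
pose g s := K (2 * phi a - phi s).
have dg (s : R) : is_derive s 1 g ((h (g s))^-1 * - f s).
  have d1 : is_derive s 1 (fun s => 2 * phi a - phi s) (- f s).
    by have := is_deriveB (is_derive_cst (2 * phi a) s 1) (phi_derive s); rewrite sub0r.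
  exact: (@is_derive1_comp _ K (fun s => 2 * phi a - phi s) s _ _ (dK _) d1).
have cg : continuous g by exact: is_derive1_continuous dg.
exists g; split => //.
  split => [s|]; first by case: (dg s).
  have -> : derive1 g = fun s => (h (g s))^-1 * - f s.
    by apply/funext => s; rewrite derive1E; case: (dg s).
  move=> s; apply: cvgM; last by apply: cvgN; exact: f_continuous.
  apply: cvgV; first by rewrite gt_eqF// (lt_le_trans (f_gt0 b0)).
  by apply: continuous_comp; [exact: cg | exact: ch].
near=> w; have bw : b < dot w e2.
  near: w; apply: (cvgr_gt (dot z e2)); first exact: dot_continuous.
  by rewrite (lt_le_trans ba).
rewrite boundary_region/= gE /g -(HE _ bw); split => [e|->].
  by rewrite -[LHS]HK; congr K; lra.
by rewrite KH; lra.
Unshelve. all: by end_near. Qed.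

Lemma boundary_far z : gauge z = 2 * phi a -> a <= `|z.1| \/ a <= `|z.2|.
Proof.
rewrite /gauge -(phi_norm z.1) -(phi_norm z.2) => e.
have [h1|h1] := leP a `|z.1|; first by left.
have [h2|h2] := leP a `|z.2|; first by right.
by have := phi_lt (normr_ge0 _) h1; have := phi_lt (normr_ge0 _) h2; lra.
Qed.

(** One coordinate has absolute value at least a, so one of four axis-parallel frames puts the point
    at height at least a. *)
Lemma region_graph z : boundary region z ->
  exists e1 e2 g, local_C1_graph (boundary region) z e1 e2 g.
Proof.
move=> Bz; have gz : gauge z = 2 * phi a by move: Bz; rewrite boundary_region.
have [] := boundary_far gz; rewrite ler_normr => /orP[] az.
- have [g hg] : exists g, local_C1_graph (boundary region) z (0, 1) (1, 0) g.
    apply: region_local_graph; [| | | move=> w | exact: gz |].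
    + by apply/enorm_eq1; rewrite /=; ring.
    + by apply/enorm_eq1; rewrite /=; ring.
    + by rewrite /dot/=; ring.
    + by rewrite /gauge /dot/= !mulr0 !mulr1 add0r addr0 addrC.
    + by rewrite /dot/= mulr0 addr0 mulr1.
  by exists (0, 1), (1, 0), g; exact: hg.
- have [g hg] : exists g, local_C1_graph (boundary region) z (0, 1) (-1, 0) g.
    apply: region_local_graph; [| | | move=> w | exact: gz |].
    + by apply/enorm_eq1; rewrite /=; ring.
    + by apply/enorm_eq1; rewrite /=; ring.
    + by rewrite /dot/=; ring.
    + by rewrite /gauge /dot/= !mulr0 !mulr1 add0r addr0 mulrN1 phi_even addrC.
    + by rewrite /dot/= mulr0 addr0 mulrN1.
  by exists (0, 1), (-1, 0), g; exact: hg.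
- have [g hg] : exists g, local_C1_graph (boundary region) z (1, 0) (0, 1) g.
    apply: region_local_graph; [| | | move=> w | exact: gz |].
    + by apply/enorm_eq1; rewrite /=; ring.
    + by apply/enorm_eq1; rewrite /=; ring.
    + by rewrite /dot/=; ring.
    + by rewrite /gauge /dot/= !mulr0 !mulr1 add0r addr0.
    + by rewrite /dot/= mulr0 add0r mulr1.
  by exists (1, 0), (0, 1), g; exact: hg.
- have [g hg] : exists g, local_C1_graph (boundary region) z (1, 0) (0, -1) g.
    apply: region_local_graph; [| | | move=> w | exact: gz |].
    + by apply/enorm_eq1; rewrite /=; ring.
    + by apply/enorm_eq1; rewrite /=; ring.
    + by rewrite /dot/=; ring.
    + by rewrite /gauge /dot/= !mulr0 !mulr1 add0r addr0 mulrN1 phi_even.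
    + by rewrite /dot/= mulr0 add0r mulrN1.
  by exists (1, 0), (0, -1), g; exact: hg.
Qed.

(** * Outer normals and their modulus of continuity *)

Definition grad (z : R * R) : R * R := (f z.1, f z.2).
Definition normal (z : R * R) : R * R := (enorm (grad z))^-1 *: grad z.

Lemma enorm_ge0 (z : R * R) : 0 <= enorm z. Proof. exact: sqrtr_ge0. Qed.

Lemma f_sqr_eq1 x : a <= `|x| -> f x ^+ 2 = 1.
Proof.
rewrite ler_normr => /orP[] ax; first by rewrite f_eq1// expr1n.
by rewrite -[x]opprK f_odd f_eq1// sqrrN expr1n.
Qed.

Lemma grad_ge1 z : gauge z = 2 * phi a -> 1 <= enorm (grad z).
Proof.
move=> gz; rewrite -(ler_pXn2r (_ : 0 < 2)%N) ?nnegrE ?enorm_ge0// expr1n enorm_sqr/=.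
by have [/f_sqr_eq1 ->|/f_sqr_eq1 ->] := boundary_far gz; rewrite ?lerDl ?lerDr sqr_ge0.
Qed.

Lemma dotZl k (u v : R * R) : dot (k *: u) v = k * dot u v.
Proof. by rewrite /dot /= /GRing.scale/=; ring. Qed.

Lemma normal_unit z : gauge z = 2 * phi a -> (normal z).1 ^+ 2 + (normal z).2 ^+ 2 = 1.
Proof.
move=> /grad_ge1 g1; have g0 : enorm (grad z) != 0 by rewrite gt_eqF// (lt_le_trans ltr01).
have := enorm_sqr (grad z) => e.
rewrite /normal/= /GRing.scale/= !exprMn -mulrDr -e exprVn mulVf//.
by rewrite expf_neq0.
Qed.

(** A two-by-two matrix with orthonormal rows has orthonormal columns; [k], [k2] and [m1] are the
    relations between the columns. *)
Lemma orthonormal_decomp (e1 e2 z : R * R) : enorm e1 = 1 -> enorm e2 = 1 -> dot e1 e2 = 0 ->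
  z.1 = dot z e1 * e1.1 + dot z e2 * e2.1 /\ z.2 = dot z e1 * e1.2 + dot z e2 * e2.2.
Proof.
move=> /enorm_eq1; move: e1 e2 z => [c s] [c' s'] [x y] /= h1 /enorm_eq1/= h2.
rewrite /dot/= => h3.
have k : c ^+ 2 = s' ^+ 2.
  have h4 : (c * c') ^+ 2 = (s * s') ^+ 2 by rewrite (_ : c * c' = - (s * s')) ?sqrrN//; lra.
  rewrite -[LHS]mulr1 -[RHS]mulr1 -{1}h2 -h1.
  by move: h4; rewrite !exprMn; lra.
have k2 : s ^+ 2 = c' ^+ 2 by lra.
have m1 : c * s + c' * s' = 0.
  have u1 : s * (c * s + c' * s') = 0.
    have -> : s * (c * s + c' * s') = c * s ^+ 2 + c' * (s * s') by ring.
    have -> : s * s' = - (c * c') by lra.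
    by rewrite k2; ring.
  have u2 : c * (c * s + c' * s') = 0.
    have -> : c * (c * s + c' * s') = s * c ^+ 2 + s' * (c * c') by ring.
    have -> : c * c' = - (s * s') by lra.
    by rewrite k; ring.
  have : (c ^+ 2 + s ^+ 2) * (c * s + c' * s') = c * (c * (c * s + c' * s')) + s * (s * (c * s + c' * s')) by ring.
  by rewrite h1 u1 u2 !mulr0 addr0 mul1r.
split.
  have -> : (x * c + y * s) * c + (x * c' + y * s') * c' = x * (c ^+ 2 + c' ^+ 2) + y * (c * s + c' * s') by ring.
  by rewrite m1 -k2 h1; ring.
have -> : (x * c + y * s) * s + (x * c' + y * s') * s' = x * (c * s + c' * s') + y * (s ^+ 2 + s' ^+ 2) by ring.
by rewrite m1 -k addrC [s ^+ 2 + _]addrC h1; ring.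
Qed.

(** The gauge is constant along the curve u |-> u e1 + g(u) e2 near z, so the chain rule gives
    orthogonality. It is proved for an arbitrary local graph because the definition of a normal
    quantifies over all of them. *)
Lemma local_graph_tangent z e1 e2 g : boundary region z ->
  local_C1_graph (boundary region) z e1 e2 g ->
  dot (grad z) (e1 + derive1 g (dot z e1) *: e2) = 0.
Proof.
move=> Bz [[n1 n2 e12] [dg _] nz].
have hz := nbhs_singleton nz; have gz := hz.1 Bz.
pose u0 := dot z e1; pose p (u : R) : R * R := u *: e1 + g u *: e2.
have [z1 z2] := orthonormal_decomp z n1 n2 e12.
have dgu : is_derive u0 1 g (derive1 g u0) by rewrite derive1E; exact: derivableP.
have cg : {for u0, continuous g}.
  by apply: differentiable_continuous; apply/derivable1_diffP; exact: dg.
have pz : p u0 = z.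
  by rewrite /p [z]surjective_pairing z1 z2 gz.
have cp : p u @[u --> u0] --> z.
  rewrite -pz; apply: cvgD; apply: cvgZr_tmp; [exact: cvg_id | exact: cg].
have p1 u : dot (p u) e1 = u.
  move/enorm_eq1: n1 => n1; rewrite /dot/= in e12.
  rewrite /p /dot/= /GRing.scale/=.
  have -> : (u * e1.1 + g u * e2.1) * e1.1 + (u * e1.2 + g u * e2.2) * e1.2 =
    u * (e1.1 ^+ 2 + e1.2 ^+ 2) + g u * (e1.1 * e2.1 + e1.2 * e2.2) by ring.
  by rewrite n1 e12 mulr1 mulr0 addr0.
have p2 u : dot (p u) e2 = g u.
  move/enorm_eq1: n2 => n2; rewrite /dot/= in e12.
  rewrite /p /dot/= /GRing.scale/=.
  have -> : (u * e1.1 + g u * e2.1) * e2.1 + (u * e1.2 + g u * e2.2) * e2.2 =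
    g u * (e2.1 ^+ 2 + e2.2 ^+ 2) + u * (e1.1 * e2.1 + e1.2 * e2.2) by ring.
  by rewrite n2 e12 mulr1 mulr0 addr0.
have Fp : \forall u \near u0, cst (2 * phi a) u = (gauge \o p) u.
  have Sp : \forall u \near u0, (boundary region (p u) <-> dot (p u) e2 = g (dot (p u) e1)).
    exact: (cp _ nz).
  apply: filterS Sp => u /=; rewrite p1 p2 boundary_region /= => h.
  by rewrite h.2.
have d0 : is_derive u0 1 (gauge \o p) 0.
  by apply: near_eq_is_derive (is_derive_cst (2 * phi a) u0 1); exact: Fp.
have dlin (c d : R) : is_derive u0 1 (fun u : R => u * c + g u * d) (c + derive1 g u0 * d).
  apply: is_derive_eq.
  by rewrite /GRing.scale/=; ring.
have dphi (c d : R) : is_derive u0 1 (fun u : R => phi (u * c + g u * d))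
    (f (u0 * c + g u0 * d) * (c + derive1 g u0 * d)).
  exact: (@is_derive1_comp _ phi (fun u : R => u * c + g u * d) u0 _ _ (phi_derive _) (dlin c d)).
have dG : is_derive u0 1 (gauge \o p) (dot (grad (p u0)) (e1 + derive1 g u0 *: e2)).
  exact: is_deriveD (dphi e1.1 e2.1) (dphi e1.2 e2.2).
rewrite -pz p1 /u0 in dG *.
by have [_ <-] := dG; have [_ <-] := d0; rewrite /u0.
Qed.

Lemma dot_grad_normal z : gauge z = 2 * phi a -> 0 < dot (grad z) (normal z).
Proof.
move=> /grad_ge1 g1; have g0 : 0 < enorm (grad z) by rewrite (lt_le_trans ltr01).
have -> : dot (grad z) (normal z) = enorm (grad z).
  have -> : dot (grad z) (normal z) = (enorm (grad z))^-1 * enorm (grad z) ^+ 2.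
    by rewrite enorm_sqr /dot /normal/= /GRing.scale/=; ring.
  by rewrite expr2 mulrA mulVf ?mul1r// gt_eqF.
exact: g0.
Qed.

(** Outwards, the tangent inequality at z shows that the gauge does not decrease. Inwards, it is
    used at the moved point, where the directional derivative is still positive by continuity. *)
Lemma normal_inside z : gauge z = 2 * phi a ->
  \forall t \near (0 : R)^'+, ~ region (z + t *: normal z) /\ region (z - t *: normal z).
Proof.
move=> gz; have gn := dot_grad_normal gz; set N := normal z in gn *.
(* Derivative of the gauge in the direction N at the point z - t N. *)
pose q (t : R) := f (z.1 - t * N.1) * N.1 + f (z.2 - t * N.2) * N.2.
have cl (c d : R) : continuous (fun t : R => c - t * d).
  by move=> t; apply: cvgB; [exact: cvg_cst | apply: cvgM; [exact: cvg_id|exact: cvg_cst]].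
have cq : continuous q.
  move=> t; apply: cvgD; apply: cvgM; do ?exact: cvg_cst; apply: continuous_comp;
   do ?exact: f_continuous; exact: cl.
have q0 : 0 < q 0 by rewrite /q !mul0r !subr0.
near=> t; have t0 : 0 < t by near: t; exact: nbhs_right_gt.
have qt : 0 < q t.
  near: t; apply: (cvgr_gt (q 0)) => //.
  exact/cvg_at_right_filter/cq.
split.
  apply/negP; rewrite -leNgt -gz; apply: le_trans (gauge_tangent z _).
  rewrite lerDl.
  have -> : f z.1 * ((z + t *: N).1 - z.1) + f z.2 * ((z + t *: N).2 - z.2) = t * dot (grad z) N.
    by rewrite /dot /grad/= /GRing.scale/=; ring.
  by rewrite mulr_ge0// ltW.
have := gauge_tangent (z - t *: N) z; rewrite gz => h; rewrite /region/=.
apply: lt_le_trans h; rewrite ltrDl.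
have -> : f (z - t *: N).1 * (z.1 - (z - t *: N).1) + f (z - t *: N).2 * (z.2 - (z - t *: N).2) = t * q t.
  by rewrite /q /= /GRing.scale/=; ring.
by rewrite mulr_gt0.
Unshelve. all: by end_near. Qed.

Lemma unit_orthogonal (u v w : R * R) : u.1 ^+ 2 + u.2 ^+ 2 = 1 -> v.1 ^+ 2 + v.2 ^+ 2 = 1 ->
  w != 0 -> dot u w = 0 -> dot v w = 0 -> u = v \/ u = - v.
Proof.
move: u v w => [a1 a2] [b1 b2] [w1 w2] /= h1 h2; rewrite /dot/= => w0 e1 e2.
pose d := a1 * b2 - a2 * b1.
have d1 : d * w1 = 0.
  have -> : d * w1 = b2 * (a1 * w1 + a2 * w2) - a2 * (b1 * w1 + b2 * w2) by rewrite /d; ring.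
  by rewrite e1 e2 !mulr0 subrr.
have d2 : d * w2 = 0.
  have -> : d * w2 = a1 * (b1 * w1 + b2 * w2) - b1 * (a1 * w1 + a2 * w2) by rewrite /d; ring.
  by rewrite e1 e2 !mulr0 subrr.
have d0 : d = 0.
  apply/eqP; apply: contraNT w0 => dn0; apply/eqP.
  move/eqP: d1; rewrite mulf_eq0 (negPf dn0)/= => /eqP ->.
  by move/eqP: d2; rewrite mulf_eq0 (negPf dn0)/= => /eqP ->.
pose k := a1 * b1 + a2 * b2.
have k1 : a1 = k * b1.
  have -> : k * b1 = a1 * (b1 ^+ 2 + b2 ^+ 2) - b2 * d by rewrite /k /d; ring.
  by rewrite h2 d0; ring.
have k2 : a2 = k * b2.
  have -> : k * b2 = a2 * (b1 ^+ 2 + b2 ^+ 2) + b1 * d by rewrite /k /d; ring.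
  by rewrite h2 d0; ring.
have : k ^+ 2 = 1.
  have -> : k ^+ 2 = (a1 ^+ 2 + a2 ^+ 2) * (b1 ^+ 2 + b2 ^+ 2) - d ^+ 2 by rewrite /k /d; ring.
  by rewrite h1 h2 d0; ring.
move/eqP; rewrite sqrf_eq1 => /orP[] /eqP ke; rewrite k1 k2 ke.
  by left; rewrite !mul1r.
by right; rewrite !mulN1r.
Qed.

Lemma local_graph_tangent_neq0 (z e1 e2 : R * R) (g : R -> R) S :
  local_C1_graph S z e1 e2 g -> e1 + derive1 g (dot z e1) *: e2 != 0.
Proof.
move=> [[/enorm_eq1 n1 _ e12] _ _]; apply/eqP => h.
have : dot (e1 + derive1 g (dot z e1) *: e2) e1 = 1.
  rewrite /dot/= in e12; rewrite /dot/= /GRing.scale/=; set k := derive1 _ _.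
  have -> : (e1.1 + k * e2.1) * e1.1 + (e1.2 + k * e2.2) * e1.2 =
    (e1.1 ^+ 2 + e1.2 ^+ 2) + k * (e1.1 * e2.1 + e1.2 * e2.2) by ring.
  by rewrite n1 e12 mulr0 addr0.
by rewrite h /dot/= !mul0r addr0 => /eqP; rewrite eq_sym oner_eq0.
Qed.

(** Every local graph determines the same normal line, so the only rival candidate is the opposite
    vector, and it would put the same points both inside and outside the region. *)
Lemma outer_normal_region z : boundary region z -> outer_normal region z = normal z.
Proof.
move=> Bz; have gz : gauge z = 2 * phi a by move: Bz; rewrite boundary_region.
have tangent e1 e2 g : local_C1_graph (boundary region) z e1 e2 g ->
    dot (normal z) (e1 + derive1 g (dot z e1) *: e2) = 0.
  by move=> hg; rewrite /normal dotZl (local_graph_tangent Bz hg) mulr0.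
apply: get_unique.
  split; [exact/enorm_eq1/normal_unit | | exact: normal_inside].
  have [e1 [e2 [g hg]]] := region_graph Bz.
  by exists e1, e2, g; split => //; exact: tangent.
move=> v [/enorm_eq1 v1 [e1 [e2 [g [hg vT]]]] vin].
have [//|vN] := unit_orthogonal v1 (normal_unit gz) (local_graph_tangent_neq0 hg) vT (tangent _ _ _ hg).
have [t [[h1 h2] [h3 h4]]] := filter_ex (filterI vin (normal_inside gz)).
by move: h4; rewrite -scalerN -vN => /h1.
Qed.

(** Radial projection to the unit circle is 1-Lipschitz outside the open unit disc. With p, q the
    norms, d the inner product and e = d/(pq) <= 1, the claim is 2 - 2 e <= p^2 + q^2 - 2 p q e,
    which follows from 2 p q <= p^2 + q^2 and p q >= 1. *)
Lemma enormB_normal (u v : R * R) : 1 <= enorm u -> 1 <= enorm v ->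
  enorm ((enorm u)^-1 *: u - (enorm v)^-1 *: v) <= enorm (u - v).
Proof.
move=> u1 v1; rewrite -(ler_pXn2r (_ : 0 < 2)%N) ?nnegrE ?enorm_ge0// !enorm_sqr.
have := enorm_sqr u; have := enorm_sqr v.
move: u1 v1; set p := enorm u; set q := enorm v => p1 q1 eq ep /=.
have p0 : p != 0 by rewrite gt_eqF// (lt_le_trans ltr01).
have q0 : q != 0 by rewrite gt_eqF// (lt_le_trans ltr01).
rewrite /GRing.scale/=; set d := u.1 * v.1 + u.2 * v.2.
have dpq : d <= p * q.
  have h : d ^+ 2 <= (p * q) ^+ 2.
    rewrite exprMn ep eq -subr_ge0.
    have -> : (u.1 ^+ 2 + u.2 ^+ 2) * (v.1 ^+ 2 + v.2 ^+ 2) - d ^+ 2 = (u.1 * v.2 - u.2 * v.1) ^+ 2 by rewrite /d; ring.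
    exact: sqr_ge0.
  have pq0 : 0 <= p * q by rewrite mulr_ge0// enorm_ge0.
  by have [d0|/ltW d0] := leP d 0; [exact: le_trans pq0|rewrite -(ler_pXn2r (_ : 0 < 2)%N)].
have -> : (p^-1 * u.1 - q^-1 * v.1) ^+ 2 + (p^-1 * u.2 - q^-1 * v.2) ^+ 2 = 2 - 2 * (p * q)^-1 * d.
  have -> : (p^-1 * u.1 - q^-1 * v.1) ^+ 2 + (p^-1 * u.2 - q^-1 * v.2) ^+ 2 =
    p ^- 2 * (u.1 ^+ 2 + u.2 ^+ 2) + q ^- 2 * (v.1 ^+ 2 + v.2 ^+ 2) - 2 * (p^-1 * q^-1) * d.
    by rewrite -!exprVn /d; ring.
  by rewrite -ep -eq !mulVf ?expf_neq0// invfM; ring.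
have -> : (u.1 - v.1) ^+ 2 + (u.2 - v.2) ^+ 2 = p ^+ 2 + q ^+ 2 - 2 * d.
  by rewrite ep eq /d; ring.
have h1 : d / (p * q) <= 1 by rewrite ler_pdivrMr ?mul1r// mulr_gt0// (lt_le_trans ltr01).
have h2 : 1 <= p * q by rewrite -[leLHS]mulr1 ler_pM.
have h3 : 2 * (p * q) <= p ^+ 2 + q ^+ 2 by have := sqr_ge0 (p - q); lra.
have h4 : (p * q - 1) * (d / (p * q)) <= p * q - 1.
  by rewrite ler_piMr// subr_ge0.
have h5 : d = (p * q) * (d / (p * q)) by rewrite mulrC divfK// mulf_neq0.
have -> : 2 * (p * q)^-1 * d = 2 * (d / (p * q)) by ring.
by move: h4 h3 h5; generalize (d / (p * q)) => e; lra.
Qed.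

Lemma enorm_le_add (z : R * R) : enorm z <= `|z.1| + `|z.2|.
Proof.
rewrite -(ler_pXn2r (_ : 0 < 2)%N) ?nnegrE ?enorm_ge0 ?addr_ge0// enorm_sqr.
rewrite -(real_normK (num_real z.1)) -(real_normK (num_real z.2)).
have : 0 <= `|z.1| * `|z.2| by rewrite mulr_ge0.
by lra.
Qed.

Lemma fst_le_enorm (z : R * R) : `|z.1| <= enorm z.
Proof.
rewrite -(ler_pXn2r (_ : 0 < 2)%N) ?nnegrE ?enorm_ge0// enorm_sqr.
by rewrite real_normK ?num_real// lerDl sqr_ge0.
Qed.

Lemma snd_le_enorm (z : R * R) : `|z.2| <= enorm z.
Proof.
rewrite -(ler_pXn2r (_ : 0 < 2)%N) ?nnegrE ?enorm_ge0// enorm_sqr.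
by rewrite real_normK ?num_real// lerDr sqr_ge0.
Qed.

Lemma boundary_nonempty : boundary region (a, a).
Proof. by rewrite boundary_region/= /gauge/= mulr_natl. Qed.

(** Normalizing the gradient does not increase distances, and each of its two coordinates moves by
    at most E, whence the factor 2. The lower bound comes from the pair of equal points at the
    corner (a, a). *)
Lemma normal_modulus_region d E : 0 <= d ->
  (forall x y, `|x - y| <= d -> `|f x - f y| <= E) ->
  0 <= normal_modulus region d <= 2 * E.
Proof.
move=> d0 fE; rewrite /normal_modulus; set A := image _ _.
have A0 : A 0.
  exists ((a, a), (a, a)) => /=; last by rewrite subrr /enorm /dot/= !mul0r addr0 sqrtr0.
  split; [exact: boundary_nonempty | exact: boundary_nonempty |].
  by rewrite subrr /enorm /dot/= !mul0r addr0 sqrtr0.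
have ub : ubound A (2 * E).
  move=> _ [[z w] [/= Bz Bw zw] <-].
  rewrite !outer_normal_region//.
  move: Bz Bw; rewrite boundary_region/= => /grad_ge1 gz /grad_ge1 gw.
  apply: (le_trans (enormB_normal gz gw)); apply: (le_trans (enorm_le_add _)).
  rewrite mulr_natl lerD// fE//.
    by apply: le_trans zw; exact: (fst_le_enorm (z - w)).
  by apply: le_trans zw; exact: (snd_le_enorm (z - w)).
apply/andP; split; last by apply: ge_sup => //; exists 0.
by apply: ub_le_sup => //; exists (2 * E).
Qed.

(** * Absence of segments in the boundary *)

Lemma phi_mid x y : 2 * phi ((x + y) / 2) <= phi x + phi y.
Proof.
set m := (x + y) / 2; have := phi_tangent m x; have := phi_tangent m y.
have e : f m * (x - m) + f m * (y - m) = 0 by rewrite /m; field.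
by lra.
Qed.

(** Equality at the midpoint forces f to be constant between u and v. Since f increases strictly on
    [-a, a], the interval lies to one side of [-a, a], up to an endpoint, and there phi is
    injective. *)
Lemma phi_mid_eq u v : u != v -> 2 * phi ((u + v) / 2) = phi u + phi v ->
  a < `|(u + v) / 2| /\ phi u != phi v.
Proof.
wlog uv : u v / u < v => [wlog|].
  rewrite neq_lt => /orP[] h; first by apply: wlog => //; rewrite lt_eqF.
  by rewrite addrC (addrC (phi u)) eq_sym; apply: wlog => //; rewrite lt_eqF.
move=> _ e; set m := (u + v) / 2 in e *.
have um : u < m by rewrite /m; lra.
have mv : m < v by rewrite /m; lra.
have h1 := phi_tangent m u; have h2 := phi_tangent m v.
have e1 : f m * (u - m) + f m * (v - m) = 0 by rewrite /m; field.
have fc c : u < c -> c < v -> f c = f m.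
  move=> uc cv; apply/eqP; rewrite eq_le; apply/andP; split.
    have k1 := phi_tangent m c; have k2 := phi_tangent c v.
    have k3 : f c * (v - c) <= f m * (v - c) by lra.
    by rewrite ler_pM2r ?subr_gt0// in k3.
  have k1 := phi_tangent m c; have k2 := phi_tangent c u.
  have k3 : f m * (c - u) <= f c * (c - u) by lra.
  by rewrite ler_pM2r ?subr_gt0// in k3.
have a0 := a_gt0.
have [au|ua] := leP a u.
  split; first by rewrite ger0_norm; lra.
  by rewrite lt_eqF// phi_lt//; lra.
have [va|av] := leP v (- a).
  split; first by rewrite ler0_norm; lra.
  by rewrite -(phi_even u) -(phi_even v) gt_eqF// phi_lt//; lra.
(* The part of [u, v] inside [-a, a]; the points dividing it in thirds are interior, so f would take
   equal values there. *)
pose l := Num.max u (- a); pose r := Num.min v a.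
have lr : l < r by rewrite /l /r gt_max !lt_min uv ua av/=; lra.
have [lu la] : u <= l /\ - a <= l by rewrite /l !le_max !lexx orbT.
have [rv ra] : r <= v /\ r <= a by rewrite /r !ge_min !lexx orbT.
have : f ((2 * l + r) / 3) < f ((l + 2 * r) / 3) by apply: f_lt; lra.
by rewrite !fc ?ltxx//; lra.
Qed.

(** The midpoint also lies on the boundary, so both coordinates give equality in [phi_mid]. If only
    one coordinate varies, phi differs at its ends and the gauge is not constant; if both vary, both
    midpoint coordinates exceed a in absolute value and the gauge is too large. *)
Lemma region_no_segment x y : x != y -> ~ (segment x y `<=` boundary region).
Proof.
move=> xy sB.
have B t : 0 <= t <= 1 -> gauge ((1 - t) *: x + t *: y) = 2 * phi a.
  move=> t01; have := sB ((1 - t) *: x + t *: y); rewrite boundary_region; apply.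
  by exists t => //; rewrite /= in_itv.
have gx : gauge x = 2 * phi a.
  by rewrite -(B 0) ?lexx ?ler01// subr0 scale1r scale0r addr0.
have gy : gauge y = 2 * phi a.
  by rewrite -(B 1) ?lexx ?ler01// subrr scale1r scale0r add0r.
have half : 0 <= (2^-1 : R) <= 1 by apply/andP; split; lra.
have gm : phi ((x.1 + y.1) / 2) + phi ((x.2 + y.2) / 2) = 2 * phi a.
  rewrite -(B _ half) /gauge /= /GRing.scale/=.
  by congr (phi _ + phi _); field.
rewrite /gauge in gx gy.
have e1 : 2 * phi ((x.1 + y.1) / 2) = phi x.1 + phi y.1.
  by have := phi_mid x.1 y.1; have := phi_mid x.2 y.2; lra.
have e2 : 2 * phi ((x.2 + y.2) / 2) = phi x.2 + phi y.2 by lra.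
have [x1|x1] := eqVneq x.1 y.1.
  have x2 : x.2 != y.2.
    by apply: contra_neq xy => x2; rewrite [x]surjective_pairing x1 x2 -surjective_pairing.
  have [_ /eqP] := phi_mid_eq x2 e2; apply.
  by move: gx gy; rewrite x1; lra.
have [far1 ne1] := phi_mid_eq x1 e1.
have [x2|x2] := eqVneq x.2 y.2.
  by move/eqP: ne1; apply; move: gx gy; rewrite x2; lra.
have [far2 _] := phi_mid_eq x2 e2.
have a0 := ltW a_gt0.
have := phi_lt a0 far1; have := phi_lt a0 far2; rewrite !phi_norm; lra.
Qed.

End region.

(** * Invariance of Lebesgue integrals under translation and reflection *)

Section lebesgue_translation.
Context {R : realType}.
Notation mu := (@lebesgue_measure R).

Lemma measurable_translate (c : R) :
  measurable_fun [set: measurableTypeR R] (fun x : measurableTypeR R => (x + c : measurableTypeR R)).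
Proof. by apply: measurable_funD; [exact: measurable_id | exact: measurable_cst]. Qed.

Lemma lebesgue_measure_translate (c : R) (A : set (measurableTypeR R)) : measurable A ->
  pushforward mu (fun x : measurableTypeR R => (x + c : measurableTypeR R)) A = mu A.
Proof.
pose T := HB.pack_for {mfun measurableTypeR R >-> measurableTypeR R}
  (fun x : measurableTypeR R => (x + c : measurableTypeR R))
  (isMeasurableFun.Build _ _ _ _ _ (measurable_translate c)).
move=> mA; apply/esym/(@lebesgue_measure_unique _ (pushforward mu T)) => //= _ [[a b]] _ <-.
rewrite /pushforward.
have -> : T @^-1` `]a, b]%classic = `]a - c, b - c]%classic.
  by apply/seteqP; split => x /=; rewrite !in_itv/= ltrBlDr lerBrDr.
rewrite !lebesgue_measure_itv/= !lte_fin ltrD2r.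
by case: ifP => // _; rewrite -!EFinB; congr EFin; lra.
Qed.

Local Open Scope ereal_scope.

Lemma ge0_integral_translate (c : R) (f : R -> \bar R) :
  measurable_fun [set: measurableTypeR R] f -> (forall x, 0 <= f x) ->
  \int[mu]_x f (x + c)%R = \int[mu]_x f x.
Proof.
move=> mf f0.
have := @ge0_integral_pushforward _ _ (measurableTypeR R) (measurableTypeR R) R
  _ (measurable_translate c) mu setT f measurableT mf (fun y _ => f0 y).
rewrite preimage_setT /= => <-.
apply: eq_measure_integral => [|? A mA _]; first exact: measurable_translate.
exact: lebesgue_measure_translate.
Qed.

Lemma integral_translate (c : R) (f : R -> \bar R) :
  measurable_fun [set: measurableTypeR R] f ->
  \int[mu]_x f (x + c)%R = \int[mu]_x f x.
Proof.
move=> mf; rewrite integralE [RHS]integralE; congr (_ - _).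
  rewrite -(@ge0_integral_translate c f^\+ (measurable_funepos mf)) //.
  by apply: eq_integral => x _; rewrite !funeposE.
rewrite -(@ge0_integral_translate c f^\- (measurable_funeneg mf)) //.
by apply: eq_integral => x _; rewrite !funenegE.
Qed.

Lemma ge0_integral_opp (f : R -> \bar R) :
  measurable_fun [set: measurableTypeR R] f -> (forall x, 0 <= f x) ->
  \int[mu]_x f (- x)%R = \int[mu]_x f x.
Proof.
move=> mf f0.
have mN : measurable_fun [set: measurableTypeR R] (-%R : _ -> measurableTypeR R) by by apply: continuous_measurable_fun; exact: opp_continuous.
have := @ge0_integral_pushforward _ _ (measurableTypeR R) (measurableTypeR R) R
  _ mN mu setT f measurableT mf (fun y _ => f0 y).
rewrite preimage_setT /= => <-.
apply: eq_measure_integral => A mA _.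
exact: lebesgue_measureN.
Qed.

Lemma integral_opp (f : R -> \bar R) :
  measurable_fun [set: measurableTypeR R] f ->
  \int[mu]_x f (- x)%R = \int[mu]_x f x.
Proof.
move=> mf; rewrite integralE [RHS]integralE; congr (_ - _).
  rewrite -(@ge0_integral_opp f^\+ (measurable_funepos mf)) //.
  by apply: eq_integral => x _; rewrite !funeposE.
rewrite -(@ge0_integral_opp f^\- (measurable_funeneg mf)) //.
by apply: eq_integral => x _; rewrite !funenegE.
Qed.

End lebesgue_translation.

(** * Oscillatory integral of a concave function *)

Section oscillation.
Context {R : realType}.
Notation mu := (@lebesgue_measure R).

Lemma integrable_bounded_support (g : R -> R) L M :
  measurable_fun [set: measurableTypeR R] g -> (forall w, `|g w| <= M) ->
  (forall w, L < `|w| -> g w = 0) -> mu.-integrable setT (EFin \o g).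
Proof.
move=> mg gM gL.
have -> : EFin \o g = (EFin \o g) \_ `[- L, L].
  apply/funext => w; rewrite patchE mem_setE in_itv/= -ler_norml.
  by case: leP => // /gL ->.
rewrite -integrable_mkcond//.
apply: measurable_bounded_integrable => //.
- by rewrite /= lebesgue_measure_itv/=; case: ifP => // _; rewrite -EFinB ltry.
- exact: measurable_funTS.
- exists M; split; first exact: num_real.
  by move=> x xM w _; rewrite /= (le_trans (gM w))// ltW.
Qed.

Lemma Rintegral_translate c (g : R -> R) : measurable_fun [set: measurableTypeR R] g ->
  \int[mu]_x g (x + c) = \int[mu]_x g x.
Proof.
move=> mg; rewrite /Rintegral (@integral_translate _ c (EFin \o g))//.
exact/measurable_EFinP.
Qed.

Lemma integrable_translate c (g : R -> R) : mu.-integrable setT (EFin \o g) ->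
  mu.-integrable setT (EFin \o (fun x => g (x + c))).
Proof.
move=> /integrableP[/measurable_EFinP mg gy]; apply/integrableP; split.
  apply/measurable_EFinP; apply: measurableT_comp => //.
  exact: measurable_translate.
rewrite (_ : (\int[mu]_x _)%E = (\int[mu]_x (`|(EFin \o g) x|)%E)%E)//.
apply: (@ge0_integral_translate _ c (fun x => `|(EFin \o g) x|)%E) => //.
by apply: measurableT_comp => //; exact/measurable_EFinP.
Qed.

Lemma Rintegral_indic_itv (a b : R) : a <= b -> \int[mu]_w (\1_(`[a, b]) w : R) = b - a.
Proof.
move=> ab; rewrite /Rintegral integral_indic// setIT /= lebesgue_measure_itv/= lte_fin.
by case: ltP => ba /=; lra.
Qed.

Variables (A k : R -> R) (W tau B M : R).
Hypothesis tau_gt0 : 0 < tau.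
Hypothesis A_measurable : measurable_fun [set: measurableTypeR R] A.
Hypothesis A_ge0 : forall w, 0 <= A w.
Hypothesis A_bound : forall w, A w <= M.
Hypothesis A_support : forall w, W <= `|w| -> A w = 0.
Hypothesis A_concave : forall w, `|w| + tau < W -> A (w + tau) + A (w - tau) <= 2 * A w.
Hypothesis A_edge : forall w, W - 2 * tau <= `|w| -> A w <= B.
Hypothesis B_ge0 : 0 <= B.
Hypothesis k_measurable : measurable_fun [set: measurableTypeR R] k.
Hypothesis k_bound : forall w, `|k w| <= 1.
Hypothesis k_shift : forall w, k (w + tau) = - k w.

Let I := \int[mu]_w (k w * A w).

Let k_shiftN w : k (w - tau) = - k w.
Proof. by rewrite -[w in RHS](subrK tau) k_shift opprK. Qed.

Let iA : mu.-integrable setT (EFin \o A).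
Proof.
apply: (@integrable_bounded_support A W M) => // w.
  by rewrite ger0_norm.
by move=> /ltW; exact: A_support.
Qed.

Let ikA : mu.-integrable setT (EFin \o (fun w => k w * A w)).
Proof.
apply: (@integrable_bounded_support _ W M) => [|w|w /ltW /A_support ->]; last by rewrite mulr0.
  exact: measurable_funM.
by rewrite normrM (le_trans (ler_piMl _ (k_bound w)))// ger0_norm.
Qed.

Let iAs c : mu.-integrable setT (EFin \o (fun w => A (w + c))).
Proof. exact: (@integrable_translate c A). Qed.

Let k_plus : forall w, k w * A (w + tau) = - (k (w + tau) * A (w + tau)).
Proof. by move=> w; rewrite k_shift mulNr opprK. Qed.

Let k_minus : forall w, k w * A (w - tau) = - (k (w - tau) * A (w - tau)).
Proof. by move=> w; rewrite k_shiftN mulNr opprK. Qed.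

Let ikAs c : mu.-integrable setT (EFin \o (fun w => k (w + c) * A (w + c))).
Proof. exact: (@integrable_translate c (fun w => k w * A w)). Qed.

Let D2 w := A (w + tau) + A (w - tau) - 2 * A w.

(** Where exactly one of w - tau, w + tau leaves the open interval (-W, W); the second difference of
    A can be positive only there. *)
Let edge : R -> R := (\1_(`[W - tau, W + tau]) \+ \1_(`[- W - tau, - W + tau])).

Let iN (g : R -> R) : mu.-integrable setT (EFin \o g) -> mu.-integrable setT (EFin \o (fun x => - g x)).
Proof. exact: integrableN. Qed.

Let iD (g h : R -> R) : mu.-integrable setT (EFin \o g) -> mu.-integrable setT (EFin \o h) ->
  mu.-integrable setT (EFin \o (fun x => g x + h x)).
Proof. by move=> ig ih; exact: (integrableD _ ig ih). Qed.

Let iZ c (g : R -> R) : mu.-integrable setT (EFin \o g) ->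
  mu.-integrable setT (EFin \o (fun x => c * g x)).
Proof. by move=> ig; exact: (integrableZl _ _ ig). Qed.

Let iedge : mu.-integrable setT (EFin \o edge).
Proof.
by apply: iD; exact: integrable_indic_itv.
Qed.

Let iD2 : mu.-integrable setT (EFin \o D2).
Proof. by apply: iD; [apply: iD; exact: iAs | apply/iN/iZ]. Qed.

Let int_D2 : \int[mu]_w D2 w = 0.
Proof.
have mA := A_measurable.
rewrite RintegralB//; last 2 first.
- by apply: iD; exact: iAs.
- exact: iZ.
rewrite RintegralD//.
rewrite RintegralZl// !Rintegral_translate//; lra.
Qed.

Let int_kD2 : \int[mu]_w (k w * D2 w) = - (4 * I).
Proof.
have mA := A_measurable.
have mkA : measurable_fun [set: measurableTypeR R] (fun w => k w * A w) by exact: measurable_funM.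
have -> : \int[mu]_w (k w * D2 w) =
  \int[mu]_w (- (k (w + tau) * A (w + tau)) + - (k (w - tau) * A (w - tau)) - 2 * (k w * A w)).
  by apply: eq_Rintegral => w _; rewrite -k_plus -k_minus /D2; ring.
rewrite RintegralB//; last 2 first.
- by apply: iD; apply: iN; exact: ikAs.
- exact: iZ.
rewrite RintegralD//; last 2 first.
- by apply: iN; exact: ikAs.
- by apply: iN; exact: ikAs.
rewrite RintegralZl//.
have RN (g : R -> R) : mu.-integrable setT (EFin \o g) -> \int[mu]_w (- g w) = - \int[mu]_w g w.
  by move=> ig; rewrite -mulN1r -RintegralZl//; apply: eq_Rintegral => w _; rewrite mulN1r.
rewrite !RN//; try exact: ikAs.
rewrite (@Rintegral_translate tau (fun w => k w * A w))//.
rewrite (@Rintegral_translate (- tau) (fun w => k w * A w))// -/I; lra.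
Qed.

(** From |x| = -x + 2 max(x, 0): the positive part of [D2] is at most B and is supported on the
    edges. *)
Let D2_le w : `|D2 w| <= - D2 w + 2 * B * edge w.
Proof.
have e0 : 0 <= edge w by rewrite /edge/= addr_ge0.
have eB : 0 <= 2 * B * edge w by rewrite !mulr_ge0.
have [h|h] := leP (D2 w) 0; first by rewrite ?ler0_norm ?lerDl.
rewrite gtr0_norm//; suff : D2 w <= B * edge w by lra.
have e1 : edge w >= 1 -> D2 w <= B -> D2 w <= B * edge w.
  by move=> e1 dB; rewrite (le_trans dB)// ler_peMr.
have Aw := A_ge0 w.
have [c1|c1] := leP W (`|w + tau|).
  have [c2|c2] := leP W (`|w - tau|).
    by move: h; rewrite /D2 A_support// (A_support c2); lra.
  apply: e1.
    rewrite /edge/= indicE mem_setE in_itv/=.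
    suff -> : W - tau <= w <= W + tau by rewrite lerDl.
    by move: c1 c2; rewrite ler_normr ltr_norml => /orP[c1|c1] /andP[c2 c3]; have := tau_gt0; lra.
  rewrite /D2 A_support// add0r; suff : A (w - tau) <= B by lra.
  apply: A_edge; move: c1 c2; rewrite ltr_norml !ler_normr => /orP[c1|c1] /andP[c2 c3].
    by apply/orP; left; lra.
  by apply/orP; right; have := tau_gt0; lra.
have [c2|c2] := leP W (`|w - tau|).
  apply: e1.
    rewrite /edge/= !indicE !mem_setE !in_itv/=.
    suff -> : - W - tau <= w <= - W + tau by rewrite lerDr.
    by move: c2 c1; rewrite ler_normr ltr_norml => /orP[c1|c1] /andP[c2 c3]; have := tau_gt0; lra.
  rewrite /D2 (A_support c2) addr0; suff : A (w + tau) <= B by lra.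
  apply: A_edge; move: c2 c1; rewrite ltr_norml !ler_normr => /orP[c1|c1] /andP[c2 c3].
    by apply/orP; left; have := tau_gt0; lra.
  by apply/orP; right; lra.
have cW : `|w| + tau < W.
  move: c1 c2; rewrite !ltr_norml => /andP[c1 c2] /andP[c3 c4].
  by rewrite -ltrBrDr ltr_norml; apply/andP; split; lra.
by have := A_concave cW; move: h; rewrite /D2; lra.
Qed.

(** As k changes sign under translation by tau, integrating k against the second difference [D2] of
    A gives -4 I. The integral of [D2] itself is 0, so by [D2_le] its L^1 norm is at most 2 B times
    the total length 4 tau of the edges. *)
Lemma oscillation_bound : `|I| <= 2 * tau * B.
Proof.
have iabs : mu.-integrable setT (EFin \o (fun w => `|D2 w|)) by exact: integrable_norm.
have ikD2 : mu.-integrable setT (EFin \o (fun w => k w * D2 w)).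
  apply: (le_integrable _ _ _ iabs) => //.
    apply/measurable_EFinP/measurable_funM => //.
    by apply/measurable_EFinP; case/integrableP: iD2.
  move=> w _; rewrite /= lee_fin normrM normr_id ler_piMl//.
have h1 : 4 * `|I| <= \int[mu]_w `|D2 w|.
  rewrite -[4]ger0_norm// -normrM -normrN -int_kD2.
  apply: le_trans (le_normr_Rintegral _ ikD2) _ => //.
  apply: le_Rintegral => //; first exact: integrable_norm.
  by move=> w _; rewrite normrM ler_piMl.
have h2 : \int[mu]_w `|D2 w| <= \int[mu]_w (- D2 w + 2 * B * edge w).
  apply: le_Rintegral => //; apply: iD; [exact: iN | exact: iZ].
have h3 : \int[mu]_w (- D2 w + 2 * B * edge w) = 2 * B * (4 * tau).
  rewrite RintegralD//; [|exact: iN|exact: iZ].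
  have -> : \int[mu]_w (- D2 w) = 0.
    rewrite -[RHS]oppr0 -int_D2 -mulN1r -RintegralZl//.
    by apply: eq_Rintegral => w _; rewrite mulN1r.
  rewrite RintegralZl// add0r; congr (_ * _).
  have jj (a b : R) : mu.-integrable setT (EFin \o (\1_(`[a, b]) : R -> R)).
    exact: integrable_indic_itv.
  rewrite /edge RintegralD//.
  rewrite !Rintegral_indic_itv; [ring | |]; by rewrite lerD2l (ge0_cp (ltW tau_gt0)).
rewrite -(ler_pM2l (_ : (0 : R) < 4))// (le_trans h1)// (le_trans h2)// h3.
by rewrite le_eqVlt; apply/orP; left; apply/eqP; ring.
Qed.

End oscillation.

(** * Bounded functions on the plane; midpoint inequality for lengths *)

Section planar_measure.
Context {R : realType}.
Notation mu := (@lebesgue_measure R).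
Notation mu2 := (@lebesgue2 R).
Notation T := (measurableTypeR R).
Notation T2 := (measurableTypeR R * measurableTypeR R)%type.

Lemma integrable2_bounded_support (h : T2 -> R) L M :
  measurable_fun [set: T2] h -> (forall z, `|h z| <= M) ->
  (forall z, h z != 0 -> `|z.1| <= L /\ `|z.2| <= L) -> mu2.-integrable setT (EFin \o h).
Proof.
move=> mh hM hL.
pose Q : set T2 := `[- L, L]%classic `*` `[- L, L]%classic.
have mQ : measurable Q by exact: measurableX.
have -> : EFin \o h = (EFin \o h) \_ Q.
  apply/funext => z; rewrite patchE; case: ifPn => // /negP zQ /=.
  congr EFin; apply/eqP; apply/negPn/negP => /hL[h1 h2]; apply: zQ.
  by rewrite inE /Q/=; split; rewrite /= in_itv/= -ler_norml.
rewrite -integrable_mkcond//.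
apply: measurable_bounded_integrable => //.
- have lt1 : (mu `[(- L)%R, L] < +oo)%E.
    by rewrite /= lebesgue_measure_itv/=; case: ifP => // _; rewrite -EFinB ltry.
  rewrite /= /lebesgue2 /Q product_measure1E//.
  by rewrite lte_mul_pinfty// ge0_fin_numE.
- exact: measurable_funTS.
- exists M; split; first exact: num_real.
  by move=> x xM w _; rewrite /= (le_trans (hM w))// ltW.
Qed.

(** The Brunn-Minkowski inequality on the line: K contains the open interval between the mean of the
    infima and the mean of the suprema. *)
Lemma measure_midpoint (I J K : set T) : measurable I -> measurable J -> measurable K ->
  I !=set0 -> J !=set0 -> has_ubound I -> has_lbound I -> has_ubound J -> has_lbound J ->
  is_interval K -> (forall x y, I x -> J y -> K ((x + y) / 2)) ->
  (mu I + mu J <= 2%:E * mu K)%E.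
Proof.
move=> mI mJ mK I0 J0 uI lI uJ lJ iK IJK.
have h (S : set T) : measurable S -> has_ubound S -> has_lbound S -> S !=set0 -> (mu S <= (sup S - inf S)%:E)%E.
  move=> mS uS lS [s Ss].
  apply: (@le_trans _ _ (mu `[inf S, sup S])).
    apply: le_measure; rewrite ?inE//.
    by move=> x Sx; rewrite /= in_itv/= ub_le_sup// ge_inf.
  rewrite /= lebesgue_measure_itv/= lte_fin -EFinB; case: ifP => // _.
  by rewrite lee_fin subr_ge0 (le_trans (ge_inf lS Ss))// ub_le_sup.
apply: le_trans (leeD (h I mI uI lI I0) (h J mJ uJ lJ J0)) _.
pose l := (inf I + inf J) / 2; pose r := (sup I + sup J) / 2.
have -> : ((sup I - inf I)%:E + (sup J - inf J)%:E = 2%:E * (r - l)%:E)%E.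
  by rewrite -EFinD -EFinM /r /l; congr EFin; field.
rewrite lee_pmul2l//; apply: (@le_trans _ _ (mu `]l, r[)).
  rewrite /= lebesgue_measure_itv/= lte_fin -EFinB.
  by case: ltP => //; rewrite lee_fin subr_le0.
apply: le_measure; rewrite ?inE// => z /=; rewrite in_itv/= => /andP[lz zr].
have e1 : 0 < z - l by rewrite subr_gt0.
have e2 : 0 < r - z by rewrite subr_gt0.
have [x Ix xl] := inf_adherent e1 (conj I0 lI).
have [y Jy yl] := inf_adherent e1 (conj J0 lJ).
have [x' Ix' xr] := sup_adherent e2 (conj I0 uI).
have [y' Jy' yr] := sup_adherent e2 (conj J0 uJ).
apply: (iK _ _ (IJK _ _ Ix Jy) (IJK _ _ Ix' Jy')).
by apply/andP; split; move: xl yl xr yr; rewrite /l /r; lra.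
Qed.

End planar_measure.

(** * Slicing the region by parallel chords *)

Section region_fourier.
Context {R : realType}.
Notation mu := (@lebesgue_measure R).
Notation mu2 := (@lebesgue2 R).
Notation T := (measurableTypeR R).
Notation T2 := (measurableTypeR R * measurableTypeR R)%type.
Variables (a : R) (f phi : R -> R).
Hypothesis fphi : profile a f phi.

Let a_gt0 := profile_gt0 fphi.
Let f_continuous := profile_continuous fphi.
Let f_odd := profile_odd fphi.
Let f_nd := profile_nd fphi.
Let f_eq1 := profile_eq1 fphi.
Let f_lt := profile_lt fphi.
Let phi_derive := profile_derive fphi.
Let phi0 := profile0 fphi.

Let D : set T2 := region a phi.

Let tangent x y : phi x + f x * (y - x) <= phi y.
Proof. exact: (phi_tangent fphi). Qed.

Let phiN x : phi (- x) = phi x.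
Proof. exact: (phi_even fphi). Qed.

Lemma measurable_phi : measurable_fun [set: T] phi.
Proof.
by apply: continuous_measurable_fun; exact: phi_continuous fphi.
Qed.

Lemma measurable_gauge : measurable_fun [set: T2] (gauge phi).
Proof.
by apply: measurable_funD; apply: (measurableT_comp measurable_phi).
Qed.

Lemma measurable_region : measurable D.
Proof.
have := measurable_gauge measurableT (@measurable_itv _ `]-oo, (2 * phi a)[).
rewrite setTI; congr (measurable _).
Qed.

Variables (x0 B tau : R) (s : R).
Hypothesis x0_itv : 0 <= x0 <= a.
Hypothesis s_def : s = f x0.
Hypothesis tau_gt0 : 0 < tau.
Hypothesis B_ge0 : 0 <= B.
(** The tangent to phi at x0, raised by 2 tau, cuts off a cap that projects into an interval of
    length B. This controls all chords with |w| >= W - 2 tau. *)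
Hypothesis cap : exists u, forall x, `|x| <= 2 * a ->
  phi x - phi x0 - s * (x - x0) < 2 * tau -> u <= x <= u + B.

(** The supremum of z.2 + s * z.1 over the region: the value at the boundary point (x0, a + phi a -
    phi x0), where the supporting line has slope -s. *)
Let W := a + phi a - phi x0 + s * x0.

Let s01 : 0 <= s <= 1.
Proof.
have /andP[h1 h2] := x0_itv.
rewrite s_def -(f0 fphi) f_nd//=; exact: (f_le1 fphi).
Qed.

(** The tangent at a gives phi z.2 >= phi a + z.2 - a, so depth below the supporting line bounds the
    height of the cap over z.1. *)
Lemma cap_height z : D z -> phi z.1 - phi x0 - s * (z.1 - x0) < W - (z.2 + s * z.1).
Proof.
rewrite /D /region/= /gauge /W => h; have := tangent a z.2; rewrite f_eq1//; lra.
Qed.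

Let DN z : D z -> D (- z).
Proof. by rewrite /D /region/= /gauge/= !phiN. Qed.

Lemma slab z : D z -> `|z.2 + s * z.1| < W.
Proof.
have h z' : D z' -> z'.2 + s * z'.1 < W.
  move=> /cap_height; have := tangent x0 z'.1; rewrite -s_def; lra.
move=> Dz; rewrite ltr_norml h// andbT.
by have := h _ (DN Dz); rewrite /=; lra.
Qed.

Let W_gt0 : 0 < W.
Proof.
have := slab (region0 fphi).
by apply: le_lt_trans; exact: normr_ge0.
Qed.

Definition chord (w : R) : set T := [set x | D (x, w - s * x)].

Lemma measurable_chord_graph : measurable [set z : T2 | D (z.1, z.2 - s * z.1)].
Proof.
have m : measurable_fun [set: T2] (fun z : T2 => (z.1, z.2 - s * z.1) : T2).
  apply: measurable_fun_pair => //=.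
  apply: measurable_funB; first exact: measurable_snd.
  by apply: measurable_funM; [exact: measurable_cst | exact: measurable_fst].
by have := m measurableT _ measurable_region; rewrite setTI.
Qed.

Lemma measurable_chord w : measurable (chord w).
Proof.
have := measurable_ysection w measurable_chord_graph.
congr (measurable _); apply/seteqP; split => x; rewrite /ysection/= inE//.
Qed.

Definition chord_length w : R := fine (mu (chord w)).

Let in_seg (u v x : R) : u <= x <= v = (x \in `[u, v]). Proof. by rewrite in_itv. Qed.

Lemma chord_sub w u v : (forall x, chord w x -> u <= x <= v) -> (mu (chord w) <= (Num.max 0 (v - u))%:E)%E.
Proof.
move=> h; apply: (@le_trans _ _ (mu `[u, v])).
  by apply: le_measure; rewrite ?inE//; exact: measurable_chord.
rewrite /= lebesgue_measure_itv/= lte_fin -EFinB; case: ifP => // _; rewrite lee_fin le_max lexx ?orbT//.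
Qed.

Lemma chord_bound w x : chord w x -> - (2 * a) <= x <= 2 * a.
Proof.
move=> /(region_bound fphi)[/= h _].
by rewrite -ler_norml.
Qed.

Lemma mu_chord w : mu (chord w) = (chord_length w)%:E.
Proof.
rewrite /chord_length fineK// ge0_fin_numE//.
by rewrite (le_lt_trans (chord_sub (@chord_bound w)))// ltry.
Qed.

Lemma chord_length_ge0 w : 0 <= chord_length w.
Proof. exact: fine_ge0. Qed.

Lemma chord_length_bound w : chord_length w <= 4 * a.
Proof.
rewrite -lee_fin -mu_chord (le_trans (chord_sub (@chord_bound w)))// lee_fin.
by have := a_gt0; rewrite ge_max => a0; apply/andP; split; lra.
Qed.

Lemma chord_length_support w : W <= `|w| -> chord_length w = 0.
Proof.
move=> Ww; rewrite /chord_length (_ : chord w = set0) ?measure0//.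
apply/seteqP; split => // x /slab/=; rewrite subrK.
by rewrite ltNge Ww.
Qed.

Lemma chord_length_edge w : W - 2 * tau <= `|w| -> chord_length w <= B.
Proof.
have [u uB] := cap.
have key v : W - 2 * tau <= v -> forall x, chord v x -> u <= x <= u + B.
  move=> Wv x vx; have /= h := cap_height vx; rewrite subrK in h.
  by apply: uB; [rewrite ler_norml (chord_bound vx) | lra].
move=> Ww; rewrite -lee_fin -mu_chord; move: Ww.
case: (ger0P w) => _ hw.
  rewrite (le_trans (chord_sub (key w hw)))// lee_fin addrAC subrr add0r.
  by rewrite ge_max B_ge0 lexx.
have kN x : chord w x -> - (u + B) <= x <= - u.
  move=> /DN; rewrite /= => h.
  have : chord (- w) (- x).
    by rewrite /chord/= (_ : - w - s * - x = - (w - s * x))//; ring.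
  by move=> /(key _ hw); lra.
have e : - u - - (u + B) = B by ring.
by rewrite (le_trans (chord_sub kN))// lee_fin e ge_max B_ge0 lexx.
Qed.

(** The segment between the contact point (x0, y0) and its opposite crosses every line strictly
    between the two supporting lines. *)
Lemma chord_nonempty w : `|w| < W -> chord w !=set0.
Proof.
move=> wW; pose y0 := a + phi a - phi x0; pose t := w / W.
have /andP[x00 x0a] := x0_itv.
have ay0 : a <= y0.
  by have := phi_nd fphi x00 x0a; rewrite /y0; lra.
have g0 : gauge phi (x0, y0) <= 2 * phi a.
  rewrite /gauge/= (phi_out fphi ay0) /y0; lra.
have t1 : 0 <= `|t| < 1.
  by rewrite normr_ge0 /t normrM normfV (gtr0_norm W_gt0) ltr_pdivrMr// mul1r.
have Dt : D (`|t| *: (x0, y0)).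
  exact: (region_scale fphi).
exists (t * x0); rewrite /chord/=.
have -> : w - s * (t * x0) = t * y0.
  by rewrite -{1}[w](divfK (negbT (gt_eqF W_gt0))) -/t /W /y0; ring.
case: (ger0P t) Dt => _ // /DN.
by rewrite -scaleNr opprK.
Qed.

(** By convexity of the region, midpoints of points on two parallel chords lie on the middle chord;
    [measure_midpoint] then compares the lengths. *)
Lemma chord_length_concave w : `|w| + tau < W ->
  chord_length (w + tau) + chord_length (w - tau) <= 2 * chord_length w.
Proof.
move=> wW; rewrite -lee_fin EFinD EFinM -!mu_chord.
have n1 : `|w + tau| < W by rewrite (le_lt_trans (ler_normD _ _))// (gtr0_norm tau_gt0).
have n2 : `|w - tau| < W by rewrite (le_lt_trans (ler_normB _ _))// (gtr0_norm tau_gt0).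
apply: measure_midpoint; try exact: measurable_chord; try exact: chord_nonempty.
- by exists (2 * a) => x /chord_bound/andP[].
- by exists (- (2 * a)) => x /chord_bound/andP[].
- by exists (2 * a) => x /chord_bound/andP[].
- by exists (- (2 * a)) => x /chord_bound/andP[].
- have conv x y t : chord w x -> chord w y -> 0 <= t <= 1 -> chord w ((1 - t) * x + t * y).
    rewrite /chord/= /D /region/= /gauge/= => hx hy /andP[t0 t1].
    set z := (1 - t) * x + t * y.
    have h1 := tangent z x; have h2 := tangent z y.
    have h3 := tangent (w - s * z) (w - s * x); have h4 := tangent (w - s * z) (w - s * y).
    have t1' : 0 <= 1 - t by rewrite subr_ge0.
    have g1 := ler_wpM2l t1' h1; have g2 := ler_wpM2l t0 h2.
    have g3 := ler_wpM2l t1' h3; have g4 := ler_wpM2l t0 h4.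
    have e1 : (1 - t) * (phi z + f z * (x - z)) + t * (phi z + f z * (y - z)) = phi z by rewrite /z; ring.
    have e2 : (1 - t) * (phi (w - s * z) + f (w - s * z) * (w - s * x - (w - s * z))) +
      t * (phi (w - s * z) + f (w - s * z) * (w - s * y - (w - s * z))) = phi (w - s * z).
      by rewrite /z; ring.
    have k1 : phi z + phi (w - s * z) <= (1 - t) * (phi x + phi (w - s * x)) + t * (phi y + phi (w - s * y)) by lra.
    apply: (le_lt_trans k1).
    have [t0'|t0'] := eqVneq t 0; first by rewrite t0'; lra.
    have tp : 0 < t by rewrite lt_neqAle eq_sym t0'.
    have l1 := ler_wpM2l t1' (ltW hx).
    have l2 : t * (phi y + phi (w - s * y)) < t * (2 * phi a) by rewrite ltr_pM2l.
    by lra.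
  move=> x y Cx Cy z /andP[xz zy].
  have [xy|xy] := eqVneq x y; first by rewrite (_ : z = x)//; apply/eqP; rewrite eq_le xz xy zy.
  have xy' : 0 < y - x by rewrite subr_gt0 lt_neqAle xy (le_trans xz).
  have -> : z = (1 - (z - x) / (y - x)) * x + (z - x) / (y - x) * y.
    by field; rewrite gt_eqF.
  apply: conv => //; apply/andP; split; last by rewrite ler_pdivrMr// mul1r lerD2r.
  by rewrite divr_ge0 ?(ltW xy')// subr_ge0.
move=> x y; rewrite /chord/= /D /region/= /gauge/= => hx hy.
have h1 := phi_mid fphi x y.
have h2 := phi_mid fphi (w + tau - s * x) (w - tau - s * y).
have e : (w + tau - s * x + (w - tau - s * y)) / 2 = w - s * ((x + y) / 2) by field.
by rewrite e in h2; lra.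
Qed.

Lemma measurable_chord_length : measurable_fun [set: T] chord_length.
Proof.
apply: measurableT_comp => //.
have := measurable_fun_ysection mu measurable_chord_graph.
by congr (measurable_fun _ _); apply/funext => w /=; congr (mu _);
  apply/seteqP; split => x; rewrite /ysection/= inE.
Qed.

Let D_bound z : D z -> `|z.1| <= 2 * a /\ `|z.2| <= 2 * a.
Proof. exact: (region_bound fphi). Qed.

(** The shear (x, y) |-> (x, y + s x) translates each vertical line, hence preserves integrals;
    Fubini then collects the points with the same w. *)
Lemma integral_region_sheared (k : R -> R) : measurable_fun [set: T] k ->
  (forall w, `|k w| <= 1) ->
  \int[mu2]_z (\1_D z * k (z.2 + s * z.1)) = \int[mu]_w (k w * chord_length w).
Proof.
move=> mk k1; have mD := measurable_region.
pose h (z : T2) : R := \1_D z * k (z.2 + s * z.1).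
(* The integrand after the shear: its horizontal slices are the indicators of chords times k. *)
pose H (z : T2) : R := \1_D (z.1, z.2 - s * z.1) * k z.2.
have b1 (b : bool) : `|b%:R| <= 1 :> R by case: b; rewrite ?normr1 ?normr0.
have ms : measurable_fun [set: T2] (fun z : T2 => z.2 + s * z.1 : T).
  apply: measurable_funD; first exact: measurable_snd.
  by apply: measurable_funM; [exact: measurable_cst | exact: measurable_fst].
have mh : measurable_fun [set: T2] h.
  by apply: measurable_funM; [exact: measurable_indic | exact: (measurableT_comp mk ms)].
have mH : measurable_fun [set: T2] H.
  apply: measurable_funM; last by apply: (measurableT_comp mk); exact: measurable_snd.
  rewrite (_ : (fun x : T2 => _) = \1_[set z : T2 | D (z.1, z.2 - s * z.1)] :> (T2 -> R)).
    by apply: measurable_indic; exact: measurable_chord_graph.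
  by apply/funext => z; rewrite !indicE; congr ((nat_of_bool _)%:R); apply/idP/idP; rewrite !inE.
have ih : mu2.-integrable setT (EFin \o h).
  apply: (@integrable2_bounded_support _ _ (2 * a) 1) => // z.
    by rewrite /h normrM indicE -[leRHS]mulr1 ler_pM.
  rewrite /h mulf_eq0 negb_or indicE => /andP[+ _].
  by rewrite pnatr_eq0 eqb0 negbK inE => /D_bound.
have iH : mu2.-integrable setT (EFin \o H).
  apply: (@integrable2_bounded_support _ _ (2 * a + W) 1) => // z.
    by rewrite /H normrM indicE -[leRHS]mulr1 ler_pM.
  rewrite /H mulf_eq0 negb_or indicE => /andP[+ _].
  rewrite pnatr_eq0 eqb0 negbK inE => Dz.
  have := slab Dz; have [/= h1 _] := D_bound Dz; rewrite /= subrK => h2.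
  by have := a_gt0; have := W_gt0; split; lra.
rewrite /Rintegral; congr fine.
rewrite -(integral12_prod_meas1 ih) /fubini_F /=.
transitivity (\int[mu]_x \int[mu]_w (H (x, w))%:E)%E.
  apply: eq_integral => x _.
  rewrite -(@integral_translate _ (- (s * x)) (fun y => (h (x, y))%:E)).
    by apply: eq_integral => w _; rewrite /h /H /= subrK.
  by apply/measurable_EFinP; apply: (measurableT_comp mh); exact: pair1_measurable.
rewrite (Fubini iH); apply: eq_integral => w _.
have mC := measurable_chord w.
have Hw x : (H (x, w))%:E = ((k w)%:E * (\1_(chord w) x)%:E)%E.
  rewrite /H /= -EFinM mulrC; congr ((_ * _)%:E); rewrite !indicE; congr ((nat_of_bool _)%:R).
rewrite (eq_integral (fun x => (k w)%:E * (\1_(chord w) x)%:E)%E); last by move=> x _; rewrite -Hw.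
rewrite integralZl//.
  by rewrite integral_indic// setIT EFinM -mu_chord.
apply/integrableP; split; first exact/measurable_EFinP/measurable_indic.
rewrite (eq_integral (fun x => (\1_(chord w) x)%:E)); last first.
  by move=> x _; rewrite gee0_abs.
by rewrite integral_indic// setIT (le_lt_trans (_ : _ <= (chord_length w)%:E)%E) ?ltry// -mu_chord.
Qed.

Lemma region_integral_bound (k : R -> R) : measurable_fun [set: T] k ->
  (forall w, `|k w| <= 1) -> (forall w, k (w + tau) = - k w) ->
  `|\int[mu2]_z (\1_D z * k (z.2 + s * z.1))| <= 2 * tau * B.
Proof.
move=> mk k1 kt; rewrite integral_region_sheared//.
apply: (@oscillation_bound _ chord_length k W tau B (4 * a)) => //.
- exact: measurable_chord_length.
- exact: chord_length_ge0.
- exact: chord_length_bound.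
- exact: chord_length_support.
- exact: chord_length_concave.
- exact: chord_length_edge.
Qed.

End region_fourier.

(** * Measurability and integrability on the plane *)

Section planar_measurability.
Context {R : realType}.
Notation mu := (@lebesgue_measure R).
Notation mu2 := (@lebesgue2 R).
Notation T := (measurableTypeR R).
Notation T2 := (measurableTypeR R * measurableTypeR R)%type.

(** An open set is the union of the countably many boxes with rational ends that it contains, which
    places it in the product sigma-algebra. *)
Lemma open_measurable2 (O : set (R * R)) : open O -> measurable (O : set T2).
Proof.
move=> oO.
pose box (q : rat * rat * rat * rat) : set T2 :=
  `]ratr q.1.1.1, ratr q.1.1.2[%classic `*` `]ratr q.1.2, ratr q.2[%classic.
pose F q : set T2 := if `[< box q `<=` O >] then box q else set0.
rewrite (_ : O = \bigcup_q F q).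
  apply: countable_bigcupT_measurable; first exact: countableP.
  move=> q; rewrite /F; case: ifP => // _.
  by apply: measurableX.
apply/seteqP; split => [z Oz|z [q _]]; last first.
  by rewrite /F; case: asboolP => // h /h.
have [e /= e0 eO] : nbhs_ball z O by apply/nbhs_ballP; exact: open_nbhs_nbhs.
have r1 x : x - e < x by rewrite ltrBlDr ltrDl.
have r2 x : x < x + e by rewrite ltrDl.
have [q1] := rat_in_itvoo (r1 z.1); have [q2] := rat_in_itvoo (r2 z.1).
have [q3] := rat_in_itvoo (r1 z.2); have [q4] := rat_in_itvoo (r2 z.2).
rewrite !in_itv/= => /andP[a1 a2] /andP[b1 b2] /andP[c1 c2] /andP[d1 d2].
exists (q1, q2, q3, q4) => //; rewrite /F; case: asboolP => [_|].
  by split; rewrite /= in_itv/=; apply/andP.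
move=> h; exfalso; apply: h => -[w1 w2] [/=]; rewrite !in_itv/= => /andP[h1 h2] /andP[h3 h4].
apply: eO; split; rewrite /ball/= ltr_distl; apply/andP; split; lra.
Qed.

Lemma continuous_measurable_fun2 (u : R * R -> R) : continuous u ->
  measurable_fun [set: T2] (u : T2 -> T).
Proof.
move=> /continuousP cf; apply: (measurability _ (RGenOpens.measurableE R)).
move=> _ [_ [a [b ->] <-]]; rewrite setTI; apply: open_measurable2.
exact/cf/interval_open.
Qed.

Lemma integral_oneDsqrV : (\int[mu]_x ((oneDsqr x)^-1)%:E = pi%:E)%E.
Proof.
rewrite ge0_symfun_integralT.
- by rewrite -set_itvcy integral0y_oneDsqr -EFinM; congr EFin; field.
- by move=> x; rewrite invr_ge0 (le_trans ler01)// oneDsqr_ge1.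
- exact: continuous_oneDsqrV.
- by move=> x /=; rewrite /oneDsqr sqrrN.
Qed.

Lemma integrable2_decay (u : T2 -> R) M : measurable_fun [set: T2] u ->
  (forall z, `|u z| <= M * ((oneDsqr z.1)^-1 * (oneDsqr z.2)^-1)) ->
  mu2.-integrable setT (EFin \o u).
Proof.
move=> mu_u uM.
have d0 (x : R) : 0 <= (oneDsqr x)^-1 by rewrite invr_ge0 (le_trans ler01)// oneDsqr_ge1.
have M0 : 0 <= M.
  have := le_trans (normr_ge0 _) (uM (0, 0)).
  by rewrite /= /oneDsqr expr0n addr0 invr1 !mulr1.
have mv : measurable_fun [set: T] (fun x : T => (oneDsqr x)^-1).
  by apply: continuous_measurable_fun; exact: continuous_oneDsqrV.
have mw : measurable_fun [set: T2] (fun z : T2 => M * ((oneDsqr z.1)^-1 * (oneDsqr z.2)^-1)).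
  apply: measurable_funM => //; apply: measurable_funM.
    by apply: (measurableT_comp mv); exact: measurable_fst.
  by apply: (measurableT_comp mv); exact: measurable_snd.
apply: (@le_integrable _ _ _ _ _ _ _ (EFin \o (fun z : T2 => M * ((oneDsqr z.1)^-1 * (oneDsqr z.2)^-1)))) => //.
- exact/measurable_EFinP.
- move=> z _; rewrite /= lee_fin (le_trans (uM z))// ler_norm//.
apply/integrable12ltyP; first exact/measurable_EFinP.
have -> : (\int[mu]_x \int[mu]_y `|(M * ((oneDsqr x)^-1 * (oneDsqr y)^-1))%:E| = (M * (pi * pi))%:E)%E.
  transitivity (\int[mu]_x ((M * pi)%:E * ((oneDsqr x)^-1)%:E))%E.
    apply: eq_integral => x _.
    transitivity (\int[mu]_y ((M * (oneDsqr x)^-1)%:E * ((oneDsqr y)^-1)%:E))%E.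
      apply: eq_integral => y _; rewrite gee0_abs ?lee_fin ?mulr_ge0//.
      by rewrite -EFinM mulrA.
    rewrite ge0_integralZl_EFin//.
    + by rewrite integral_oneDsqrV -!EFinM; congr EFin; ring.
    + exact/measurable_EFinP.
    + exact: mulr_ge0.
  rewrite ge0_integralZl_EFin//.
  + by rewrite integral_oneDsqrV -!EFinM; congr EFin; ring.
  + exact/measurable_EFinP.
  + by rewrite mulr_ge0// pi_ge0.
by rewrite ltry.
Qed.

End planar_measurability.

(** * Exchange of integrals with an indicator and a bounded kernel *)

Section indicator_fubini.
Context d1 d2 (T1 : measurableType d1) (T2 : measurableType d2) (R : realType).
Variable m1 : {sigma_finite_measure set T1 -> \bar R}.
Variable m2 : {sigma_finite_measure set T2 -> \bar R}.
Variable D : set T1.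
Hypothesis mD : measurable D.
Hypothesis iD : m1.-integrable setT (EFin \o (\1_D : T1 -> R)).

Let ind_le1 (x : T1) : `|\1_D x : R| <= 1.
Proof. by rewrite indicE; case: (x \in D); rewrite ?normr1 ?normr0. Qed.

Variables (u : T2 -> R) (c : T1 -> T2 -> R).
Hypothesis iu : m2.-integrable setT (EFin \o u).
Hypothesis mc : measurable_fun [set: (T1 * T2)%type] (fun z : T1 * T2 => c z.1 z.2).
Hypothesis c_le1 : forall x t, `|c x t| <= 1.

Let mu_u : measurable_fun [set: T2] u.
Proof. by apply/measurable_EFinP; case/integrableP: iu. Qed.

Let K (z : T1 * T2) : R := \1_D z.1 * (u z.2 * c z.1 z.2).

Let mK : measurable_fun [set: (T1 * T2)%type] K.
Proof.
apply: measurable_funM.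
  by apply: (measurableT_comp (measurable_indic mD)); exact: measurable_fst.
by apply: measurable_funM => //; apply: (measurableT_comp mu_u); exact: measurable_snd.
Qed.

Let iK : (m1 \x m2)%E.-integrable setT (EFin \o K).
Proof.
have m0 : measurable_fun [set: (T1 * T2)%type] (fun z : T1 * T2 => \1_D z.1 * `|u z.2|).
  apply: measurable_funM.
    by apply: (measurableT_comp (measurable_indic mD)); exact: measurable_fst.
  by apply: measurableT_comp => //; apply: (measurableT_comp mu_u); exact: measurable_snd.
suff ih : (m1 \x m2)%E.-integrable setT (EFin \o (fun z : T1 * T2 => \1_D z.1 * `|u z.2|)).
  apply: (le_integrable _ _ _ ih) => //; first exact/measurable_EFinP.
  move=> z _; rewrite /= lee_fin /K !normrM normr_id ler_wpM2l//.
  by rewrite ler_piMr.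
apply/integrable12ltyP; first exact/measurable_EFinP.
have uy : (\int[m2]_t (`|u t|)%:E < +oo)%E by case/integrableP: iu.
have u0 : (0 <= \int[m2]_t (`|u t|)%:E)%E by apply: integral_ge0 => t _; rewrite lee_fin.
have uf : (\int[m2]_t (`|u t|)%:E)%E \is a fin_num by rewrite ge0_fin_numE.
rewrite (_ : (\int[m1]_x _)%E = (\int[m1]_x ((fine (\int[m2]_t (`|u t|)%:E))%:E * (\1_D x)%:E))%E).
  rewrite ge0_integralZl_EFin ?fine_ge0//.
    rewrite lte_mul_pinfty ?lee_fin ?fine_ge0//.
    case/integrableP: iD => _; congr (_ < _)%E; apply: eq_integral => x _.
    by rewrite /= ger0_norm.
  by apply/measurable_EFinP/measurable_indic.
apply: eq_integral => x _; rewrite fineK// muleC.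
rewrite -ge0_integralZl_EFin//; last by apply/measurable_EFinP; apply: measurableT_comp.
apply: eq_integral => t _; rewrite -EFinM /=; congr EFin.
by rewrite ger0_norm// mulr_ge0.
Qed.

Let icx x : m2.-integrable setT (EFin \o (fun t => u t * c x t)).
Proof.
apply: (le_integrable _ _ _ iu) => //.
  apply/measurable_EFinP/measurable_funM => //.
  exact: (measurableT_comp mc (pair1_measurable x)).
by move=> t _; rewrite /= lee_fin normrM ler_piMr.
Qed.

Let ict t : m1.-integrable setT (EFin \o (fun x => \1_D x * c x t)).
Proof.
apply: (le_integrable _ _ _ iD) => //.
  apply/measurable_EFinP/measurable_funM => //.
  exact: (measurableT_comp mc (pair2_measurable t)).
by move=> x _; rewrite /= lee_fin normrM ler_piMr.
Qed.

Let inner1 : (fun x => \int[m2]_t (EFin \o K) (x, t))%E =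
  (fun x => (\1_D x * \int[m2]_t (u t * c x t))%:E).
Proof.
apply/funext => x; rewrite -RintegralZl// fineK//.
by apply: integrable_fin_num => //; exact: (integrableZl _ _ (icx x)).
Qed.

Let inner2 : (fun t => \int[m1]_x (EFin \o K) (x, t))%E =
  (fun t => (u t * \int[m1]_x (\1_D x * c x t))%:E).
Proof.
apply/funext => t; rewrite -RintegralZl// fineK//.
  by apply: eq_integral => x _; rewrite /K/=; congr EFin; ring.
by apply: integrable_fin_num => //; exact: (integrableZl _ _ (ict t)).
Qed.

Lemma integrable_indicM : m1.-integrable setT
  (EFin \o (fun x => \1_D x * \int[m2]_t (u t * c x t))).
Proof. by have := integrable_fubini_F iK; rewrite /fubini_F inner1. Qed.

Lemma integrable_Mindic : m2.-integrable setT
  (EFin \o (fun t => u t * \int[m1]_x (\1_D x * c x t))).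
Proof.
pose M := \int[m1]_x `|\1_D x|.
apply: (@le_integrable _ _ _ _ _ _ _ (EFin \o (fun t => M * u t))) => //.
- by have := measurable_fubini_G iK; rewrite /fubini_G inner2.
- move=> t _; rewrite /= lee_fin mulrC !normrM ler_wpM2r//.
  apply: (@le_trans _ _ M); last exact: ler_norm.
  apply: le_trans (le_normr_Rintegral _ (ict t)) _ => //.
  apply: le_Rintegral => //; try exact: integrable_norm.
  by move=> x _; rewrite normrM ler_piMr.
exact: (integrableZl _ _ iu).
Qed.

(** With c the cosine or sine of the inner product, this is the multiplication formula for the
    Fourier transform in real form. *)
Lemma indicator_fubini :
  \int[m1]_x (\1_D x * \int[m2]_t (u t * c x t)) =
  \int[m2]_t (u t * \int[m1]_x (\1_D x * c x t)).
Proof. by have := Fubini iK; rewrite inner1 inner2 /Rintegral => ->. Qed.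

End indicator_fubini.

(** * Decay and integrability of Schwartz functions *)

Section schwartz_functions.
Context {R : realType}.
Local Open Scope complex_scope.
Notation mu2 := (@lebesgue2 R).
Notation T := (measurableTypeR R).
Notation T2 := (measurableTypeR R * measurableTypeR R)%type.
Notation normc := ComplexField.Normc.normc.
Implicit Types (phi psi : R * R -> R[i]) (z : R[i]).

Lemma Re_le_normc z : `|complex.Re z| <= normc z.
Proof.
by case: z => x y /=; rewrite -sqrtr_sqr ler_wsqrtr// lerDl sqr_ge0.
Qed.

Lemma Im_le_normc z : `|complex.Im z| <= normc z.
Proof.
by case: z => x y /=; rewrite -sqrtr_sqr ler_wsqrtr// lerDr sqr_ge0.
Qed.

Lemma normc_le_add z : normc z <= `|complex.Re z| + `|complex.Im z|.
Proof. by case: z => x y; have := enorm_le_add (x, y); rewrite /enorm /dot/= -!expr2. Qed.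

Lemma normc_ge0 z : 0 <= normc z.
Proof. by case: z => x y; exact: sqrtr_ge0. Qed.

Lemma schwartz_continuous phi : schwartz phi ->
  continuous (fun x => complex.Re (phi x)) /\ continuous (fun x => complex.Im (phi x)).
Proof.
by move=> [s1 s2 _]; split => x; apply: differentiable_continuous;
  [exact: (s1 [::] x) | exact: (s2 [::] x)].
Qed.

Lemma cdersn_nil phi x : cdersn [::] phi x = phi x.
Proof. by rewrite /cdersn/=; case: (phi x). Qed.

(** The weights of orders 0 and 4 suffice because (1 + x^2)(1 + y^2) <= 2 + 2 (x^2 + y^2)^2. *)
Lemma schwartz_decay phi : schwartz phi -> exists M, forall x,
  normc (phi x) <= M * ((oneDsqr x.1)^-1 * (oneDsqr x.2)^-1).
Proof.
move=> [_ _ h]; have [M0 hM0] := h 0%N [::]; have [M4 hM4] := h 4%N [::].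
exists (2 * M0 + 2 * M4) => x.
have := hM0 x; have := hM4 x; rewrite /schwartz_weight cdersn_nil expr0 mul1r.
have e4 : enorm x ^+ 4 = (x.1 ^+ 2 + x.2 ^+ 2) ^+ 2 by rewrite -enorm_sqr -exprM.
rewrite e4; have n0 := normc_ge0 (phi x); set n := normc (phi x) in n0 *; set r := _ + _.
move=> h4 h0.
have p1 : 0 < oneDsqr x.1 by rewrite (lt_le_trans ltr01)// oneDsqr_ge1.
have p2 : 0 < oneDsqr x.2 by rewrite (lt_le_trans ltr01)// oneDsqr_ge1.
rewrite -invfM ler_pdivlMr ?mulr_gt0//.
have h1 : oneDsqr x.1 * oneDsqr x.2 <= 2 + 2 * r ^+ 2.
  rewrite /oneDsqr /r; have a1 := sqr_ge0 x.1; have a2 := sqr_ge0 x.2.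
  set p := x.1 ^+ 2 in a1 *; set q := x.2 ^+ 2 in a2 *.
  have := sqr_ge0 (p + q - 1); have := sqr_ge0 p; have := sqr_ge0 q; have := mulr_ge0 a1 a2.
  by lra.
have := ler_wpM2l n0 h1; lra.
Qed.

Lemma schwartz_integrable phi : schwartz phi ->
  mu2.-integrable setT (EFin \o (fun x => complex.Re (phi x))) /\
  mu2.-integrable setT (EFin \o (fun x => complex.Im (phi x))).
Proof.
move=> sphi; have [c1 c2] := schwartz_continuous sphi.
have [M hM] := schwartz_decay sphi.
split; apply: (@integrable2_decay _ _ M).
- exact: continuous_measurable_fun2.
- by move=> z; rewrite (le_trans (Re_le_normc _)).
- exact: continuous_measurable_fun2.
- by move=> z; rewrite (le_trans (Im_le_normc _)).
Qed.

End schwartz_functions.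

(** * Sigma-finiteness of planar Lebesgue measure, for Fubini on the product of two planes *)

Section sigma_finite_plane.
Context {R : realType}.
Notation mu2 := (@lebesgue2 R).
Notation T2 := (measurableTypeR R * measurableTypeR R)%type.

Lemma lebesgue2_sigma_finite : sigma_finite [set: T2] mu2.
Proof.
have /sigma_finiteP[F [TF ndF Foo]] := sigma_finiteT (@lebesgue_measure R).
exists (fun n => F n `*` F n).
  rewrite -setXTT TF predeqE => -[x y]; split.
    move=> [/= [n _ Fnx] [k _ Gky]]; exists (maxn n k) => //; split.
    - by move: x Fnx; exact/subsetPset/ndF/leq_maxl.
    - by move: y Gky; exact/subsetPset/ndF/leq_maxr.
  by move=> [n _ []/= ? ?]; split; exists n.
move=> k; have [? ?] := Foo k; split; first exact: measurableX.
by rewrite /= /lebesgue2 product_measure1E// lte_mul_pinfty// ge0_fin_numE.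
Qed.

HB.instance Definition _ := Measure.on mu2.
HB.instance Definition _ := Measure_isSigmaFinite.Build _ _ _ mu2 lebesgue2_sigma_finite.

End sigma_finite_plane.

(** * The indicator as a tempered distribution and its Fourier transform *)

Section characteristic_distribution.
Context {R : realType}.
Local Open Scope complex_scope.
Notation mu2 := (@lebesgue2 R).
Notation T := (measurableTypeR R).
Notation T2 := (measurableTypeR R * measurableTypeR R)%type.
Notation normc := ComplexField.Normc.normc.
Implicit Types (phi psi : R * R -> R[i]) (z : R[i]).
Variable D : set (R * R).
Hypothesis mD : measurable (D : set T2).
Hypothesis iD : mu2.-integrable setT (EFin \o (\1_D : T2 -> R)).

Let ind_ge0 (x : R * R) : 0 <= \1_D x :> R.
Proof. by []. Qed.

Let ind_le1 (x : R * R) : \1_D x <= 1 :> R.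
Proof. by rewrite indicE; case: (x \in D). Qed.

Lemma Re_char_funM x z : complex.Re (char_fun D x * z) = \1_D x * complex.Re z.
Proof. by case: z => p q /=; rewrite mul0r subr0. Qed.

Lemma Im_char_funM x z : complex.Im (char_fun D x * z) = \1_D x * complex.Im z.
Proof. by case: z => p q /=; rewrite mul0r addr0. Qed.

Lemma distr_of_char_fun phi : distr_of (char_fun D) phi =
  (\int[mu2]_x (\1_D x * complex.Re (phi x))) +i* (\int[mu2]_x (\1_D x * complex.Im (phi x))).
Proof.
by rewrite /distr_of /cintegral; congr (_ +i* _); apply: eq_Rintegral => x _;
  rewrite ?Re_char_funM ?Im_char_funM.
Qed.

Let iM (u : T2 -> R) : mu2.-integrable setT (EFin \o u) ->
  mu2.-integrable setT (EFin \o (fun x => \1_D x * u x)).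
Proof.
move=> iu; apply: (le_integrable _ _ _ iu) => //.
  apply/measurable_EFinP/measurable_funM; first exact: measurable_indic.
  by apply/measurable_EFinP; case/integrableP: iu.
by move=> x _; rewrite /= lee_fin normrM ler_piMl// ger0_norm.
Qed.

Let iD2 (g h : T2 -> R) : mu2.-integrable setT (EFin \o g) -> mu2.-integrable setT (EFin \o h) ->
  mu2.-integrable setT (EFin \o (fun x => g x + h x)).
Proof. by move=> ig ih; exact: (integrableD _ ig ih). Qed.

Let iB2 (g h : T2 -> R) : mu2.-integrable setT (EFin \o g) -> mu2.-integrable setT (EFin \o h) ->
  mu2.-integrable setT (EFin \o (fun x => g x - h x)).
Proof. by move=> ig ih; exact: (integrableB _ ig ih). Qed.

Let iZ2 c (g : T2 -> R) : mu2.-integrable setT (EFin \o g) ->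
  mu2.-integrable setT (EFin \o (fun x => c * g x)).
Proof. by move=> ig; exact: (integrableZl _ _ ig). Qed.

Lemma distr_of_char_fun_linear (c : R[i]) phi psi : schwartz phi -> schwartz psi ->
  distr_of (char_fun D) (fun x => c * phi x + psi x) =
  c * distr_of (char_fun D) phi + distr_of (char_fun D) psi.
Proof.
move=> sphi spsi; have [i1 i2] := schwartz_integrable sphi.
have [i3 i4] := schwartz_integrable spsi.
have j1 := iM i1; have j2 := iM i2; have j3 := iM i3; have j4 := iM i4.
rewrite !distr_of_char_fun; case: c => p q.
have eR : \int[mu2]_x (\1_D x * complex.Re ((p +i* q) * phi x + psi x)) =
  p * (\int[mu2]_x (\1_D x * complex.Re (phi x)))
   - q * (\int[mu2]_x (\1_D x * complex.Im (phi x))) + \int[mu2]_x (\1_D x * complex.Re (psi x)).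
  rewrite -!RintegralZl// -RintegralB//; [|exact: iZ2|exact: iZ2].
  rewrite -RintegralD//; last by apply: iB2; exact: iZ2.
  by apply: eq_Rintegral => x _; case: (phi x) => ? ?; case: (psi x) => ? ? /=; ring.
have eI : \int[mu2]_x (\1_D x * complex.Im ((p +i* q) * phi x + psi x)) =
  p * (\int[mu2]_x (\1_D x * complex.Im (phi x)))
   + q * (\int[mu2]_x (\1_D x * complex.Re (phi x))) + \int[mu2]_x (\1_D x * complex.Im (psi x)).
  rewrite -!RintegralZl// -RintegralD//; [|exact: iZ2|exact: iZ2].
  rewrite -RintegralD//; last by apply: iD2; exact: iZ2.
  by apply: eq_Rintegral => x _; case: (phi x) => ? ?; case: (psi x) => ? ? /=; ring.
by rewrite eR eI; simpc.
Qed.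

(** Real and imaginary parts of the pairing are each bounded by the area [m] of D times the supremum
    seminorm, so convergence in that single seminorm is enough. *)
Lemma distr_of_char_fun_tempered : tempered (distr_of (char_fun D)).
Proof.
split; first exact: distr_of_char_fun_linear.
move=> phi_ phi sn s0 /(_ 0%N [::]) cvg0.
pose S n := schwartz_seminorm 0 [::] (fun x => phi_ n x - phi x).
pose m := \int[mu2]_x \1_D x.
have m0 : 0 <= m by apply: Rintegral_ge0 => x _.
have bnd n x : normc (phi_ n x - phi x) <= S n.
  have [_ _ h1] := sn n; have [_ _ h2] := s0.
  have [M1 hM1] := h1 0%N [::]; have [M2 hM2] := h2 0%N [::].
  apply: ub_le_sup; last first.
    by exists x => //; rewrite /schwartz_weight cdersn_nil expr0 mul1r.
  exists (M1 + M2) => _ [y _ <-].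
  rewrite /schwartz_weight cdersn_nil expr0 mul1r.
  apply: le_trans (le_normcD _ _) _; rewrite normcN.
  have := hM1 y; have := hM2 y; rewrite /schwartz_weight !cdersn_nil expr0 !mul1r.
  by move=> k2 k1; exact: lerD.
have key (u v : T2 -> R) n : mu2.-integrable setT (EFin \o u) -> mu2.-integrable setT (EFin \o v) ->
  (forall x, `|u x - v x| <= S n) ->
  `|\int[mu2]_x (\1_D x * u x) - \int[mu2]_x (\1_D x * v x)| <= m * S n.
  move=> iu iv uv; rewrite -RintegralB//; [|exact: iM|exact: iM].
  have ib : mu2.-integrable setT (EFin \o (fun x => \1_D x * u x - \1_D x * v x)).
    by apply: iB2; exact: iM.
  apply: le_trans (le_normr_Rintegral _ ib) _ => //.
  rewrite mulrC -RintegralZl//; apply: le_Rintegral => //.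
  - exact: integrable_norm.
  - exact: iZ2.
  by move=> x _; rewrite -mulrBr normrM ger0_norm// mulrC ler_wpM2r.
apply: (@squeeze_cvgr _ _ _ _ (cst 0) (fun n => m * S n + m * S n)).
- near=> n; apply/andP; split; first exact: normc_ge0.
  apply: (le_trans (normc_le_add _)).
  have [i1 i2] := schwartz_integrable (sn n); have [i3 i4] := schwartz_integrable s0.
  rewrite !distr_of_char_fun; apply: lerD; apply: key => // x.
    by have := le_trans (Re_le_normc _) (bnd n x); case: (phi_ n x) => ? ?; case: (phi x).
  by have := le_trans (Im_le_normc _) (bnd n x); case: (phi_ n x) => ? ?; case: (phi x).
- exact: cvg_cst.
- have c0 : (fun n => m * S n) @ \oo --> m * 0 by apply: cvgM; [exact: cvg_cst | exact: cvg0].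
  by rewrite -[X in _ --> X]addr0 -(mulr0 m); apply: cvgD.
Unshelve. all: by end_near. Qed.

Let C (x t : T2) : R := cos (- dot x t).
Let S (x t : T2) : R := sin (- dot x t).

Let mdot : measurable_fun [set: (T2 * T2)%type] (fun z : T2 * T2 => - dot z.1 z.2).
Proof.
have m1 : measurable_fun [set: (T2 * T2)%type] (fun z : T2 * T2 => z.1.1).
  exact: (measurableT_comp measurable_fst measurable_fst).
have m2 : measurable_fun [set: (T2 * T2)%type] (fun z : T2 * T2 => z.1.2).
  exact: (measurableT_comp measurable_snd measurable_fst).
have m3 : measurable_fun [set: (T2 * T2)%type] (fun z : T2 * T2 => z.2.1).
  exact: (measurableT_comp measurable_fst measurable_snd).
have m4 : measurable_fun [set: (T2 * T2)%type] (fun z : T2 * T2 => z.2.2).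
  exact: (measurableT_comp measurable_snd measurable_snd).
apply: measurableT_comp; first by apply: continuous_measurable_fun; exact: opp_continuous.
by apply: measurable_funD; apply: measurable_funM.
Qed.

Let mC : measurable_fun [set: (T2 * T2)%type] (fun z : T2 * T2 => C z.1 z.2).
Proof.
apply: (measurableT_comp (continuous_measurable_fun _) mdot).
exact: continuous_cos.
Qed.

Let mS : measurable_fun [set: (T2 * T2)%type] (fun z : T2 * T2 => S z.1 z.2).
Proof.
apply: (measurableT_comp (continuous_measurable_fun _) mdot).
exact: continuous_sin.
Qed.

Let C1 x t : `|C x t| <= 1.
Proof. by rewrite ler_norml cos_geN1 cos_le1. Qed.

Let S1 x t : `|S x t| <= 1.
Proof. by rewrite ler_norml sin_geN1 sin_le1. Qed.

Let dotC (x t : T2) : dot x t = dot t x.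
Proof. by rewrite /dot mulrC [X in _ + X]mulrC. Qed.

Let CC x t : C x t = C t x. Proof. by rewrite /C dotC. Qed.
Let SC x t : S x t = S t x. Proof. by rewrite /S dotC. Qed.

Lemma fourier_char_fun xi : fourier (char_fun D) xi =
  (\int[mu2]_x (\1_D x * cos (- dot xi x))) +i* (\int[mu2]_x (\1_D x * sin (- dot xi x))).
Proof.
by rewrite /fourier /cintegral; congr (_ +i* _); apply: eq_Rintegral => x _;
  rewrite ?Re_char_funM ?Im_char_funM.
Qed.

Let iuc (u : T2 -> R) (c : T2 -> T2 -> R) x : mu2.-integrable setT (EFin \o u) ->
  measurable_fun [set: (T2 * T2)%type] (fun z : T2 * T2 => c z.1 z.2) ->
  (forall x t, `|c x t| <= 1) ->
  mu2.-integrable setT (EFin \o (fun t => u t * c x t)).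
Proof.
move=> iu mc c1; apply: (le_integrable _ _ _ iu) => //.
  apply/measurable_EFinP/measurable_funM.
    by apply/measurable_EFinP; case/integrableP: iu.
  exact: (measurableT_comp mc (pair1_measurable x)).
by move=> t _; rewrite /= lee_fin normrM ler_piMr.
Qed.

(** The distributional transform is given by the classical one. Splitting into real and imaginary
    parts leaves four instances of [indicator_fubini]. *)
Lemma fourier_distr_char_fun phi : schwartz phi ->
  fourier_distr (distr_of (char_fun D)) phi = distr_of (fourier (char_fun D)) phi.
Proof.
move=> sphi; have [iu iv] := schwartz_integrable sphi.
set u := (fun x => complex.Re (phi x)) in iu; set v := (fun x => complex.Im (phi x)) in iv.
pose F (w : T2 -> R) (c : T2 -> T2 -> R) (x : T2) := \int[mu2]_t (w t * c x t).
pose G (c : T2 -> T2 -> R) (t : T2) := \int[mu2]_x (\1_D x * c x t).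
have iF w (c : T2 -> T2 -> R) : mu2.-integrable setT (EFin \o w) ->
    measurable_fun [set: (T2 * T2)%type] (fun z : T2 * T2 => c z.1 z.2) ->
    (forall x t, `|c x t| <= 1) -> 
    mu2.-integrable setT (EFin \o (fun x => \1_D x * F w c x)).
  by move=> iw mc c1; exact: (integrable_indicM (m1 := mu2) (m2 := mu2) mD iD iw mc c1).
have iG w (c : T2 -> T2 -> R) : mu2.-integrable setT (EFin \o w) ->
    measurable_fun [set: (T2 * T2)%type] (fun z : T2 * T2 => c z.1 z.2) ->
    (forall x t, `|c x t| <= 1) -> 
    mu2.-integrable setT (EFin \o (fun x => w x * G c x)).
  by move=> iw mc c1; exact: (integrable_Mindic (m1 := mu2) (m2 := mu2) mD iD iw mc c1).
have FG w (c : T2 -> T2 -> R) : mu2.-integrable setT (EFin \o w) ->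
    measurable_fun [set: (T2 * T2)%type] (fun z : T2 * T2 => c z.1 z.2) ->
    (forall x t, `|c x t| <= 1) -> 
    \int[mu2]_x (\1_D x * F w c x) = \int[mu2]_t (w t * G c t).
  by move=> iw mc c1; exact: (indicator_fubini (m1 := mu2) (m2 := mu2) mD iD iw mc c1).
have eR x : complex.Re (fourier phi x) = F u C x - F v S x.
  rewrite /F -RintegralB//; [|exact: iuc|exact: iuc].
  by apply: eq_Rintegral => t _; rewrite /u /v; case: (phi t) => p q /=.
have eI x : complex.Im (fourier phi x) = F u S x + F v C x.
  rewrite /F -RintegralD//; [|exact: iuc|exact: iuc].
  by apply: eq_Rintegral => t _; rewrite /u /v; case: (phi t) => p q /=.
have gR t : complex.Re (fourier (char_fun D) t) = G C t.
  by rewrite fourier_char_fun /=; apply: eq_Rintegral => x _; rewrite CC.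
have gI t : complex.Im (fourier (char_fun D) t) = G S t.
  by rewrite fourier_char_fun /=; apply: eq_Rintegral => x _; rewrite SC.
rewrite /fourier_distr distr_of_char_fun /distr_of /cintegral.
have ReM (z w : R[i]) : complex.Re (z * w) = complex.Re z * complex.Re w - complex.Im z * complex.Im w.
  by case: z => ? ?; case: w.
have ImM (z w : R[i]) : complex.Im (z * w) = complex.Re z * complex.Im w + complex.Im z * complex.Re w.
  by case: z => ? ?; case: w.
congr (_ +i* _).
  transitivity (\int[mu2]_x (\1_D x * F u C x - \1_D x * F v S x)).
    by apply: eq_Rintegral => x _; rewrite eR mulrBr.
  rewrite RintegralB//; [|exact: iF|exact: iF].
  rewrite !FG// -RintegralB//; [|exact: iG|exact: iG].
  by apply: eq_Rintegral => t _; rewrite ReM gR gI /u /v; ring.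
transitivity (\int[mu2]_x (\1_D x * F u S x + \1_D x * F v C x)).
  by apply: eq_Rintegral => x _; rewrite eI mulrDr.
rewrite RintegralD//; [|exact: iF|exact: iF].
rewrite !FG// -RintegralD//; [|exact: iG|exact: iG].
by apply: eq_Rintegral => t _; rewrite ImM gR gI /u /v; ring.
Qed.

Let measurable_int_ind (c : T2 -> T2 -> R) :
  measurable_fun [set: (T2 * T2)%type] (fun z : T2 * T2 => c z.1 z.2) ->
  (forall x t, `|c x t| <= 1) ->
  measurable_fun [set: T2] (fun t => \int[mu2]_x (\1_D x * c t x)).
Proof.
move=> mc c1.
(* Adding 1 makes the kernel nonnegative, so that the marginal is measurable by Tonelli; the area of
   D is subtracted afterwards. *)
pose K (z : T2 * T2) : \bar R := (\1_D z.2 * (1 + c z.1 z.2))%:E.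
have K0 (z : T2 * T2) : (0 <= K z)%E.
  rewrite lee_fin mulr_ge0//; have := c1 z.1 z.2; rewrite ler_norml => /andP[h _]; lra.
have mK : measurable_fun [set: (T2 * T2)%type] K.
  apply/measurable_EFinP/measurable_funM.
    exact: (measurableT_comp (measurable_indic mD) measurable_snd).
  by apply: measurable_funD.
have -> : (fun t => \int[mu2]_x (\1_D x * c t x)) =
  (fun t => fine (\int[mu2]_x (K (t, x))) - \int[mu2]_x (\1_D x : R)).
  apply/funext => t.
  have -> : fine (\int[mu2]_x (K (t, x)))%E = \int[mu2]_x (\1_D x + \1_D x * c t x).
    by apply: eq_Rintegral => x _; rewrite mulrDr mulr1.
  by rewrite RintegralD//; [rewrite addrC addKr | exact: iuc].
apply: measurable_funB => //; apply: measurableT_comp => //.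
exact: (@measurable_fun_fubini_tonelli_F _ _ _ _ _ mu2 K mK K0).
Qed.

Lemma measurable_fourier_char_fun :
  measurable_fun [set: T2] (fun x => complex.Re (fourier (char_fun D) x)) /\
  measurable_fun [set: T2] (fun x => complex.Im (fourier (char_fun D) x)).
Proof.
split.
  rewrite (_ : (fun x => _) = (fun t => \int[mu2]_x (\1_D x * C t x))).
    exact: measurable_int_ind.
  by apply/funext => x; rewrite fourier_char_fun.
rewrite (_ : (fun x => _) = (fun t => \int[mu2]_x (\1_D x * S t x))).
  exact: measurable_int_ind.
by apply/funext => x; rewrite fourier_char_fun.
Qed.

Lemma A_char_fun (p : \bar R) :
  finite_norm mu2 p (fun x => normc (fourier (char_fun D) x)) ->
  A_ p (distr_of (char_fun D)).
Proof.
move=> fin; have [m1 m2] := measurable_fourier_char_fun.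
split; first exact: distr_of_char_fun_tempered.
exists (fourier (char_fun D)) => //.
exact: fourier_distr_char_fun.
Qed.

End characteristic_distribution.

(** * Integrals of powers near 0 and near infinity *)

Section power_integrals.
Context {R : realType}.
Notation mu := (@lebesgue_measure R).
Notation T := (measurableTypeR R).

Lemma term_le_nneseries (u : nat -> \bar R) k : (forall n, (0 <= u n)%E) ->
  (u k <= \sum_(0 <= n <oo) u n)%E.
Proof.
move=> u0; apply: (@le_trans _ _ (\sum_(0 <= n < k.+1) u n)%E).
  by rewrite big_nat_recr//= leeDr// sume_ge0.
by apply: nneseries_lim_ge => n _ _; exact: u0.
Qed.

Lemma integral_le_pieces (D : set T) (f : T -> R) (J : nat -> set T) (c m : nat -> R) :
  measurable D -> measurable_fun D f -> (forall n, measurable (J n)) ->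
  (forall n, 0 <= c n) -> (forall x, D x -> 0 <= f x) ->
  (forall x, D x -> exists2 n, J n x & f x <= c n) ->
  (forall n, (mu (J n) <= (m n)%:E)%E) ->
  (\int[mu]_(x in D) (f x)%:E <= \sum_(0 <= n <oo) (c n * m n)%:E)%E.
Proof.
move=> mD mf mJ c0 f0 fc Jm.
have mt n : measurable_fun [set: T] (fun x => (c n * \1_(J n) x)%:E).
  by apply/measurable_EFinP/measurable_funM => //; exact: measurable_indic.
have t0 n (x : T) : (0 <= (c n * \1_(J n) x)%:E)%E by rewrite lee_fin mulr_ge0.
apply: (@le_trans _ _ (\int[mu]_(x in D) \sum_(0 <= n <oo) (c n * \1_(J n) x)%:E)%E).
  apply: ge0_le_integral => //.
  - by apply/measurable_EFinP.
  - by apply: ge0_emeasurable_sum => [n x _ _|n _]; [exact: t0 | exact: measurable_funTS].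
  - move=> x Dx; have [n Jx fcn] := fc x Dx.
    apply: le_trans (term_le_nneseries n _); last by move=> k.
    by rewrite lee_fin indicE mem_set// mulr1.
rewrite integral_nneseries//; last by move=> n; exact: measurable_funTS.
apply: lee_nneseries => [n _ _|n _]; first exact: integral_ge0.
apply: (@le_trans _ _ (\int[mu]_x ((c n)%:E * (\1_(J n) x)%:E))%E).
  by apply: ge0_subset_integral => //; exact: mt.
rewrite ge0_integralZl_EFin//; last by apply/measurable_EFinP/measurable_indic.
rewrite integral_indic// setIT EFinM lee_wpmul2l ?lee_fin//; exact: Jm.
Qed.

Lemma le0_ler_powR (q x y : R) : q <= 0 -> 0 < x -> x <= y -> y `^ q <= x `^ q.
Proof.
move=> q0 x0 xy; have y0 := lt_le_trans x0 xy.
rewrite -[q]opprK (powRN y (- q)) (powRN x (- q)) lef_pV2 ?posrE ?powR_gt0//.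
by apply: ge0_ler_powR; rewrite ?nnegrE ?oppr_ge0 ?(ltW x0) ?(ltW y0).
Qed.

Lemma half_powR_lt1 (r : R) : 0 < r -> 0 <= (2^-1 : R) `^ r < 1.
Proof.
move=> r0; have one : (1 : R) = 1 `^ r by rewrite powR1.
rewrite powR_ge0/= [ltRHS]one gt0_ltr_powR ?nnegrE//.
by rewrite invf_lt1// ltr1n.
Qed.

Lemma dyadic_powR_series (r b : R) : 0 < r -> 0 <= b ->
  (\sum_(0 <= n <oo) ((b * 2 ^- n) `^ r)%:E = (b `^ r / (1 - (2^-1) `^ r))%:E)%E.
Proof.
move=> r0 b0; have /andP[x0 x1] := half_powR_lt1 r0.
apply/cvg_lim => //.
rewrite (_ : (fun n => _) = EFin \o series (geometric (b `^ r) (2^-1 `^ r))).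
  apply: cvg_EFin; first exact: nearW.
  by apply: cvg_geometric_series; rewrite ger0_norm.
apply/funext => n; rewrite /series/= -sumEFin; apply: eq_bigr => k _; congr EFin.
rewrite powRM// ?invr_ge0 ?exprn_ge0//; congr (_ * _).
by rewrite -exprVn -!powR_mulrn ?powR_ge0 ?invr_ge0// powRAC.
Qed.

(** Dyadic intervals shrinking to 0 contribute a geometric series of ratio 2^-(q+1). *)
Lemma integral_powR_near0 (q : R) : -1 < q -> q <= 0 -> exists2 C, 0 <= C &
  forall L, 0 < L -> (\int[mu]_(x in `]0%R, L[) (x `^ q)%:E <= (C * L `^ (q + 1))%:E)%E.
Proof.
move=> q1 q0; have r0 : 0 < q + 1 by lra.
have /andP[x0 x1] := half_powR_lt1 r0.
pose C := (2^-1) `^ (q + 1) / (1 - (2^-1) `^ (q + 1)).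
exists C; first by rewrite divr_ge0// subr_ge0 ltW.
move=> L L0.
pose b n := L * 2 ^- n.
have p2 n : 0 < 2 ^- n :> R by rewrite invr_gt0 exprn_gt0.
have b0 n : 0 < b n by rewrite mulr_gt0.
have bS n : b n.+1 = b n / 2 by rewrite /b exprS invfM; lra.
suff h : (\sum_(0 <= n <oo) ((b n.+1) `^ q * b n.+1)%:E <= (C * L `^ (q + 1))%:E)%E.
  apply: le_trans h.
  apply: (@integral_le_pieces _ _ (fun n => `]b n.+1, b n]%classic) (fun n => (b n.+1) `^ q) (fun n => b n.+1)) => //.
  - by apply: measurable_funTS; exact: measurable_powR.
  - by move=> n; exact: powR_ge0.
  - by move=> x _; exact: powR_ge0.
  - move=> x; rewrite /= in_itv/= => /andP[xp xL].
    have [j hj] : exists j, b j.+1 < x.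
      have [j hj] := exp2V_small (divr_gt0 xp L0); exists j.
      rewrite bS (lt_le_trans (_ : _ < b j))//.
        by rewrite ltr_pdivrMr// ltr_pMr// ltr1n.
      by rewrite /b mulrC -ler_pdivlMr// ltW.
    have exj : exists j, b j.+1 < x by exists j.
    case: (ex_minnP exj) => n hn mn; exists n.
      rewrite /= in_itv/= hn; case: n hn mn => [|n] hn mn; first by rewrite /b expr0 invr1 mulr1 ltW.
      by rewrite leNgt; apply/negP => /mn; rewrite ltnn.
    by apply: le0_ler_powR => //; exact: ltW.
  - move=> n; rewrite /= lebesgue_measure_itv/= lte_fin -EFinB.
    by case: ifP => _; rewrite lee_fin ?(ltW (b0 _))// bS; lra.
rewrite (eq_eseriesr (g := fun n => ((L / 2 * 2 ^- n) `^ (q + 1))%:E)); last first.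
  move=> n _; congr EFin.
  have -> : L / 2 * 2 ^- n = b n.+1 by rewrite /b exprS invfM mulrA.
  by rewrite powRD ?powRr1 ?(ltW (b0 _))// gt_eqF// implybT.
have L2 : 0 <= L / 2 by rewrite divr_ge0// ltW.
rewrite dyadic_powR_series// lee_fin powRM ?invr_ge0 ?(ltW L0)//.
by rewrite /C -mulrA mulrC.
Qed.

(** Dyadic intervals growing from L contribute a geometric series of ratio 2^(q+1). *)
Lemma integral_powR_tail (q : R) : q < -1 -> exists2 C, 0 <= C &
  forall L, 0 < L -> (\int[mu]_(x in `[L, +oo[) (x `^ q)%:E <= (C * L `^ (q + 1))%:E)%E.
Proof.
move=> q1; have r0 : 0 < - (q + 1) by lra.
have /andP[x0 x1] := half_powR_lt1 r0.
exists ((1 - (2^-1) `^ (- (q + 1)))^-1); first by rewrite invr_ge0 subr_ge0 ltW.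
move=> L L0; pose b n := L * 2 ^+ n.
have p2 n : 0 < 2 ^+ n :> R by rewrite exprn_gt0.
have b0 n : 0 < b n by rewrite mulr_gt0.
have bS n : b n.+1 = 2 * b n by rewrite /b exprS; ring.
have Li : 0 <= L^-1 by rewrite invr_ge0 ltW.
suff h : (\sum_(0 <= n <oo) ((b n) `^ q * b n)%:E <=
    ((1 - (2^-1) `^ (- (q + 1)))^-1 * L `^ (q + 1))%:E)%E.
  apply: le_trans h.
  apply: (@integral_le_pieces _ _ (fun n => `[b n, b n.+1]%classic) (fun n => (b n) `^ q) b) => //.
  - by apply: measurable_funTS; exact: measurable_powR.
  - by move=> n; exact: powR_ge0.
  - by move=> x _; exact: powR_ge0.
  - move=> x; rewrite /= in_itv/= andbT => Lx.
    have xp : 0 < x by rewrite (lt_le_trans L0).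
    have exj : exists j, x <= b j.+1.
      have [j hj] := exp2V_small (divr_gt0 L0 xp); exists j.
      rewrite ltr_pdivlMr// mulrC ltr_pdivrMr// in hj.
      by have := b0 j; rewrite bS {1}/b; move: hj; rewrite -/(b j); lra.
    case: (ex_minnP exj) => n hn mn.
    have bx : b n <= x.
      case: n hn mn => [|n] hn mn; first by rewrite /b expr0 mulr1.
      by rewrite leNgt; apply/negP => /ltW/mn; rewrite ltnn.
    exists n; first by rewrite /= in_itv/= bx.
    by apply: le0_ler_powR => //; lra.
  - move=> n; rewrite /= lebesgue_measure_itv/= lte_fin -EFinB.
    by case: ifP => _; rewrite lee_fin ?(ltW (b0 _))// bS; lra.
rewrite (eq_eseriesr (g := fun n => ((L^-1 * 2 ^- n) `^ (- (q + 1)))%:E)); last first.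
  move=> n _; congr EFin.
  have -> : L^-1 * 2 ^- n = (b n)^-1 by rewrite /b invfM.
  rewrite -powR_inv1 ?(ltW (b0 _))// -powRrM mulN1r opprK.
  by rewrite powRD ?powRr1 ?(ltW (b0 _))// (gt_eqF (b0 n)) implybT.
rewrite dyadic_powR_series// lee_fin mulrC ler_wpM2l//.
  by rewrite invr_ge0 subr_ge0 ltW.
by rewrite -(powR_inv1 (ltW L0)) -powRrM mulN1r opprK lexx.
Qed.

End power_integrals.

(** * Negative powers of the distance to a dyadic grid *)

Section grid_distance.
Context {R : realType}.
Notation mu := (@lebesgue_measure R).
Notation T := (measurableTypeR R).

Lemma integral_indicM (A : set T) (g : T -> R) : measurable A ->
  (\int[mu]_x (\1_A x * g x)%:E = \int[mu]_(x in A) (g x)%:E)%E.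
Proof.
move=> mA; rewrite [RHS]integral_mkcond; apply: eq_integral => x _.
by rewrite patchE indicE; case: (x \in A); rewrite ?mul1r ?mul0r.
Qed.

Definition grid_point (j k : nat) : R := k%:R * 2 ^- j.

Definition grid_distance (j : nat) (t : R) : R :=
  Num.min (t - grid_point j (grid_index j t)) (grid_point j (grid_index j t).+1 - t).

(** Majorant on [0, 1), off the grid, of the q-th power of [grid_distance]: in each open cell the
    power of the smaller distance is replaced by the sum of the powers of both. *)
Definition grid_power_sum (q : R) (j : nat) (t : R) : R :=
  \sum_(k < 2 ^ j) \1_(`]grid_point j k, grid_point j k.+1[) t *
    ((t - grid_point j k) `^ q + (grid_point j k.+1 - t) `^ q).

Lemma grid_pointS j k : grid_point j k.+1 = grid_point j k + 2 ^- j.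
Proof. by rewrite /grid_point -natr1 mulrDl mul1r. Qed.

Lemma grid_point_itv j t : 0 <= t ->
  grid_point j (grid_index j t) <= t < grid_point j (grid_index j t).+1.
Proof.
move=> t0; have /andP[h1 h2] := grid_index_itv j t0.
have p0 : 0 < 2 ^+ j :> R by rewrite exprn_gt0.
by rewrite /grid_point ler_pdivrMr// ltr_pdivlMr// mulrC h1 h2.
Qed.

Lemma grid_distance_gt0 j t : 0 <= t -> (forall k, t != grid_point j k) ->
  0 < grid_distance j t.
Proof.
move=> t0 tn; have /andP[h1 h2] := grid_point_itv j t0.
by rewrite lt_min !subr_gt0 h2 andbT lt_neqAle eq_sym tn.
Qed.

Lemma grid_distance_le j t : grid_distance j t <= 2 ^- j.
Proof.
have p0 : 0 < 2 ^- j :> R by rewrite invr_gt0 exprn_gt0.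
rewrite /grid_distance grid_pointS ge_min; set g := grid_point _ _.
by have [h|h] := leP (t - g) (2 ^- j) => //=; lra.
Qed.

Lemma grid_index_shift j t v : 0 <= t -> `|v| < grid_distance j t ->
  0 <= t + v /\ grid_index j (t + v) = grid_index j t.
Proof.
move=> t0; rewrite ltr_norml lt_min ltrNl lt_min => /andP[/andP[h1 h2] /andP[h3 h4]].
have p0 : 0 < 2 ^+ j :> R by rewrite exprn_gt0.
have g0 : 0 <= grid_point j (grid_index j t) by rewrite mulr_ge0// invr_ge0 ltW.
split; first by lra.
apply: grid_index_eq; apply/andP; split.
  by rewrite mulrC -ler_pdivrMr// -/(grid_point _ _); lra.
by rewrite mulrC -ltr_pdivlMr// -/(grid_point _ _); lra.
Qed.

Lemma grid_power_sum_ge0 q j t : 0 <= grid_power_sum q j t.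
Proof.
by apply: sumr_ge0 => k _; rewrite mulr_ge0// addr_ge0// powR_ge0.
Qed.

Lemma grid_distance_powR q j t : 0 <= t < 1 -> (forall k, t != grid_point j k) ->
  grid_distance j t `^ q <= grid_power_sum q j t.
Proof.
move=> /andP[t0 t1] tn; have /andP[h1 h2] := grid_point_itv j t0.
have p0 : 0 < 2 ^+ j :> R by rewrite exprn_gt0.
have kj : (grid_index j t < 2 ^ j)%N.
  have /andP[k1 _] := grid_index_itv j t0.
  by rewrite -(ltr_nat R) (le_lt_trans k1)// natrX gtr_pMr.
rewrite /grid_power_sum (bigD1 (Ordinal kj))//= indicE mem_set ?mul1r; last first.
  by rewrite /= in_itv/= h2 andbT lt_neqAle eq_sym tn.
apply: (@le_trans _ _ ((t - grid_point j (grid_index j t)) `^ q +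
    (grid_point j (grid_index j t).+1 - t) `^ q)); last first.
  by rewrite lerDl sumr_ge0// => k _; rewrite mulr_ge0// addr_ge0// powR_ge0.
rewrite /grid_distance; case: (leP (t - _) _) => _.
  by rewrite lerDl powR_ge0.
by rewrite lerDr powR_ge0.
Qed.

Lemma measurable_powR_shift (q a : R) : measurable_fun [set: T] (fun t : T => (t - a) `^ q).
Proof.
apply: (measurableT_comp (measurable_powR q)).
by apply: measurable_funB; [exact: measurable_id | exact: measurable_cst].
Qed.

Lemma measurable_powR_shiftN (q b : R) : measurable_fun [set: T] (fun t : T => (b - t) `^ q).
Proof.
apply: (measurableT_comp (measurable_powR q)).
by apply: measurable_funB; [exact: measurable_cst | exact: measurable_id].
Qed.

Lemma measurable_grid_power_sum q j : measurable_fun [set: T] (grid_power_sum q j).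
Proof.
apply: measurable_sum => k; apply: measurable_funM; first exact: measurable_indic.
by apply: measurable_funD; [exact: measurable_powR_shift | exact: measurable_powR_shiftN].
Qed.

Lemma integral_powR_shift (q a b : R) :
  (\int[mu]_(t in `]a, b[) ((t - a) `^ q)%:E = \int[mu]_(t in `]0%R, (b - a)%R[) (t `^ q)%:E)%E.
Proof.
rewrite -[LHS]integral_indicM// -[RHS]integral_indicM//.
rewrite -(@integral_translate _ a (fun t => (\1_(`]a, b[) t * (t - a) `^ q)%:E)); last first.
  apply/measurable_EFinP/measurable_funM; first exact: measurable_indic.
  exact: measurable_powR_shift.
apply: eq_integral => t _; rewrite addrK; congr ((_ * _)%:E).
rewrite !indicE; congr ((nat_of_bool _)%:R); apply/idP/idP; rewrite !inE/= !in_itv/= => /andP[] *; apply/andP; split; lra.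
Qed.

Lemma integral_powR_shiftN (q a b : R) :
  (\int[mu]_(t in `]a, b[) ((b - t) `^ q)%:E = \int[mu]_(t in `]0%R, (b - a)%R[) (t `^ q)%:E)%E.
Proof.
have -> : (\int[mu]_(t in `]0%R, (b - a)%R[) (t `^ q)%:E =
    \int[mu]_(t in `](- b)%R, (- a)%R[) ((t - (- b)) `^ q)%:E)%E.
  by rewrite integral_powR_shift opprK addrC.
rewrite -[LHS]integral_indicM// -[RHS]integral_indicM// -[RHS]integral_opp; last first.
  apply/measurable_EFinP/measurable_funM; first exact: measurable_indic.
  exact: measurable_powR_shift.
apply: eq_integral => t _; rewrite opprK (addrC (- t)); congr ((_ * _)%:E).
rewrite !indicE; congr ((nat_of_bool _)%:R); apply/idP/idP; rewrite !inE/= !in_itv/= => /andP[] *; apply/andP; split; lra.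
Qed.

(** Each of the 2^j cells contributes two integrals of order 2^(-j(q+1)), in total 2^(-jq). *)
Lemma integral_grid_power_sum (q : R) : -1 < q -> q <= 0 -> exists2 C, 0 <= C &
  forall j, (\int[mu]_t (grid_power_sum q j t)%:E <= (C * (2 ^+ j) `^ (- q))%:E)%E.
Proof.
move=> q1 q0; have [C C0 hC] := integral_powR_near0 q1 q0.
exists (2 * C); first by rewrite mulr_ge0.
move=> j; have p0 : 0 < 2 ^- j :> R by rewrite invr_gt0 exprn_gt0.
have mt k : measurable_fun [set: T] (fun t : T => (\1_(`]grid_point j k, grid_point j k.+1[) t *
    ((t - grid_point j k) `^ q + (grid_point j k.+1 - t) `^ q))%:E).
  apply/measurable_EFinP/measurable_funM; first exact: measurable_indic.
  by apply: measurable_funD; [exact: measurable_powR_shift | exact: measurable_powR_shiftN].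
have -> : (\int[mu]_t (grid_power_sum q j t)%:E = \sum_(k < 2 ^ j)
   \int[mu]_t (\1_(`]grid_point j k, grid_point j k.+1[) t *
    ((t - grid_point j k) `^ q + (grid_point j k.+1 - t) `^ q))%:E)%E.
  rewrite -ge0_integral_sum//.
  - by apply: eq_integral => t _; rewrite sumEFin.
  - by move=> k t _; rewrite lee_fin mulr_ge0// addr_ge0// powR_ge0.
have -> : (2 * C * (2 ^+ j) `^ (- q))%:E = (\sum_(k < 2 ^ j) (2 * C * (2 ^- j) `^ (q + 1))%:E)%E.
  have key : (2 ^- j) `^ (q + 1) * 2 ^+ j = (2 ^+ j) `^ (- q) :> R.
    rewrite powRD ?powRr1 ?(ltW p0)//; last by rewrite (gt_eqF p0) implybT.
    rewrite divfK ?gt_eqF ?exprn_gt0// powRN -powR_inv1 ?exprn_ge0//.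
    by rewrite powRAC powR_inv1// powR_ge0.
  rewrite sumEFin sumr_const card_ord; congr EFin.
  by rewrite -[RHS]mulr_natr natrX -[RHS]mulrA key.
apply: lee_sum => k _; rewrite integral_indicM//.
rewrite (eq_integral (fun t : T => ((t - grid_point j k) `^ q)%:E + ((grid_point j k.+1 - t) `^ q)%:E)%E)//.
rewrite ge0_integralD//; last 4 first.
- by move=> t _; rewrite lee_fin powR_ge0.
- by apply/measurable_EFinP/measurable_funTS; exact: measurable_powR_shift.
- by move=> t _; rewrite lee_fin powR_ge0.
- by apply/measurable_EFinP/measurable_funTS; exact: measurable_powR_shiftN.
rewrite integral_powR_shift integral_powR_shiftN.
have -> : grid_point j k.+1 - grid_point j k = 2 ^- j by rewrite grid_pointS addrC addKr.
have -> : (2 * C * (2 ^- j) `^ (q + 1))%:E = ((C * (2 ^- j) `^ (q + 1))%:E + (C * (2 ^- j) `^ (q + 1))%:E)%E.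
  by rewrite -EFinD; congr EFin; ring.
by apply: leeD; exact: hC.
Qed.

End grid_distance.

(** * Integration over the length of the frequency *)

Section lambda_bound.
Context {R : realType}.
Notation mu := (@lebesgue_measure R).
Notation T := (measurableTypeR R).

Lemma integral_powRZ_le (q C : R) (A : set T) (b : R) : measurable A -> 0 <= b ->
  (\int[mu]_(x in A) (x `^ q)%:E <= C%:E)%E ->
  (\int[mu]_(x in A) (b * x `^ q)%:E <= (b * C)%:E)%E.
Proof.
move=> mA b0 h.
under eq_integral do rewrite EFinM.
rewrite ge0_integralZl_EFin//.
- by rewrite EFinM lee_wpmul2l// lee_fin.
- by move=> x _; rewrite lee_fin powR_ge0.
- by apply/measurable_EFinP; apply: measurable_funTS; exact: measurable_powR.
Qed.

Lemma powR_inv (x q : R) : 0 <= x -> x^-1 `^ q = (x `^ q)^-1.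
Proof. by move=> x0; rewrite -powR_inv1// powRAC powR_inv1// powR_ge0. Qed.

Lemma powR_add (x q r : R) : 0 < x -> x `^ (q + r) = x `^ q * x `^ r.
Proof. by move=> x0; rewrite powRD// (gt_eqF x0) implybT. Qed.

(* For each lambda the bound is used with the first j such that
   lambda * c * e j * d j < 1, so that both summands of the bound for j + 1
   are comparable. *)
Lemma frequency_integral_bound (p : R) : 1 < p -> p < 2 -> exists2 C, 0 <= C &
  forall (K c : R) (e d : nat -> R) (N : T -> R), 0 < c -> 0 <= K ->
    (forall j, 0 < e j) -> (forall j, 0 < d j) ->
    (forall L, 0 < L -> exists j, e j * d j < L) ->
    measurable_fun [set: T] N -> (forall l, 0 <= N l) ->
    (forall l, 0 < l -> N l <= K / l * e 0%N) ->
    (forall j l, 0 < l -> N l <= K / l * (e j.+1 + (l * c * d j)^-1)) ->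
    (\int[mu]_(l in `]0%R, +oo[) (l * N l `^ p)%:E <=
      \sum_(0 <= j <oo) (C * K `^ p * (e j `^ (2 * p - 2) * (c * d j) `^ (p - 2)))%:E)%E.
Proof.
move=> p1 p2.
have q1 : -1 < 1 - p by lra.
have q2 : 1 - p <= 0 by lra.
have q3 : 1 - 2 * p < -1 by lra.
have [C1 C10 hC1] := integral_powR_near0 q1 q2.
have [C2 C20 hC2] := integral_powR_tail q3.
pose C := 2 `^ p * (C1 + C2).
exists C; first by rewrite mulr_ge0 ?powR_ge0// addr_ge0.
move=> K c e d N c0 K0 e0 d0 small mN N0 N1 N2.
(* The frequency at which e j and 1/(l c d j) balance. *)
pose L j := (c * e j * d j)^-1.
have L0 j : 0 < L j by rewrite invr_gt0 !mulr_gt0.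
pose K2 := (2 * K) `^ p.
(* Majorants for the two regimes, below and above the balance; each integrates to a constant times
   K^p (e j)^(2p-2) (c d j)^(p-2). *)
pose F1 j := (fun l : T => K2 * e j `^ p * l `^ (1 - p)) \_ `]0%R, L j[.
pose F2 j := (fun l : T => K2 * (c * d j) `^ (- p) * l `^ (1 - 2 * p)) \_ `[L j, +oo[.
have F10 j l : 0 <= F1 j l.
  by rewrite /F1 patchE; case: ifP => // _; rewrite !mulr_ge0 ?powR_ge0.
have F20 j l : 0 <= F2 j l.
  by rewrite /F2 patchE; case: ifP => // _; rewrite !mulr_ge0 ?powR_ge0.
have mF1 j : measurable_fun [set: T] (F1 j).
  apply/(measurable_restrictT _ _).1 => //; apply: measurable_funTS.
  by apply: measurable_funM => //; exact: measurable_powR.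
have mF2 j : measurable_fun [set: T] (F2 j).
  apply/(measurable_restrictT _ _).1 => //; apply: measurable_funTS.
  by apply: measurable_funM => //; exact: measurable_powR.
have pointwise l : 0 < l -> exists j, l * N l `^ p <= F1 j l + F2 j l.
  move=> l0.
  have exj : exists j, l * c * (e j * d j) < 1.
    have lc0 : 0 < (l * c)^-1 by rewrite invr_gt0 mulr_gt0.
    have [j hj] := small _ lc0; exists j.
    by rewrite mulrC -ltr_pdivlMr ?mulr_gt0// mul1r.
  have step A : 0 <= A -> N l <= 2 * K * A / l ->
      l * N l `^ p <= K2 * A `^ p * l `^ (1 - p).
    move=> A0 h.
    have h2 : N l `^ p <= (2 * K * A / l) `^ p.
      by apply: ge0_ler_powR => //; rewrite ?nnegrE ?divr_ge0 ?mulr_ge0 ?(ltW l0)//; lra.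
    apply: le_trans (ler_wpM2l (ltW l0) h2) _.
    rewrite powRM ?invr_ge0 ?mulr_ge0 ?(ltW l0)// (powRM _ (mulr_ge0 _ K0))//.
    rewrite -/K2 powR_add// powRr1 ?(ltW l0)// powRN powR_inv ?(ltW l0)//.
    by rewrite mulrCA mulrA.
  have lL j : l * c * (e j * d j) < 1 -> l < L j.
    by rewrite /L -[X in _ -> _ < X]mul1r ltr_pdivlMr ?mulr_gt0// !mulrA.
  case: (ex_minnP exj) => -[|j] hj mj.
    exists 0%N; apply: (@le_trans _ _ (F1 0%N l)); last by rewrite lerDl.
    rewrite /F1 patchE mem_set; last by rewrite /= in_itv/= l0/= lL.
    apply: step; first exact: ltW.
    apply: le_trans (N1 l l0) _.
    have : 0 <= K / l * e 0%N by rewrite !mulr_ge0 ?invr_ge0 ?(ltW l0) ?(ltW (e0 _)).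
    by rewrite (_ : 2 * K * e 0%N / l = 2 * (K / l * e 0%N)); [lra | ring].
  have Kl : 0 <= K / l by rewrite divr_ge0// ltW.
  have lcd : 0 < l * c * d j by rewrite !mulr_gt0.
  have [le|le] := leP (l * c * d j)^-1 (e j.+1).
    exists j.+1; apply: (@le_trans _ _ (F1 j.+1 l)); last by rewrite lerDl.
    rewrite /F1 patchE mem_set; last by rewrite /= in_itv/= l0/= lL.
    apply: step; first exact: ltW.
    apply: le_trans (N2 j l l0) _.
    have -> : 2 * K * e j.+1 / l = K / l * (e j.+1 + e j.+1) by ring.
    by rewrite ler_wpM2l// lerD2l.
  exists j; apply: (@le_trans _ _ (F2 j l)); last by rewrite lerDr.
  rewrite /F2 patchE mem_set; last first.
    rewrite /= in_itv/= andbT leNgt; apply/negP => lj.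
    have : l * c * (e j * d j) < 1.
      by move: lj; rewrite /L -[X in _ < X -> _]mul1r ltr_pdivlMr ?mulr_gt0// !mulrA.
    by move/mj; rewrite ltnn.
  have -> : K2 * (c * d j) `^ (- p) * l `^ (1 - 2 * p) =
      K2 * ((l * c * d j)^-1) `^ p * l `^ (1 - p).
    rewrite powR_inv ?(ltW lcd)// -mulrA.
    have -> : l * c * d j = l * (c * d j) by rewrite mulrA.
    rewrite (@powRM _ l (c * d j)) ?(ltW l0) ?mulr_ge0 ?(ltW c0) ?(ltW (d0 _))// invfM -!powRN.
    have -> : 1 - 2 * p = - p + (1 - p) by ring.
    by rewrite powR_add//; ring.
  apply: step; first by rewrite invr_ge0 ltW.
  apply: le_trans (N2 j l l0) _.
  have -> : 2 * K * (l * c * d j)^-1 / l = K / l * ((l * c * d j)^-1 + (l * c * d j)^-1) by ring.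
  by rewrite ler_wpM2l// lerD2r ltW.
apply: (@le_trans _ _ (\int[mu]_(l in `]0%R, +oo[) \sum_(0 <= j <oo) (F1 j l + F2 j l)%:E)%E).
  apply: ge0_le_integral => //.
  - by move=> l; rewrite /= in_itv/= andbT => l0; rewrite lee_fin mulr_ge0 ?powR_ge0// ltW.
  - apply/measurable_EFinP; apply: measurable_funTS; apply: measurable_funM => //.
    exact: (measurableT_comp (measurable_powR p) mN).
  - apply: ge0_emeasurable_sum => [j l _ _|j _]; first by rewrite lee_fin addr_ge0.
    by apply/measurable_EFinP; apply: measurable_funTS; exact: measurable_funD.
  - move=> l; rewrite /= in_itv/= andbT => l0; have [j hj] := pointwise l l0.
    apply: le_trans (term_le_nneseries j _); first by rewrite lee_fin.
    by move=> k; rewrite lee_fin addr_ge0.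
rewrite integral_nneseries//; last 2 first.
- by move=> j; apply/measurable_EFinP; apply: measurable_funTS; exact: measurable_funD.
- by move=> j l _; rewrite lee_fin addr_ge0.
apply: lee_nneseries => [j _ _|j _]; first by apply: integral_ge0 => l _; rewrite lee_fin addr_ge0.
under eq_integral do rewrite EFinD.
rewrite ge0_integralD//; last 4 first.
- by move=> l _; rewrite lee_fin.
- by apply/measurable_EFinP; exact: measurable_funTS.
- by move=> l _; rewrite lee_fin.
- by apply/measurable_EFinP; exact: measurable_funTS.
have cut (F : T -> R) (A : set T) : measurable A -> measurable_fun [set: T] F -> (forall x, 0 <= F x) ->
    (\int[mu]_(l in `]0%R, +oo[) ((F \_ A) l)%:E <= \int[mu]_(l in A) (F l)%:E)%E.
  move=> mA mF F0.
  rewrite [leRHS]integral_mkcond; apply: (@le_trans _ _ (\int[mu]_l ((F \_ A) l)%:E)%E).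
    apply: ge0_subset_integral => //.
      by apply/measurable_EFinP; apply/(measurable_restrictT _ _).1 => //; exact: measurable_funTS.
    by move=> l _; rewrite lee_fin patchE; case: ifP.
  by rewrite le_eqVlt; apply/orP; left; apply/eqP/eq_integral => l _; rewrite !patchE; case: ifP.
have mP q k : measurable_fun [set: T] (fun l : T => k * l `^ q).
  by apply: measurable_funM => //; exact: measurable_powR.
have P0 q k (l : T) : 0 <= k -> 0 <= k * l `^ q by move=> k0; rewrite mulr_ge0// powR_ge0.
have k1 : 0 <= K2 * e j `^ p by rewrite mulr_ge0 ?powR_ge0.
have k2 : 0 <= K2 * (c * d j) `^ (- p) by rewrite mulr_ge0 ?powR_ge0.
apply: le_trans (leeD (cut _ _ _ (mP _ _) (fun l => P0 _ _ l k1)) (cut _ _ _ (mP _ _) (fun l => P0 _ _ l k2))) _ => //.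
apply: le_trans (leeD (integral_powRZ_le _ k1 (hC1 _ (L0 j))) (integral_powRZ_le _ k2 (hC2 _ (L0 j)))) _ => //.
rewrite -EFinD lee_fin.
have cd0 : 0 < c * d j by rewrite mulr_gt0.
have LE : L j = (e j)^-1 * (c * d j)^-1 by rewrite /L mulrAC invfM mulrC.
have Lq q : L j `^ q = e j `^ (- q) * (c * d j) `^ (- q).
  by rewrite LE (@powRM _ (e j)^-1 (c * d j)^-1) ?invr_ge0 ?(ltW cd0) ?(ltW (e0 _))// !powR_inv ?(ltW cd0) ?(ltW (e0 _))// !powRN.
rewrite !Lq.
have E1 : e j `^ (2 * p - 2) = e j `^ p * e j `^ (- (1 - p + 1)).
  by rewrite -powR_add//; congr (_ `^ _); ring.
have E2 : e j `^ (2 * p - 2) = e j `^ (- (1 - 2 * p + 1)) by congr (_ `^ _); ring.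
have E3 : (c * d j) `^ (p - 2) = (c * d j) `^ (- (1 - p + 1)) by congr (_ `^ _); ring.
have E4 : (c * d j) `^ (p - 2) = (c * d j) `^ (- p) * (c * d j) `^ (- (1 - 2 * p + 1)).
  by rewrite -powR_add//; congr (_ `^ _); ring.
have EK : K2 = 2 `^ p * K `^ p by rewrite /K2 powRM.
rewrite le_eqVlt; apply/orP; left; apply/eqP.
have -> : C * K `^ p * (e j `^ (2 * p - 2) * (c * d j) `^ (p - 2)) =
    2 `^ p * C1 * K `^ p * (e j `^ (2 * p - 2) * (c * d j) `^ (p - 2)) +
    2 `^ p * C2 * K `^ p * (e j `^ (2 * p - 2) * (c * d j) `^ (p - 2)).
  by rewrite /C; ring.
rewrite EK; congr (_ + _).
  by rewrite E1 E3; ring.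
by rewrite E4 E2; ring.
Qed.

End lambda_bound.

(** * Lebesgue measure on a set as a mixture of push-forwards *)

Lemma ge0_integral_mrestr d (T : measurableType d) (R : realType)
  (m : {measure set T -> \bar R}) (I : set T) (mI : measurable I) (h : T -> \bar R) :
  measurable_fun [set: T] h -> (forall x, 0 <= h x)%E ->
  (\int[mrestr m mI]_x h x = \int[m]_(x in I) h x)%E.
Proof.
move=> mh h0; rewrite (@ge0_negligible_integral _ _ _ (mrestr m mI) setT (~` I))//; last 2 first.
- exact: measurableC.
- by change (m (~` I `&` I) = 0%E); rewrite setICl measure0.
rewrite setTD setCK; apply: eq_measure_integral => A mA AI.
by change (m (A `&` I) = m A); rewrite setIidl.
Qed.

Section mixture_of_pushforwards.
Context {R : realType}.
Notation mu := (@lebesgue_measure R).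
Notation T := (measurableTypeR R).

(** The mixture agrees with Lebesgue measure restricted to A on half-open intervals, hence on all
    measurable sets. The inequality arises because h, rather than its cutoff to A, is kept on the
    right. *)
Lemma mixture_integral_le (A I : set T) (c : nat -> R) (F : nat -> T -> T) (h : T -> \bar R) :
  measurable A -> measurable I -> (forall i, 0 <= c i) ->
  (forall i, measurable_fun [set: T] (F i)) ->
  (forall a b : R, \sum_(0 <= i <oo) (c i)%:E * mu (F i @^-1` `]a, b] `&` I) = mu (`]a, b] `&` A))%E ->
  measurable_fun [set: T] h -> (forall x, 0 <= h x)%E ->
  (\int[mu]_(x in A) h x <= \sum_(0 <= i <oo) (c i)%:E * \int[mu]_(t in I) h (F i t))%E.
Proof.
move=> mA mI c0 mF cdf mh h0.
pose n i : {measure set T -> \bar R} :=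
  measure_function_pushforward__canonical__measure_function_Measure (mrestr mu mI) (mF i).
pose m i : {measure set T -> \bar R} := mscale (NngNum (c0 i)) (n i).
have mA' := measurableC mA.
(* Lebesgue measure off A is added so that the uniqueness theorem for Lebesgue measure on the whole
   line applies. *)
pose nu : {measure set T -> \bar R} := measure_add (mseries m 0) (mrestr mu mA').
have E : forall X, measurable X -> mu X = nu X.
  apply: lebesgue_measure_unique => _ [[a b]] _ <-; rewrite /nu.
  apply: (etrans _ (esym (measure_addE (mseries m 0) (mrestr mu mA') _))).
  transitivity (mu (`]a, b] `&` A) + mu (`]a, b] `&` ~` A))%E; last first.
    by congr (_ + _)%E; rewrite -cdf.
  rewrite -measureU//; last 3 first.
  - exact: measurableI.
  - exact: measurableI.
  - by rewrite setIACA setICr setI0.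
  by rewrite -setIUr setUv setIT.
have mhA : measurable_fun [set: T] (h \_ A).
  by apply/(measurable_restrictT _ _).1 => //; exact: measurable_funTS.
have hA0 x : (0 <= (h \_ A) x)%E by rewrite patchE; case: ifP.
rewrite integral_mkcond (@eq_measure_integral _ _ _ setT nu); last by move=> X mX _; exact: E.
rewrite /nu ge0_integral_measure_add// ge0_integral_measure_series//.
rewrite [X in (_ + X)%E](_ : _ = 0%E) ?adde0; last first.
  rewrite ge0_integral_mrestr//; apply: integral0_eq => x Ax.
  by rewrite patchE memNset.
apply: lee_nneseries => [i _ _|i _]; first exact: integral_ge0.
rewrite /m ge0_integral_mscale//; apply: lee_wpmul2l; first by rewrite lee_fin.
have mhF : measurable_fun [set: T] (h \o F i) by exact: (measurableT_comp mh (mF i)).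
rewrite ge0_integral_pushforward//= preimage_setT ge0_integral_mrestr//; last first.
  exact: (measurableT_comp mhA (mF i)).
apply: ge0_le_integral => //.
- by apply: measurable_funTS; exact: (measurableT_comp mhA (mF i)).
- exact: measurable_funTS.
- by move=> x _ /=; rewrite patchE; case: ifP.
Qed.

End mixture_of_pushforwards.

(** * The slope transports the mixed Cantor measure to Lebesgue measure *)

Section slope_equidistribution.
Context {R : realType}.
Notation mu := (@lebesgue_measure R).
Notation T := (measurableTypeR R).
Variable delta : nat -> R.
Hypothesis delta_gt0 : forall j, 0 < delta j.
Hypothesis delta_half : forall j, 2 * delta j.+1 <= delta j.

Lemma measurable_quantile : measurable_fun [set: T] (quantile delta : T -> T).
Proof.
apply: nondecreasing_measurable => // s t st.
(* Negative arguments have index 0 at every level, so the monotonicity known on [0, +oo[ extends to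
   the line. *)
have trunc u : quantile delta u = quantile delta (Num.max 0 u).
  rewrite /quantile; congr sup; congr (_ @` _); apply/funext => j; congr (cantor_left _ _ _).
  rewrite /grid_index; have [//|u0] := leP 0 u.
  rewrite mulr0 truncn0; apply/truncn0Pn; rewrite -ltNge (le_lt_trans _ ltr01)//.
  by rewrite pmulr_rle0 ?exprn_gt0// ltW.
rewrite (trunc s) (trunc t); apply: quantile_nd => //; first by rewrite le_max lexx.
by rewrite ge_max !le_max lexx st orbT.
Qed.

(** For t uniform in [0, 1), a random point distributed by the i-th translated Cantor measure. *)
Definition sample (i : nat) (t : R) : R := shift delta i + quantile delta t.

Lemma measurable_slope_sample (l : R) i : measurable_fun [set: T] (fun t : T => l * slope delta (sample i t) : T).
Proof.
apply: measurable_funM => //.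
apply: (@measurableT_comp _ _ _ T T _ (slope delta)).
  by apply: nondecreasing_measurable => // s t; exact: slope_nd.
by apply: measurable_funD => //; exact: measurable_quantile.
Qed.

Lemma measurable_sample i : measurable_fun [set: T] (sample i : T -> T).
Proof. by apply: measurable_funD => //; exact: measurable_quantile. Qed.

(** Up to the endpoint t = c, the condition on t is 0 <= t < c with c the value of the Cantor
    function, its generalized inverse property. *)
Lemma measure_sample i x :
  mu [set t : T | `[0%R, 1%R[%classic t /\ sample i t <= x] = (cantor_fun delta (x - shift delta i))%:E.
Proof.
set c := cantor_fun _ _; set A := [set t | _].
have c0 : 0 <= c by exact: cantor_fun_ge0.
have c1 : c <= 1 by exact: cantor_fun_le1.
have mA : measurable A.
  rewrite (_ : A = `[0%R, 1%R[%classic `&` (sample i : T -> T) @^-1` `]-oo, x]%classic).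
    by apply: measurableI => //; rewrite -[X in measurable X]setTI; exact: measurable_sample.
  by apply/seteqP; split => t [h1 h2]; split => //; move: h2; rewrite /= in_itv.
apply/eqP; rewrite eq_le; apply/andP; split.
  apply: (@le_trans _ _ (mu `[0%R, c])).
    apply: le_measure; rewrite ?inE// => t [+ tx].
    rewrite /= !in_itv/= => /andP[t0 t1]; rewrite t0/=.
    by apply: cantor_fun_ge => //; [rewrite t0 | rewrite lerBrDl].
  by rewrite /= lebesgue_measure_itv/= lte_fin -EFinB subr0; case: ifP => // _; rewrite lee_fin.
apply: (@le_trans _ _ (mu `[0%R, c[)).
  rewrite /= lebesgue_measure_itv/= lte_fin -EFinB subr0; by case: ltP.
apply: le_measure; rewrite ?inE// => t; rewrite /A/= !in_itv/= => /andP[t0 tc].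
split; first by rewrite t0 (lt_le_trans tc).
by rewrite /sample -lerBrDl; apply: cantor_fun_lt.
Qed.

Lemma slope_ivt y : 0 <= y <= 1 -> exists2 x, 0 <= x <= 2 * delta 0 & slope delta x = y.
Proof.
move=> y01; have d0 := delta_gt0 0; have le0 : 0 <= 2 * delta 0 by lra.
have [] := @IVT _ (oslope delta) 0 (2 * delta 0) y le0.
- by apply: continuous_subspaceT => x; exact: oslope_continuous.
- rewrite oslopeE// oslope1// slope0// min_l// max_r//.
by move=> x; rewrite in_itv/= => /andP[x0 x1] <-; exists x; rewrite ?x0// oslopeE.
Qed.

Let clamp (l y : R) := Num.min l (Num.max 0 y).

(** For y in [0, l) the threshold x is a preimage of y/l, and strict monotonicity of [slope] gives
    the equivalence. For other y it is a point left or right of all samples. *)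
Lemma slope_level l y : 0 < l -> exists x, l * slope delta x = clamp l y /\
    forall i t, 0 <= t < 1 -> (l * slope delta (sample i t) <= y) = (sample i t <= x).
Proof.
move=> l0; have d0 := delta_gt0 0; rewrite /clamp.
have sitv i t : 0 <= t < 1 -> 0 <= sample i t <= 2 * delta 0 by exact: shift_quantile_itv.
have [y0|y0] := ltP y 0.
  exists (-1); rewrite slope0 ?mulr0 ?lerN10//; split; first by rewrite min_r// ltW.
  move=> i t /(sitv i)/andP[h1 h2].
  rewrite (leNgt (sample _ _)) (lt_le_trans _ h1) ?oppr_lt0//=; apply/negbTE.
  by rewrite -ltNge (lt_le_trans y0)// mulr_ge0 ?slope_ge0// ltW.
have [ly|yl] := leP l y.
  exists (2 * delta 0); rewrite slope1// ?mulr1; split => //.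
  move=> i t /(sitv i)/andP[h1 h2]; rewrite h2.
  by rewrite (le_trans _ ly)// ler_piMr ?slope_le1// ltW.
have [|x /andP[x0 x1] hx] := @slope_ivt (y / l).
  by rewrite divr_ge0 ?(ltW l0)//= ler_pdivrMr// mul1r ltW.
exists x; rewrite hx mulrC divfK ?gt_eqF//; split => //.
move=> i t /(sitv i)/andP[h1 h2].
rewrite mulrC -ler_pdivlMr// -hx.
have [h|h] := leP (sample i t) x; first exact: slope_nd.
by apply/negbTE; rewrite -ltNge; exact: slope_lt.
Qed.

Lemma measure_sample_level (l a b xa xb : R) i : a <= b ->
  (forall t, 0 <= t < 1 -> (l * slope delta (sample i t) <= a) = (sample i t <= xa)) ->
  (forall t, 0 <= t < 1 -> (l * slope delta (sample i t) <= b) = (sample i t <= xb)) ->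
  mu ((fun t : T => (l * slope delta (sample i t))%R : T) @^-1` `]a, b] `&` `[0%R, 1%R[) =
  (cantor_fun delta (xb - shift delta i) - cantor_fun delta (xa - shift delta i))%:E.
Proof.
move=> ab ha hb; set A := _ `&` _.
have mA : measurable A.
  apply: measurableI => //; rewrite -[X in measurable X]setTI.
  by apply: measurable_slope_sample.
pose S x := [set t : T | `[0%R, 1%R[%classic t /\ sample i t <= x].
have mS x : measurable (S x).
  rewrite (_ : S x = `[0%R, 1%R[%classic `&` (sample i : T -> T) @^-1` `]-oo, x]%classic).
    by apply: measurableI => //; rewrite -[X in measurable X]setTI; exact: measurable_sample.
  by apply/seteqP; split => t [h1 h2]; split => //; move: h2; rewrite /= in_itv.
have SE : S xb = S xa `|` A.
  apply/seteqP; split => t.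
    move=> [t01]; have t01' := t01; rewrite /= in_itv/= in t01'; rewrite -hb// => tb.
    have [h|h] := leP (l * slope delta (sample i t)) a.
      by left; split => //; rewrite -ha.
    by right; split => //; rewrite /= in_itv/= h.
  move=> [[t01]|[+ t01]]; have t01' := t01; rewrite /= in_itv/= in t01'.
    by rewrite -ha// => ta; split => //; rewrite -hb// (le_trans ta).
  by rewrite /= in_itv/= => /andP[_ tb]; split => //; rewrite -hb.
have muU : (mu (S xb) = mu (S xa) + mu A)%E.
  rewrite SE measureU//.
  apply/seteqP; split => // t [[t01 +] [+ _]]; have t01' := t01; rewrite /= in_itv/= in t01'.
  by rewrite -ha//= in_itv/= => h /andP[]; rewrite ltNge h.
move: muU; rewrite (measure_sample i xb : mu (S xb) = _) (measure_sample i xa : mu (S xa) = _).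
by rewrite EFinB => ->; rewrite addeAC subee// add0e.
Qed.

(** A random variable inserted into its own continuous distribution function becomes uniform. Here
    the mixture of the samples has distribution function [slope]; the i-th measure is an increment
    of the i-th Cantor function, and the weighted increments add up to l times an increment of
    [slope]. *)
Lemma slope_cdf (l a b : R) : 0 < l ->
  (\sum_(0 <= i <oo) (l * 2 ^- i.+1)%:E *
     mu ((fun t : T => (l * slope delta (sample i t))%R : T) @^-1` `]a, b] `&` `[0%R, 1%R[) =
   mu (`]a, b] `&` `]0%R, l]))%E.
Proof.
move=> l0; have [ab|ba] := leP a b; last first.
  have nab x : ~ `]a, b]%classic x by rewrite /= in_itv/= => /andP[]; lra.
  have e0 (X Y : set T) : X `<=` `]a, b]%classic -> mu (X `&` Y) = 0%E.
    move=> Xab; rewrite (_ : X `&` Y = set0) ?measure0//.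
    by apply/seteqP; split => // t [/Xab/nab].
  rewrite e0// eseries0// => i _ _; rewrite [X in mu X](_ : _ = set0) ?measure0 ?mule0//.
  by apply/seteqP; split => // t [/nab].
have [xa [ea ha]] := slope_level a l0.
have [xb [eb hb]] := slope_level b l0.
rewrite (eq_eseriesr (g := fun i => (2 ^- i.+1 * (l * cantor_fun delta (xb - shift delta i)) -
    2 ^- i.+1 * (l * cantor_fun delta (xa - shift delta i)))%:E)%E); last first.
  move=> i _; rewrite (measure_sample_level ab (ha i) (hb i)) -EFinM; congr EFin; ring.
have -> : (mu (`]a, b] `&` `]0%R, l]) = (clamp l b - clamp l a)%:E)%E.
  have -> : `]a, b]%classic `&` `]0%R, l]%classic = `](clamp l a), (clamp l b)]%classic.
    apply/seteqP; split => x /=; rewrite !in_itv/= /clamp le_min gt_min le_max gt_max.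
      by move=> [/andP[-> ->] /andP[-> ->]]; rewrite !orbT.
    move=> /andP[/orP[lx|/andP[x0 ax]] /andP[xl]]; first by move: lx; rewrite ltNge xl.
    by rewrite [x <= 0]leNgt x0/= => xb0; rewrite ax xb0 xl.
  have lab : clamp l a <= clamp l b by rewrite /clamp le_min2// le_max2.
  by rewrite lebesgue_measure_itv/= lte_fin -EFinB; case: ltgtP lab => // -> _; rewrite subrr.
rewrite -ea -eb.
have c01 x i : 0 <= cantor_fun delta (x - shift delta i) <= 1.
  by rewrite cantor_fun_ge0// cantor_fun_le1.
apply/cvg_lim => //.
rewrite (_ : (fun n => _) = EFin \o (fun n =>
  l * series (fun i => 2 ^- i.+1 * cantor_fun delta (xb - shift delta i)) n -
  l * series (fun i => 2 ^- i.+1 * cantor_fun delta (xa - shift delta i)) n)); last first.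
  apply/funext => n; rewrite /= sumEFin; congr EFin.
  rewrite sumrB /series/= !mulr_sumr; congr (_ - _); apply: eq_bigr => i _; ring.
apply: cvg_EFin; first exact: nearW.
by apply: cvgB; apply: cvgMr; exact: mixture_cvg.
Qed.

Lemma slope_integral_le (l : R) (h : T -> \bar R) : 0 < l ->
  measurable_fun [set: T] h -> (forall x, 0 <= h x)%E ->
  (\int[mu]_(x in `]0%R, l]) h x <= \sum_(0 <= i <oo) (l * 2 ^- i.+1)%:E *
     \int[mu]_(t in `[0%R, 1%R[) h (l * slope delta (sample i t))%R)%E.
Proof.
move=> l0 mh h0; apply: (@mixture_integral_le _ _ _ (fun i => l * 2 ^- i.+1)
  (fun i (t : T) => l * slope delta (sample i t) : T) h) => //.
- by move=> i; rewrite mulr_ge0 ?(ltW l0)// invr_ge0 exprn_ge0.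
- by move=> i; exact: measurable_slope_sample.
- by move=> a b; exact: slope_cdf.
Qed.

End slope_equidistribution.

(** * The Fourier transform of the region and caps of phi *)

Section region_transform.
Context {R : realType}.
Notation mu := (@lebesgue_measure R).
Notation T := (measurableTypeR R).
Notation T2 := (measurableTypeR R * measurableTypeR R)%type.
Notation normc := ComplexField.Normc.normc.
Variables (a : R) (f phi : R -> R).
Hypothesis fphi : profile a f phi.

Let D : set T2 := region a phi.

Definition transform_norm (xi : R * R) : R := normc (fourier (char_fun D) xi).

(** Half a period of the exponential in the variable w is tau = pi/l, and cosine and sine both
    change sign over it. The constant 4 is twice the 2 of [region_integral_bound], for the real and
    imaginary parts. *)
Lemma transform_norm_le (x0 B l : R) : 0 <= x0 <= a -> 0 < l -> 0 <= B ->
  (exists u, forall x, `|x| <= 2 * a ->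
     phi x - phi x0 - f x0 * (x - x0) < 2 * (pi / l) -> u <= x <= u + B) ->
  transform_norm (l * f x0, l) <= 4 * pi / l * B.
Proof.
move=> x0a l0 B0 cap; have tau0 : 0 < pi / l by rewrite divr_gt0// pi_gt0.
have bound (k : R -> R) : measurable_fun [set: T] (k : T -> T) -> (forall w, `|k w| <= 1) ->
    (forall w, k (w - pi) = - k w) ->
    `|\int[lebesgue2]_z (\1_D z * k (- dot (l * f x0, l) z))| <= 2 * (pi / l) * B.
  move=> mk k1 kpi.
  rewrite (_ : (fun z => _) = (fun z => \1_D z * k (- (l * (z.2 + f x0 * z.1))))); last first.
    by apply/funext => z; rewrite /dot/=; congr (_ * k _); ring.
  apply: (@region_integral_bound _ a f phi fphi x0 B (pi / l) (f x0) x0a erefl tau0 B0 cap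
    (fun w => k (- (l * w)))).
  - have ml : measurable_fun [set: T] (fun w : T => - (l * w) : T).
      apply: continuous_measurable_fun => w; apply: cvgN; apply: cvgMr; exact: cvg_id.
    exact: (measurableT_comp mk ml).
  - by move=> w; exact: k1.
  - move=> w; rewrite -kpi mulrDr mulrCA divff ?gt_eqF// mulr1 opprD//.
rewrite /transform_norm (le_trans (normc_le_add _))// fourier_char_fun/=.
have -> : 4 * pi / l * B = 2 * (pi / l) * B + 2 * (pi / l) * B by ring.
apply: lerD; apply: bound.
- by apply: continuous_measurable_fun; exact: continuous_cos.
- by move=> w; rewrite ler_norml cos_geN1 cos_le1.
- by move=> w; rewrite -cosN opprB addrC cosDpi cosN.
- by apply: continuous_measurable_fun; exact: continuous_sin.
- by move=> w; rewrite ler_norml sin_geN1 sin_le1.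
- by move=> w; rewrite -[sin w]opprK -sinN -sinDpi -[in RHS]sinN; congr sin; ring.
Qed.

Lemma transform_norm_le_trivial (x0 l : R) : 0 <= x0 <= a -> 0 < l ->
  transform_norm (l * f x0, l) <= 4 * pi / l * (4 * a).
Proof.
move=> x0a l0; have a0 := profile_gt0 fphi.
apply: transform_norm_le => //; first by rewrite mulr_ge0// ltW.
by exists (- (2 * a)) => x; rewrite ler_norml => /andP[h1 h2] _; apply/andP; split; lra.
Qed.

(** Beyond x2 the graph of phi leaves its tangent at x0 at rate at least r, so the height 2 tau is
    exceeded after a further distance 2 tau / r; likewise before x1. *)
Lemma convex_cap (x0 x1 x2 r tau x : R) : x1 <= x0 -> x0 <= x2 -> 0 < r ->
  f x1 + r <= f x0 -> f x0 + r <= f x2 ->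
  phi x - phi x0 - f x0 * (x - x0) < 2 * tau ->
  x1 - 2 * tau / r <= x <= x2 + 2 * tau / r.
Proof.
move=> x10 x02 r0 f1 f2 h.
have h0 := phi_tangent fphi x0 x.
have t0 : 0 < 2 * tau by lra.
have tr : 0 < 2 * tau / r by rewrite divr_gt0.
apply/andP; split.
  have [hx|hx] := leP x1 x; first by lra.
  have g1 := phi_tangent fphi x1 x; have g2 := phi_tangent fphi x0 x1.
  have g3 : 0 <= (f x0 - f x1 - r) * (x1 - x) by rewrite mulr_ge0//; lra.
  have g4 : (x1 - x) * r < 2 * tau by lra.
  by rewrite -ltr_pdivlMr// in g4; lra.
have [hx|hx] := leP x x2; first by lra.
have g1 := phi_tangent fphi x2 x; have g2 := phi_tangent fphi x0 x2.
have g3 : 0 <= (f x2 - f x0 - r) * (x - x2) by rewrite mulr_ge0//; lra.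
have g4 : (x - x2) * r < 2 * tau by lra.
by rewrite -ltr_pdivlMr// in g4; lra.
Qed.

Lemma transform_norm_le_cap (x0 x1 x2 r l : R) : 0 <= x0 <= a -> 0 < l ->
  x1 <= x0 -> x0 <= x2 -> 0 < r -> f x1 + r <= f x0 -> f x0 + r <= f x2 ->
  transform_norm (l * f x0, l) <= 4 * pi / l * (x2 - x1 + 4 * (pi / l) / r).
Proof.
move=> x0a l0 x10 x02 r0 f1 f2.
have tau0 : 0 < pi / l by rewrite divr_gt0// pi_gt0.
have tr : 0 < (pi / l) / r by rewrite divr_gt0.
apply: transform_norm_le => //; first by rewrite addr_ge0//; [lra | rewrite -mulrA; lra].
exists (x1 - 2 * (pi / l) / r) => x _ /(convex_cap x10 x02 r0 f1 f2)/andP[-> h] /=.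
by apply: le_trans h _; rewrite -!mulrA; lra.
Qed.

End region_transform.

(** * Transform bounds at the sampled directions *)

Section slope_transform.
Context {R : realType}.
Variable delta : nat -> R.
Hypothesis delta_gt0 : forall j, 0 < delta j.
Hypothesis delta_half : forall j, 2 * delta j.+1 <= delta j.
Variable phi : R -> R.
Hypothesis fphi : profile (2 * delta 0) (oslope delta) phi.

Notation N := (transform_norm (2 * delta 0) phi).

(** The trivial cap, of width 8 [delta 0]; the constant is weakened to the one of
    [transform_norm_sample]. *)
Lemma transform_norm_sample0 i t l : 0 <= t < 1 -> 0 < l ->
  N (l * slope delta (sample delta i t), l) <= 32 * pi ^+ 2 / l * (8 * delta 0).
Proof.
move=> t01 l0; have /andP[s0 s1] := shift_quantile_itv delta_gt0 delta_half i t01.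
rewrite /sample -(oslopeE delta_gt0 delta_half s0)//.
apply: le_trans (transform_norm_le_trivial fphi (introT andP (conj s0 s1)) l0) _.
have -> : 4 * pi / l * (4 * (2 * delta 0)) = (4 * pi) * (8 * delta 0 / l) by ring.
have -> : 32 * pi ^+ 2 / l * (8 * delta 0) = (4 * pi) * (8 * delta 0 / l) * (8 * pi) by ring.
have p2 := pi_ge2 R; have d0 := delta_gt0 0.
rewrite ler_peMr ?mulr_ge0 ?invr_ge0 ?pi_ge0 ?(ltW d0) ?(ltW l0)//; lra.
Qed.

(** With v half the distance to the grid, t - v and t + v stay in the cell of t, so their samples
    are within [delta j] of each other, while the slope changes by at least 2^-(i+1) v on either
    side. The cap estimate is applied between these samples. *)
Lemma transform_norm_sample i j t l : 0 <= t < 1 -> (forall k, t != grid_point j k) -> 0 < l ->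
  N (l * slope delta (sample delta i t), l) <=
    32 * pi ^+ 2 / l * (delta j + (l * 2 ^- i.+1 * grid_distance j t)^-1).
Proof.
move=> t01 tn l0; have /andP[t0 t1] := t01.
have p2 := pi_ge2 R.
have d0 := grid_distance_gt0 t0 tn; set d := grid_distance j t in d0 *.
have c0 : 0 < 2 ^- i.+1 :> R by rewrite invr_gt0 exprn_gt0.
pose v := d / 2.
have v0 : 0 < v by rewrite divr_gt0.
have vd : `|v| < d by rewrite gtr0_norm// /v; lra.
have vd' : `|- v| < d by rewrite normrN.
have [tp0 tp] := grid_index_shift t0 vd; have [tm0 tm] := grid_index_shift t0 vd'.
have tp1 : t + v < 1.
  have /andP[_ tv] := grid_point_itv j tp0; rewrite tp in tv; apply: (lt_le_trans tv).
  have p0 : 0 < 2 ^+ j :> R by rewrite exprn_gt0.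
  rewrite /grid_point ler_pdivrMr// mul1r -natrX ler_nat.
  have /andP[k1 _] := grid_index_itv j t0.
  by rewrite -(ltr_nat R) (le_lt_trans k1)// natrX gtr_pMr.
have tm_le : t - v <= t by lra.
have tp_le : t <= t + v by lra.
have g1 := slope_quantile_gap delta_gt0 delta_half i tm0 tm_le t1.
have g2 := slope_quantile_gap delta_gt0 delta_half i t0 tp_le tp1.
have e1 : t - (t - v) = v by ring.
have e2 : t + v - t = v by ring.
rewrite e1 in g1; rewrite e2 in g2.
have sitv := shift_quantile_itv delta_gt0 delta_half i.
have /andP[s0 s1] := sitv _ t01.
have tm01 : 0 <= t - v < 1 by rewrite tm0 (le_lt_trans tm_le).
have tp01 : 0 <= t + v < 1 by rewrite tp0.
have /andP[sm0 _] := sitv _ tm01; have /andP[sp0 _] := sitv _ tp01.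
have q1 := quantile_nd delta_gt0 delta_half tm0 tm_le.
have q2 := quantile_nd delta_gt0 delta_half t0 tp_le.
have q3 := quantile_close delta_gt0 delta_half tm0 tp0 (etrans tm (esym tp)).
have oE x : 0 <= x -> oslope delta x = slope delta x by exact: oslopeE.
rewrite /sample -(oE _ s0).
have r0 : 0 < 2 ^- i.+1 * v by rewrite mulr_gt0.
have cap := @transform_norm_le_cap _ _ _ _ fphi (shift delta i + quantile delta t)
  (shift delta i + quantile delta (t - v)) (shift delta i + quantile delta (t + v))
  (2 ^- i.+1 * v) l.
apply: le_trans (cap _ l0 _ _ r0 _ _) _; rewrite ?s0 ?s1 ?lerD2l// ?oE//.
have -> : 4 * (pi / l) / (2 ^- i.+1 * v) = 8 * pi * (l * 2 ^- i.+1 * d)^-1.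
  by rewrite /v; field; rewrite !gt_eqF// ?exprn_gt0.
have w0 : 0 < (l * 2 ^- i.+1 * d)^-1 by rewrite invr_gt0 !mulr_gt0.
set w := (l * _ * d)^-1 in w0 *.
have -> : 32 * pi ^+ 2 / l * (delta j + w) = 4 * pi / l * (8 * pi * (delta j + w)) by ring.
apply: ler_wpM2l; first by rewrite divr_ge0 ?mulr_ge0 ?pi_ge0// ltW.
have dj := delta_gt0 j.
have h : delta j <= 8 * pi * delta j by rewrite ler_peMl ?(ltW dj)//; lra.
have -> : 8 * pi * (delta j + w) = 8 * pi * delta j + 8 * pi * w by ring.
apply: lerD => //; apply: le_trans h; apply: le_trans q3; lra.
Qed.

End slope_transform.

(** * Symmetries of the plane and reduction to an octant *)

Section plane_symmetry.
Context {R : realType}.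
Notation mu := (@lebesgue_measure R).
Notation mu2 := (@lebesgue2 R).
Notation T := (measurableTypeR R).
Notation T2 := (measurableTypeR R * measurableTypeR R)%type.

Definition integral_preserving (sigma : T2 -> T2) := measurable_fun [set: T2] sigma /\
  forall h : T2 -> \bar R, measurable_fun [set: T2] h -> (forall z, 0 <= h z)%E ->
    (\int[mu2]_z h (sigma z) = \int[mu2]_z h z)%E.

Definition flip1 (z : T2) : T2 := (- z.1, z.2).
Definition flip2 (z : T2) : T2 := (z.1, - z.2).
Definition flip3 (z : T2) : T2 := (z.2, z.1).

Let measurable_opp : measurable_fun [set: T] (-%R : T -> T).
Proof. by apply: continuous_measurable_fun; exact: opp_continuous. Qed.

Lemma integral_preserving_flip3 : integral_preserving flip3.
Proof.
have m3 : measurable_fun [set: T2] flip3 by exact: measurable_swap.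
split => // h mh h0.
rewrite [LHS]fubini_tonelli1//; last exact: (measurableT_comp mh m3).
by rewrite [RHS]fubini_tonelli2.
Qed.

Lemma integral_preserving_flip1 : integral_preserving flip1.
Proof.
have m1 : measurable_fun [set: T2] flip1.
  by apply: measurable_fun_pair => //=; apply: measurableT_comp.
split => // h mh h0.
rewrite [LHS]fubini_tonelli2//; last exact: (measurableT_comp mh m1).
rewrite [RHS]fubini_tonelli2//; apply: eq_integral => y _.
rewrite /fubini_G /flip1/= (ge0_integral_opp (f := fun x => h (x, y)))//.
exact: (measurableT_comp mh (pair2_measurable y)).
Qed.

Lemma integral_preserving_flip2 : integral_preserving flip2.
Proof.
have m2 : measurable_fun [set: T2] flip2.
  by apply: measurable_fun_pair => //=; apply: measurableT_comp.
split => // h mh h0.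
rewrite [LHS]fubini_tonelli1//; last exact: (measurableT_comp mh m2).
rewrite [RHS]fubini_tonelli1//; apply: eq_integral => x _.
rewrite /fubini_F /flip2/= (ge0_integral_opp (f := fun y => h (x, y)))//.
exact: (measurableT_comp mh (pair1_measurable x)).
Qed.

Lemma Rintegral_preserving sigma (h : T2 -> R) : integral_preserving sigma ->
  measurable_fun [set: T2] h -> \int[mu2]_z h (sigma z) = \int[mu2]_z h z.
Proof.
move=> [ms Hs] mh; rewrite /Rintegral; congr fine.
have mh' : measurable_fun [set: T2] (EFin \o h) by apply/measurable_EFinP.
rewrite integralE [RHS]integralE; congr (_ - _)%E.
  rewrite -(Hs _ (measurable_funepos mh')) //.
  by apply: eq_integral => x _; rewrite !funeposE.
rewrite -(Hs _ (measurable_funeneg mh')) //.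
by apply: eq_integral => x _; rewrite !funenegE.
Qed.

Lemma integral_le_double (sigma : T2 -> T2) (G H : T2 -> R) : integral_preserving sigma ->
  measurable_fun [set: T2] G -> measurable_fun [set: T2] H ->
  (forall z, 0 <= G z) -> (forall z, 0 <= H z) -> (forall z, G z <= H z + H (sigma z)) ->
  (\int[mu2]_z (G z)%:E <= 2%:E * \int[mu2]_z (H z)%:E)%E.
Proof.
move=> [ms Hs] mG mH G0 H0 GH.
have mHs : measurable_fun [set: T2] (fun z => H (sigma z)) by exact: (measurableT_comp mH ms).
apply: (@le_trans _ _ (\int[mu2]_z ((H z)%:E + (H (sigma z))%:E))%E).
  apply: ge0_le_integral => //.
  - by move=> z _; rewrite lee_fin.
  - exact/measurable_EFinP.
  - by apply/measurable_EFinP; exact: measurable_funD.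
  - by move=> z _; rewrite -EFinD lee_fin.
rewrite ge0_integralD//; last 4 first.
- by move=> z _; rewrite lee_fin.
- exact/measurable_EFinP.
- by move=> z _; rewrite lee_fin.
- exact/measurable_EFinP.
rewrite (Hs (fun z => (H z)%:E)); last 2 first.
- exact/measurable_EFinP.
- by move=> z; rewrite lee_fin.
by rewrite mule_natl mule2n.
Qed.

Definition octant : set T2 := [set z | (0 <= z.1) && (z.1 <= z.2)].

Lemma measurable_pred2 (b : T2 -> bool) : measurable_fun [set: T2] b -> measurable [set z : T2 | b z].
Proof.
move=> mb; have := mb measurableT [set true] I; rewrite setTI.
by congr (measurable _); apply/seteqP; split => z.
Qed.

Lemma measurable_octant : measurable octant.
Proof.
apply: measurable_pred2; apply: measurable_and.
- by apply: measurable_fun_ler => //; exact: measurable_fst.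
- by apply: measurable_fun_ler; [exact: measurable_fst | exact: measurable_snd].
Qed.

(** Passing to a half-plane, a quadrant and an octant costs a factor 2 each time, by
    [integral_le_double]. *)
Lemma integral_octant_bound (G : T2 -> R) : measurable_fun [set: T2] G ->
  (forall z, 0 <= G z) -> (forall z, G (flip1 z) = G z) -> (forall z, G (flip2 z) = G z) ->
  (forall z, G (flip3 z) = G z) ->
  (\int[mu2]_z (G z)%:E <= 8%:E * \int[mu2]_z (\1_octant z * G z)%:E)%E.
Proof.
move=> mG G0 G1 G2 G3.
pose P1 : set T2 := [set z | 0 <= z.1].
pose P2 : set T2 := [set z | (0 <= z.1) && (0 <= z.2)].
have m1 : measurable_fun [set: T2] (fun z : T2 => 0 <= z.1).
  by apply: measurable_fun_ler => //; exact: measurable_fst.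
have m2 : measurable_fun [set: T2] (fun z : T2 => 0 <= z.2).
  by apply: measurable_fun_ler => //; exact: measurable_snd.
have mP1 : measurable P1 by exact: measurable_pred2.
have mP2 : measurable P2 by apply: measurable_pred2; exact: measurable_and.
have mI (P : set T2) : measurable P -> measurable_fun [set: T2] (fun z => \1_P z * G z).
  by move=> mP; apply: measurable_funM => //; exact: measurable_indic.
have I0 (P : set T2) z : 0 <= \1_P z * G z by rewrite mulr_ge0.
have ind (P : set T2) (z : T2) (b : bool) : (P z <-> b) -> \1_P z = b%:R :> R.
  by move=> Pb; rewrite indicE; congr (nat_of_bool _)%:R; apply/idP/idP; rewrite inE => /Pb.
have i1 (z : T2) : \1_P1 z = (0 <= z.1)%R%:R :> R by exact: ind.
have i2 (z : T2) : \1_P2 z = ((0 <= z.1) && (0 <= z.2))%R%:R :> R by exact: ind.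
have i3 (z : T2) : \1_octant z = ((0 <= z.1) && (z.1 <= z.2))%R%:R :> R by exact: ind.
have h1 : (\int[mu2]_z (G z)%:E <= 2%:E * \int[mu2]_z (\1_P1 z * G z)%:E)%E.
  apply: (integral_le_double integral_preserving_flip1) => //; first exact: mI.
  move=> z; rewrite G1 -mulrDl !i1 /= oppr_ge0; have := G0 z.
  by case: (lerP 0 z.1) => h; case: (lerP z.1 0) => h' /=; lra.
have h2 : (\int[mu2]_z (\1_P1 z * G z)%:E <= 2%:E * \int[mu2]_z (\1_P2 z * G z)%:E)%E.
  apply: (integral_le_double integral_preserving_flip2) => //; try exact: mI.
  move=> z; rewrite G2 -mulrDl !i1 !i2 /= oppr_ge0; have := G0 z.
  by case: (lerP 0 z.1) => _; case: (lerP 0 z.2) => h; case: (lerP z.2 0) => h' /=; lra.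
have h3 : (\int[mu2]_z (\1_P2 z * G z)%:E <= 2%:E * \int[mu2]_z (\1_octant z * G z)%:E)%E.
  apply: (integral_le_double integral_preserving_flip3) => //; try by apply: mI => //; exact: measurable_octant.
  move=> z; rewrite G3 -mulrDl !i2 !i3 /=; have := G0 z.
  by case: (lerP 0 z.1) => h; case: (lerP 0 z.2) => h'; case: (lerP z.1 z.2) => k;
    case: (lerP z.2 z.1) => k' /=; lra.
have -> : 8 = 2 * (2 * 2) :> R by ring.
rewrite !EFinM -!muleA (le_trans h1)// lee_wpmul2l// (le_trans h2)// lee_wpmul2l//.
Qed.

(** Change of variables by sigma, which is self-adjoint and preserves both the area and the
    region. *)
Lemma transform_norm_flip (a : R) (f phi : R -> R) (sigma : T2 -> T2) : profile a f phi ->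
  integral_preserving sigma -> (forall x y, dot (sigma x) y = dot x (sigma y)) ->
  (forall z, gauge phi (sigma z) = gauge phi z) ->
  forall xi, transform_norm a phi (sigma xi) = transform_norm a phi xi.
Proof.
move=> fphi Hs sd sg xi; rewrite /transform_norm !fourier_char_fun.
have mD : measurable (region a phi : set T2) by exact: measurable_region fphi.
have E (k : R -> R) : measurable_fun [set: T] (k : T -> T) ->
    \int[mu2]_x (\1_(region a phi) x * k (- dot (sigma xi) x)) =
    \int[mu2]_x (\1_(region a phi) x * k (- dot xi x)).
  move=> mk; rewrite -[RHS](Rintegral_preserving Hs); last first.
    apply: measurable_funM; first exact: measurable_indic.
    apply: (measurableT_comp mk); apply: (measurableT_comp measurable_opp).
    by apply: measurable_funD; apply: measurable_funM.
  apply: eq_Rintegral => x _; rewrite sd !indicE; congr (_%:R * _).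
  by congr nat_of_bool; apply/idP/idP; rewrite !inE /region/= sg.
by rewrite (E cos) ?(E sin)//; apply: continuous_measurable_fun;
  [exact: continuous_sin | exact: continuous_cos].
Qed.

End plane_symmetry.

(** * From the octant integral to membership in A_p *)

Section region_Lp.
Context {R : realType}.
Notation mu := (@lebesgue_measure R).
Notation mu2 := (@lebesgue2 R).
Notation T := (measurableTypeR R).
Notation T2 := (measurableTypeR R * measurableTypeR R)%type.
Variables (a : R) (f phi : R -> R).
Hypothesis fphi : profile a f phi.

Lemma integrable_region : mu2.-integrable setT (EFin \o (\1_(region a phi) : T2 -> R)).
Proof.
apply: (@integrable2_bounded_support _ _ (2 * a) 1) => [|z|z].
- by apply: measurable_indic; exact: measurable_region fphi.
- by rewrite indicE; case: (_ \in _); rewrite ?normr1 ?normr0.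
- rewrite indicE; case: (boolP (z \in _)); rewrite ?eqxx// inE => /(region_bound fphi).
  by [].
Qed.

Lemma measurable_transform_norm : measurable_fun [set: T2] (transform_norm a phi : T2 -> R).
Proof.
have [m1 m2] := measurable_fourier_char_fun (measurable_region fphi) integrable_region.
set F := fourier _ in m1 m2.
rewrite (_ : transform_norm a phi = fun z =>
    Num.sqrt (complex.Re (F z) ^+ 2 + complex.Im (F z) ^+ 2)); last first.
  by apply/funext => z; rewrite /transform_norm -/F; case: (F z).
have ms : measurable_fun [set: T] (Num.sqrt : T -> T).
  by apply: continuous_measurable_fun; exact: sqrt_continuous.
apply: (measurableT_comp ms).
by apply: measurable_funD; exact: measurable_funX.
Qed.

Lemma transform_norm_ge0 z : 0 <= transform_norm a phi z.
Proof. exact: normc_ge0. Qed.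

Lemma A_region (p : R) : 0 < p ->
  (\int[mu2]_z (\1_octant z * transform_norm a phi z `^ p)%:E < +oo)%E ->
  A_ p%:E (distr_of (char_fun (region a phi))).
Proof.
move=> p0 fin.
apply: (A_char_fun (measurable_region fphi) integrable_region).
rewrite /finite_norm unlock; apply: poweR_lty.
have E z : (`|(EFin \o (fun x => ComplexField.Normc.normc (fourier (char_fun (region a phi)) x))) z| `^ p =
    (transform_norm a phi z `^ p)%:E)%E.
  by rewrite /= ger0_norm ?normc_ge0.
rewrite [X in (X < _)%E](_ : _ = \int[mu2]_z (transform_norm a phi z `^ p)%:E)%E; last first.
  by apply: eq_integral => z _; exact: E.
have flip := transform_norm_flip fphi.
apply: le_lt_trans (@integral_octant_bound _ (fun z => transform_norm a phi z `^ p) _ _ _ _ _) _.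
- exact: (measurableT_comp (measurable_powR p) measurable_transform_norm).
- by move=> z; exact: powR_ge0.
- move=> z; rewrite flip//; first exact: integral_preserving_flip1.
  by move=> x y; rewrite /dot/=; ring.
  by move=> x; rewrite /gauge/= (phi_even fphi).
- move=> z; rewrite flip//; first exact: integral_preserving_flip2.
  by move=> x y; rewrite /dot/=; ring.
  by move=> x; rewrite /gauge/= (phi_even fphi).
- move=> z; rewrite flip//; first exact: integral_preserving_flip3.
  by move=> x y; rewrite /dot/=; ring.
  by move=> x; rewrite /gauge/= addrC.
by rewrite lte_mul_pinfty.
Qed.

End region_Lp.

(** * Finiteness of the octant integral for the slope region *)

Section slope_region_Lp.
Context {R : realType}.
Notation mu := (@lebesgue_measure R).
Notation mu2 := (@lebesgue2 R).
Notation T := (measurableTypeR R).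
Notation T2 := (measurableTypeR R * measurableTypeR R)%type.

Lemma integral_scale (l : R) (A : set T) (g : T -> R) : measurable A -> 0 <= l ->
  measurable_fun [set: T] g -> (forall t, 0 <= g t) ->
  (l%:E * \int[mu]_(t in A) (g t)%:E = \int[mu]_(t in A) (l * g t)%:E)%E.
Proof.
move=> mA l0 mg g0; under [RHS]eq_integral do rewrite EFinM.
rewrite ge0_integralZl_EFin//; first by move=> t _; rewrite lee_fin.
by apply/measurable_EFinP; exact: measurable_funTS.
Qed.

Variable delta : nat -> R.
Hypothesis delta_gt0 : forall j, 0 < delta j.
Hypothesis delta_half : forall j, 2 * delta j.+1 <= delta j.
Variable phi : R -> R.
Hypothesis fphi : profile (2 * delta 0) (oslope delta) phi.
Variable p : R.
Hypothesis p_gt1 : 1 < p.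
Hypothesis p_lt2 : p < 2.

Let N : T2 -> R := transform_norm (2 * delta 0) phi.
Let N0 z : 0 <= N z. Proof. exact: transform_norm_ge0. Qed.
Let mN : measurable_fun [set: T2] N. Proof. exact: measurable_transform_norm fphi. Qed.

(** The index is shifted to fit [frequency_integral_bound]: [e j.+1] is paired with the grid of
    level j, and [e 0] is the width of the trivial cap. *)
Let e (j : nat) : R := if j is j'.+1 then delta j' else 8 * delta 0.

Hypothesis e_summable : (\sum_(0 <= j <oo) (e j `^ (2 * p - 2) * (2 ^+ j) `^ (2 - p))%:E < +oo)%E.

Let e_gt0 j : 0 < e j.
Proof. by case: j => [|j] /=; have := delta_gt0 0; have := delta_gt0; [lra|]. Qed.

Let weight (i : nat) : R := 2 ^- i.+1.
Let weight_gt0 i : 0 < weight i. Proof. by rewrite invr_gt0 exprn_gt0. Qed.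

Let graph (i : nat) (z : T2) : T2 := (z.2 * slope delta (sample delta i z.1), z.2).

(** The p-th power of the transform in the coordinates (t, l) of the i-th sample; the factor l comes
    from rescaling [0, 1] to [0, l] in [slope_integral_le]. *)
Let W (i : nat) (z : T2) : R :=
  \1_`[0, 1[ z.1 * (\1_`]0, +oo[ z.2 * (z.2 * N (graph i z) `^ p)).

Let W_ge0 i z : 0 <= W i z.
Proof.
rewrite /W mulr_ge0// indicE; case: (boolP (z.2 \in _)); rewrite ?mul0r ?mul1r//.
by rewrite inE/= in_itv/= andbT => /ltW h; rewrite mulr_ge0// powR_ge0.
Qed.

Let measurable_N_powR (g : T2 -> T2) : measurable_fun [set: T2] g ->
  measurable_fun [set: T2] (fun z => N (g z) `^ p : T).
Proof.
move=> mg; apply: (measurableT_comp (measurable_powR p)).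
exact: (measurableT_comp mN mg).
Qed.

Let measurable_graph i : measurable_fun [set: T2] (graph i).
Proof.
apply: measurable_fun_pair; last exact: measurable_snd.
apply: measurable_funM; first exact: measurable_snd.
have ms : measurable_fun [set: T] (fun t : T => 1 * slope delta (sample delta i t) : T).
  exact: measurable_slope_sample.
under eq_fun do rewrite -[slope _ _]mul1r.
exact: (measurableT_comp ms measurable_fst).
Qed.

Let measurable_W i : measurable_fun [set: T2] (W i).
Proof.
have mi (A : set T) : measurable A -> measurable_fun [set: T] (\1_A : T -> T).
  by move=> mA; exact: measurable_indic.
apply: measurable_funM.
  exact: (measurableT_comp (mi `[0%R, 1%R[%classic (measurable_itv _)) measurable_fst).
apply: measurable_funM.
  exact: (measurableT_comp (mi `]0%R, +oo[%classic (measurable_itv _)) measurable_snd).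
apply: measurable_funM => //.
exact: measurable_N_powR.
Qed.

Let W_integral_ge0 i l : (0 <= \int[mu]_t (W i (t, l))%:E)%E.
Proof. by apply: integral_ge0 => t _; rewrite lee_fin. Qed.

Let weight_W_ge0 i l : (0 <= (weight i)%:E * \int[mu]_t (W i (t, l))%:E)%E.
Proof. by rewrite mule_ge0// lee_fin ltW. Qed.

Lemma row_integral_le (l : R) :
  (\int[mu]_s (\1_octant (s, l) * N (s, l) `^ p)%:E <=
    \sum_(0 <= i <oo) (weight i)%:E * \int[mu]_t (W i (t, l))%:E)%E.
Proof.
have mNl : measurable_fun [set: T] (fun s : T => (N (s, l) `^ p)%:E).
  apply/measurable_EFinP; apply: (measurableT_comp (measurable_powR p)).
  exact: (measurableT_comp mN (pair2_measurable l)).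
have -> : (\int[mu]_s (\1_octant (s, l) * N (s, l) `^ p)%:E =
    \int[mu]_(s in `[0%R, l]) (N (s, l) `^ p)%:E)%E.
  rewrite -[RHS]integral_indicM//; apply: eq_integral => s _; congr ((_ * _)%:E).
have [l0|l0] := leP l 0.
  rewrite null_set_integral ?nneseries_ge0//; first exact: measurable_funTS.
  by rewrite /= lebesgue_measure_itv/= lte_fin ltNge l0.
rewrite -integral_itv_obnd_cbnd; last exact: measurable_funTS.
apply: le_trans (slope_integral_le delta_gt0 delta_half l0 mNl _) _.
  by move=> x; rewrite lee_fin powR_ge0.
apply: lee_nneseries => [i _ _|i _].
  rewrite mule_ge0 ?lee_fin ?mulr_ge0 ?(ltW l0) ?(ltW (weight_gt0 i))//.
  by apply: integral_ge0 => t _; rewrite lee_fin powR_ge0.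
rewrite mulrC EFinM -muleA; apply: lee_wpmul2l; first by rewrite lee_fin ltW.
rewrite le_eqVlt; apply/orP; left; apply/eqP.
pose g (t : T) : R := N (graph i (t, l)) `^ p.
have mg : measurable_fun [set: T] g.
  have ml : measurable_fun [set: T] (fun s : T => N (s, l) `^ p : T) by exact/measurable_EFinP.
  by apply: (measurableT_comp ml); exact: measurable_slope_sample.
have g0 t : 0 <= g t by exact: powR_ge0.
transitivity (\int[mu]_(t in `[0%R, 1%R[) (l * g t)%:E)%E.
  by apply: integral_scale => //; exact: ltW.
rewrite -[LHS]integral_indicM//; apply: eq_integral => t _; congr EFin; rewrite /W/=; congr (_ * _).
by rewrite indicE mem_set ?mul1r//= in_itv/= l0.
Qed.

(** For t off the grids, [frequency_integral_bound] with c = 2^-(i+1) bounds the integral over l by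
    a series of (p-2)-th powers of grid distances. Their integrals over t are of order 2^(j(2-p))
    since p - 2 > -1, and [e_summable] sums the result. *)
Lemma sample_integral_le : exists2 C, 0 <= C & forall i,
  (\int[mu]_t \int[mu]_l (W i (t, l))%:E <= (C * weight i `^ (p - 2))%:E)%E.
Proof.
have [C1 C10 hC1] := frequency_integral_bound p_gt1 p_lt2.
have q1 : -1 < p - 2 by have := p_gt1; lra.
have q2 : p - 2 <= 0 by have := p_lt2; lra.
have [C2 C20 hC2] := @integral_grid_power_sum R _ q1 q2.
have t0 j : (0 <= (e j `^ (2 * p - 2) * (2 ^+ j) `^ (2 - p))%:E)%E.
  by rewrite lee_fin mulr_ge0 ?powR_ge0.
have Sfin' := e_summable; set S := (\sum_(0 <= j <oo) _)%E in Sfin'.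
have S0 : (0 <= S)%E by apply: nneseries_ge0 => j _ _; exact: t0.
have Sfin : S = (fine S)%:E by rewrite fineK// ge0_fin_numE.
pose K : R := 32 * pi ^+ 2.
have K0 : 0 <= K by rewrite mulr_ge0 ?exprn_ge0 ?pi_ge0.
exists (C1 * K `^ p * C2 * fine S).
  by rewrite !mulr_ge0 ?powR_ge0 ?fine_ge0.
move=> i; have w0 := weight_gt0 i.
pose A j := C1 * K `^ p * weight i `^ (p - 2) * e j `^ (2 * p - 2).
have A0 j : 0 <= A j by rewrite !mulr_ge0 ?powR_ge0.
have sample_pointwise (t : T) : (forall j k, t != grid_point j k) ->
    (\int[mu]_l (W i (t, l))%:E <= \sum_(0 <= j <oo) (A j * grid_power_sum (p - 2) j t)%:E)%E.
  move=> tn; have [t01|t01] := boolP (0 <= t < 1); last first.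
    rewrite integral0_eq ?nneseries_ge0//.
      by move=> j _ _; rewrite lee_fin mulr_ge0// grid_power_sum_ge0.
    move=> l _; rewrite /W /= indicE memNset ?mul0r//.
    by rewrite /= in_itv/=; exact/negP.
  have /andP[tge0 tlt1] := t01.
  pose g (l : T) : R := N (graph i (t, l)).
  have mg : measurable_fun [set: T] g.
    have mgr : measurable_fun [set: T] (fun l : T => graph i (t, l)).
      exact: (measurableT_comp (measurable_graph i) (pair1_measurable t)).
    exact: (measurableT_comp mN mgr).
  have -> : (\int[mu]_l (W i (t, l))%:E = \int[mu]_(l in `]0%R, +oo[) (l * g l `^ p)%:E)%E.
    rewrite -[RHS]integral_indicM//; apply: eq_integral => l _; congr EFin.
    by rewrite /W /= [X in X * _]indicE mem_set ?mul1r//= in_itv.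
  have dpos j : 0 < grid_distance j t by exact: grid_distance_gt0.
  have small L : 0 < L -> exists j, e j * grid_distance j t < L.
    move=> L0; have [j hj] := delta_small delta_gt0 delta_half L0.
    exists j.+1; apply: le_lt_trans hj; rewrite ler_piMr ?(ltW (delta_gt0 j))//.
    by rewrite (le_trans (grid_distance_le _ _))// invf_le1 ?exprn_gt0// exprn_ege1// ler1n.
  have b0 l : 0 < l -> g l <= K / l * e 0%N by exact: transform_norm_sample0.
  have b1 j l : 0 < l -> g l <= K / l * (e j.+1 + (l * weight i * grid_distance j t)^-1).
    by move=> l0; exact: transform_norm_sample.
  apply: le_trans (hC1 K (weight i) e (fun j => grid_distance j t) g w0 K0 e_gt0 dpos small mg (fun l => N0 _) b0 b1) _.
  apply: lee_nneseries => [j _ _|j _]; first by rewrite lee_fin !mulr_ge0 ?powR_ge0.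
  rewrite lee_fin powRM ?(ltW w0) ?(ltW (dpos j))//.
  have -> : C1 * K `^ p * (e j `^ (2 * p - 2) * (weight i `^ (p - 2) * grid_distance j t `^ (p - 2))) =
     A j * grid_distance j t `^ (p - 2) by rewrite /A; ring.
  by apply: ler_wpM2l => //; exact: grid_distance_powR.
have mWE : measurable_fun [set: T2] (EFin \o W i) by apply/measurable_EFinP.
have WE0 z : (0 <= (EFin \o W i) z)%E by rewrite lee_fin.
have mF := @measurable_fun_fubini_tonelli_F _ _ _ _ _ mu (EFin \o W i) mWE WE0.
have mgrid j : measurable_fun [set: T] (fun t : T => (A j * grid_power_sum (p - 2) j t)%:E).
  apply/measurable_EFinP; apply: measurable_funM => //; exact: measurable_grid_power_sum.
have grid0 j (t : T) : (0 <= (A j * grid_power_sum (p - 2) j t)%:E)%E.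
  by rewrite lee_fin mulr_ge0// grid_power_sum_ge0.
apply: (@le_trans _ _ (\int[mu]_t \sum_(0 <= j <oo) (A j * grid_power_sum (p - 2) j t)%:E)%E).
  apply: ae_ge0_le_integral => //.
  - move=> t _; apply: integral_ge0 => l _; by rewrite lee_fin.
  - by move=> t _; apply: nneseries_ge0 => j _ _; exact: grid0.
  - by apply: ge0_emeasurable_sum.
  (* The excluded parameters are dyadic rationals, a countable and hence negligible set. *)
  - pose Gr : set T := range (fun jk : nat * nat => grid_point jk.1 jk.2 : T).
    have cG : countable Gr by apply: card_le_trans (card_image_le _ _) _; exact: countableP.
    exists Gr; split; [by apply: countable_measurable => // x; exact: measurable_set1 | exact: countable_lebesgue_measure0 |].
    move=> t /= h; apply: contrapT => tG; apply: h => _; apply: sample_pointwise.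
    by move=> j k; apply/eqP => tjk; apply: tG; exists (j, k).
rewrite integral_nneseries//.
apply: (@le_trans _ _ (\sum_(0 <= j <oo) (C1 * K `^ p * weight i `^ (p - 2) * C2)%:E *
    (e j `^ (2 * p - 2) * (2 ^+ j) `^ (2 - p))%:E)%E).
  apply: lee_nneseries => [j _ _|j _]; first by apply: integral_ge0.
  under eq_integral do rewrite EFinM.
  rewrite ge0_integralZl_EFin//; last 2 first.
  - by move=> t _; rewrite lee_fin grid_power_sum_ge0.
  - by apply/measurable_EFinP; exact: measurable_grid_power_sum.
  apply: le_trans (lee_wpmul2l _ (hC2 j)) _; first by rewrite lee_fin.
  rewrite -!EFinM lee_fin opprB le_eqVlt; apply/orP; left; apply/eqP.
  by rewrite /A; ring.
rewrite nneseriesZl// -/S Sfin -EFinM lee_fin le_eqVlt; apply/orP; left; apply/eqP.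
by ring.
Qed.

(** The i-th sample has weight 2^-(i+1) and contributes a multiple of its (p-2)-th power, so the
    terms decay like 2^(-i(p-1)), a convergent geometric series. *)
Lemma slope_region_integral :
  (\int[mu2]_z (\1_octant z * N z `^ p)%:E < +oo)%E.
Proof.
have [C C0 hC] := sample_integral_le.
have mO : measurable_fun [set: T2] (fun z => (\1_octant z * N z `^ p)%:E).
  apply/measurable_EFinP; apply: measurable_funM; last exact: (@measurable_N_powR id).
  by apply: measurable_indic; exact: measurable_octant.
have O0 z : (0 <= (\1_octant z * N z `^ p)%:E)%E by rewrite lee_fin mulr_ge0// powR_ge0.
have mWE i : measurable_fun [set: T2] (EFin \o W i) by apply/measurable_EFinP.
have WE0 i z : (0 <= (EFin \o W i) z)%E by rewrite lee_fin.
have mG i := @measurable_fun_fubini_tonelli_G _ _ _ _ _ mu (EFin \o W i) (mWE i) (WE0 i).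
rewrite fubini_tonelli2//.
apply: (@le_lt_trans _ _ (\int[mu]_l \sum_(0 <= i <oo) (weight i)%:E * \int[mu]_t (W i (t, l))%:E)%E).
  apply: ge0_le_integral => //.
  - by move=> l _; apply: integral_ge0.
  - exact: measurable_fun_fubini_tonelli_G.
  - apply: ge0_emeasurable_sum => [i l _ _|i _].
      exact: weight_W_ge0.
    by apply: emeasurable_funM => //; exact: mG.
  - by move=> l _; exact: row_integral_le.
rewrite integral_nneseries//; last by move=> i; apply: emeasurable_funM => //; exact: mG.
apply: (@le_lt_trans _ _ (\sum_(0 <= i <oo) (C * (1 * 2 ^- i) `^ (p - 1))%:E)%E); last first.
  under eq_eseriesr do rewrite EFinM.
  have q0 : 0 < p - 1 by rewrite subr_gt0.
  by rewrite nneseriesZl ?dyadic_powR_series// -?EFinM ?ltry// => i _; rewrite lee_fin powR_ge0.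
apply: lee_nneseries => [i _ _|i _].
  by apply: integral_ge0 => l _; exact: weight_W_ge0.
rewrite ge0_integralZl_EFin ?(ltW (weight_gt0 i))//; last exact: mG.
have -> : (\int[mu]_l \int[mu]_t (W i (t, l))%:E = \int[mu]_t \int[mu]_l (W i (t, l))%:E)%E.
  by apply/esym; exact: (@fubini_tonelli _ _ _ _ _ mu mu (EFin \o W i) (mWE i) (WE0 i)).
apply: le_trans (lee_wpmul2l _ (hC i)) _; first by rewrite lee_fin ltW.
rewrite -EFinM lee_fin mulrCA; apply: ler_wpM2l => //.
have -> : weight i * weight i `^ (p - 2) = weight i `^ (p - 1).
  rewrite -{1}[weight i]powRr1 ?ltW// -powR_add//; congr (_ `^ _); ring.
apply: ge0_ler_powR; rewrite ?nnegrE ?mul1r ?(ltW (weight_gt0 _)) ?invr_ge0 ?exprn_ge0 ?subr_ge0 ?(ltW p_gt1)//.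
rewrite /weight lef_pV2 ?posrE ?exprn_gt0//.
by rewrite ler_eXn2l ?ltr1n.
Qed.

End slope_region_Lp.

(** * Scales adapted to omega *)

Section modulus_scale.
Context {R : realType}.
Notation mu := (@lebesgue_measure R).
Notation T := (measurableTypeR R).

Lemma nneseries_recl_le (t : nat -> \bar R) : (forall k, 0 <= t k)%E ->
  (\sum_(0 <= k <oo) t k <= t 0%N + \sum_(0 <= k <oo) t k.+1)%E.
Proof.
move=> t0; apply: lime_le; first by apply: is_cvg_nneseries.
apply: nearW => -[|n]; first by rewrite big_geq// adde_ge0// nneseries_ge0.
rewrite big_nat_recl//= leeD2l//; apply: nneseries_lim_ge => k _ _; exact: t0.
Qed.

Variable omega : R -> R.
Hypothesis omega_nd : {in `[0, +oo[ &, {homo omega : s t / s <= t}}.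
Hypothesis omega_cont : {within `[0, +oo[, continuous omega}.
Hypothesis omega0 : omega 0 = 0.

Let nd s t : 0 <= s -> s <= t -> omega s <= omega t.
Proof.
by move=> s0 st; apply: omega_nd => //; rewrite in_itv/= ?s0// andbT (le_trans s0).
Qed.

(** Positivity follows from omega(d) <= omega(2d) < 2 omega(d) for small d. The scales exist by the
    intermediate value theorem, and [delta j] < 2 [delta j.+1] would give omega([delta j]) < 2
    omega([delta j.+1]) = omega([delta j]). *)
Lemma dyadic_levels (rho : R) : 0 < rho ->
  (forall d, 0 < d -> d <= rho -> omega (2 * d) < 2 * omega d) ->
  (forall d, 0 < d -> 0 < omega d) /\
  exists delta : nat -> R, [/\ forall j, 0 < delta j, forall j, delta j <= rho,
    forall j, omega (delta j) = 2 ^- j * omega rho & forall j, 2 * delta j.+1 <= delta j].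
Proof.
move=> rho0 h.
have pos d : 0 < d -> 0 < omega d.
  move=> d0; pose m := Num.min d rho.
  have m0 : 0 < m by rewrite lt_min d0.
  have mr : m <= rho by rewrite ge_min lexx orbT.
  have md : m <= d by rewrite ge_min lexx.
  have h1 := h _ m0 mr.
  have h2 : omega m <= omega (2 * m) by apply: nd; lra.
  have h3 : omega m <= omega d by apply: nd => //; exact: ltW.
  lra.
split => //.
have ex j : exists d, [/\ 0 < d, d <= rho & omega d = 2 ^- j * omega rho].
  have p2 : 0 < 2 ^- j :> R by rewrite invr_gt0 exprn_gt0.
  have p21 : 2 ^- j <= 1 :> R by rewrite invf_le1 ?exprn_gt0// exprn_ege1// ler1n.
  have [] := @IVT _ omega 0 rho (2 ^- j * omega rho) (ltW rho0).
  - by apply: continuous_subspaceW omega_cont => x /=; rewrite !in_itv/= andbT => /andP[].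
  - rewrite omega0 min_l ?max_r ?(ltW (pos _ rho0))//.
    by rewrite mulr_ge0 ?(ltW p2) ?(ltW (pos _ rho0))//= ler_piMl// ltW// pos.
  move=> d; rewrite in_itv/= => /andP[d0 dr] dE; exists d; split => //.
  rewrite lt_neqAle d0 andbT eq_sym; apply/eqP => dz; move: dE; rewrite dz omega0 => /esym/eqP.
  by rewrite mulf_eq0 !gt_eqF// pos.
have [delta hdelta] := choice ex.
exists delta; split => [j|j|j|j]; try by have [] := hdelta j.
have [p0 pr pE] := hdelta j; have [q0 qr qE] := hdelta j.+1.
rewrite leNgt; apply/negP => lt; have := h _ q0 qr.
have : omega (delta j) <= omega (2 * delta j.+1) by apply: nd; exact: ltW.
by rewrite pE qE exprS invfM => h1; rewrite mulrA mulrA divff ?mul1r// ltNge h1.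
Qed.

Variable delta : nat -> R.
Variable rho : R.
Hypothesis delta_gt0 : forall j, 0 < delta j.
Hypothesis delta_half : forall j, 2 * delta j.+1 <= delta j.
Hypothesis omega_delta : forall j, omega (delta j) = 2 ^- j * omega rho.
Hypothesis omega_rho : 0 < omega rho.
Hypothesis delta_le1 : forall j, delta j <= 1.

(** For [delta j.+1] <= d < [delta j] the oscillation is at most 4 * 2^-j = 8 * 2^-(j+1), and
    2^-(j+1) = omega([delta j.+1]) / omega(rho). *)
Lemma oslope_modulus d : 0 < d -> d < delta 0 -> forall x y, `|x - y| <= d ->
  `|oslope delta x - oslope delta y| <= 8 / omega rho * omega d.
Proof.
move=> d0 d1.
have ex : exists j, delta j <= d.
  by have [j hj] := delta_small delta_gt0 delta_half d0; exists j; exact: ltW.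
case: (ex_minnP ex) => -[|j] hj mj; first by move: hj; rewrite leNgt d1.
have dj : d < delta j by rewrite ltNge; apply/negP => /mj; rewrite ltnn.
have key : 4 * 2 ^- j <= 8 / omega rho * omega d.
  have : omega (delta j.+1) <= omega d by apply: nd => //; exact: ltW.
  rewrite omega_delta -ler_pdivlMr// exprS invfM => h.
  have -> : 8 / omega rho * omega d = 8 * (omega d / omega rho) by ring.
  by move: h; set v := omega d / omega rho; set u := 2 ^- j; lra.
move=> x y; rewrite ler_distl => /andP[xy1 xy2].
have h1 : oslope delta y <= oslope delta x + 4 * 2 ^- j by apply: oslope_close => //; lra.
have h2 : oslope delta x <= oslope delta y + 4 * 2 ^- j by apply: oslope_close => //; lra.
by rewrite ler_norml; apply/andP; split; lra.
Qed.

(** On ([delta j] / 2, [delta j]] one has omega <= 2^-j omega(rho), so the integral there dominates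
    a fixed multiple of [delta j]^(2p-2) 2^(j(2-p)). These intervals are disjoint because the scales
    at least halve. *)
Lemma omega_summable (p : R) : 1 < p -> p < 2 ->
  (\int[mu]_(d in `]0%R, 1%R]) (d `^ (2 * p - 3) / omega d `^ (2 - p))%R%:E < +oo)%E ->
  (\sum_(0 <= j <oo) ((if j is j'.+1 then delta j' else 8 * delta 0) `^ (2 * p - 2) *
      (2 ^+ j) `^ (2 - p))%:E < +oo)%E.
Proof.
move=> p1 p2 fin.
pose t j := ((delta j) `^ (2 * p - 2) * (2 ^+ j) `^ (2 - p))%:E.
have t0 j : (0 <= t j)%E by rewrite lee_fin mulr_ge0 ?powR_ge0.
(* The first term is finite, and undoing the shift of index costs the factor 2^(2-p). *)
suff tfin : (\sum_(0 <= j <oo) t j < +oo)%E.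
  apply: le_lt_trans (nneseries_recl_le _) _.
    by move=> j; rewrite lee_fin mulr_ge0 ?powR_ge0.
  rewrite lte_add_pinfty ?ltry//.
  rewrite (eq_eseriesr (g := fun j => (2 `^ (2 - p))%:E * t j)%E).
    by rewrite nneseriesZl// lte_mul_pinfty// lee_fin powR_ge0.
  move=> j _; rewrite -EFinM exprS powRM ?exprn_ge0//; congr EFin; ring.
pose J j : set T := `](delta j / 2), delta j]%classic.
pose Om := omega rho `^ (2 - p).
pose c := 2 `^ (2 * p - 2) * 2 * Om.
have Om0 : 0 < Om by rewrite powR_gt0.
have c0 : 0 < c by rewrite !mulr_gt0 ?powR_gt0.
pose f (d : T) := d `^ (2 * p - 3) / omega d `^ (2 - p).
have fE : forall d, f d = d `^ (2 * p - 3) / omega d `^ (2 - p) by [].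
have f0 d : 0 <= f d by rewrite divr_ge0 ?powR_ge0.
have mJ j : measurable (J j) by exact: measurable_itv.
have mf : measurable_fun (`]0%R, 1%R]%classic : set T) (f : T -> T).
  (* Composition with max(0, d) turns omega into a function monotone on the whole line, hence
     measurable. *)
  apply: (@eq_measurable_fun _ _ T T _ (fun d => d `^ (2 * p - 3) * omega (Num.max 0 d) `^ (p - 2))).
    move=> d; rewrite inE/= in_itv/= => /andP[d0 _]; rewrite /f max_r ?(ltW d0)//.
    by rewrite -powRN opprB.
  apply: measurable_funTS; apply: measurable_funM; first exact: measurable_powR.
  apply: (measurableT_comp (measurable_powR (p - 2))).
  apply: nondecreasing_measurable => // x y xy; apply: nd; first by rewrite le_max lexx.
  by rewrite ge_max !le_max lexx xy orbT.
have subJ : \bigcup_j J j `<=` (`]0%R, 1%R]%classic : set T).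
  move=> d [j _]; rewrite /J/= !in_itv/= => /andP[h1 h2]; have := delta_gt0 j => dj.
  by rewrite (le_trans h2) ?delta_le1// andbT (lt_trans _ h1)// divr_gt0.
have step j : (t j <= c%:E * \int[mu]_(d in J j) (f d)%:E)%E.
  have dj := delta_gt0 j; have dj2 : 0 < delta j / 2 by rewrite divr_gt0.
  pose m := (delta j / 2) `^ (2 * p - 2) / delta j * ((2 ^+ j) `^ (2 - p) / Om).
  have q0 : 0 <= 2 * p - 2 by lra.
  have m0 : 0 <= m by rewrite !mulr_ge0 ?invr_ge0 ?powR_ge0 ?(ltW dj).
  have fm d : J j d -> m <= f d.
    rewrite /J/= in_itv/= => /andP[d1 d2]; have d0 := lt_trans dj2 d1.
    have -> : f d = d `^ (2 * p - 2) / d * (omega d `^ (2 - p))^-1.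
      rewrite /f; congr (_ / _); rewrite -powR_inv1 ?(ltW d0)// -powR_add//.
      by congr (_ `^ _); ring.
    have od : 0 < omega d.
      have [k hk] := delta_small delta_gt0 delta_half d0.
      apply: (@lt_le_trans _ _ (omega (delta k))); last by apply: nd; exact: ltW.
      by rewrite omega_delta mulr_gt0// invr_gt0 exprn_gt0.
    rewrite ler_pM//.
    - by rewrite mulr_ge0 ?invr_ge0 ?powR_ge0 ?(ltW dj).
    - by rewrite mulr_ge0 ?invr_ge0 ?powR_ge0.
    - rewrite ler_pM ?powR_ge0 ?invr_ge0 ?(ltW dj)//.
        by apply: ge0_ler_powR; rewrite ?nnegrE ?(ltW dj2) ?(ltW d0) ?(ltW d1).
      by rewrite lef_pV2 ?posrE.
    have -> : (2 ^+ j) `^ (2 - p) / Om = (((2 ^- j) * omega rho) `^ (2 - p))^-1.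
      rewrite powRM ?invr_ge0 ?exprn_ge0 ?(ltW omega_rho)// powR_inv ?exprn_ge0//.
      by rewrite invfM invrK.
    rewrite lef_pV2 ?posrE ?powR_gt0// ?mulr_gt0// ?invr_gt0 ?exprn_gt0//.
    apply: ge0_ler_powR; rewrite ?nnegrE ?mulr_ge0 ?invr_ge0 ?exprn_ge0 ?(ltW od) ?(ltW omega_rho)//; first by lra.
    by rewrite -omega_delta; apply: nd => //; exact: ltW.
  have h : ((m * (delta j / 2))%:E <= \int[mu]_(d in J j) (f d)%:E)%E.
    apply: (@le_trans _ _ (\int[mu]_(d in J j) m%:E)%E); last first.
      apply: ge0_le_integral => //.
      by apply/measurable_EFinP; apply: measurable_funS mf => // d Jd; apply: subJ; exists j.
    rewrite integral_cst// /J /= lebesgue_measure_itv/= lte_fin ltr_pdivrMr// ltr_pMr// ltr1n.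
    by rewrite -EFinB -EFinM lee_fin; apply: ler_wpM2l => //; lra.
  apply: le_trans (lee_wpmul2l _ h); last by rewrite lee_fin ltW.
  rewrite -EFinM lee_fin le_eqVlt; apply/orP; left; apply/eqP.
  rewrite /c /m powRM ?invr_ge0 ?(ltW dj)// powR_inv//.
  have k0 : 0 < 2 `^ (2 * p - 2) :> R by rewrite powR_gt0.
  set k := 2 `^ _ in k0 *; set v := _ `^ (2 - p); set w := _ `^ (2 * p - 2).
  by field; rewrite !gt_eqF.
apply: (@le_lt_trans _ _ (c%:E * \int[mu]_(d in \bigcup_j J j) (f d)%:E)%E).
  rewrite ge0_integral_bigcup//; last 3 first.
  - by apply/measurable_EFinP; apply: measurable_funS subJ mf.
  - by move=> d _; rewrite lee_fin.
  - apply: ltn_trivIset => k i ik; apply/seteqP; split => // d [].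
    rewrite /J/= !in_itv/= => /andP[d1 d2] /andP[d3 d4].
    suff h : delta k <= delta i / 2 by lra.
    elim: k ik {d1 d2 d3 d4} => // k IH; rewrite ltnS leq_eqVlt => /predU1P[->|/IH h].
      by have := delta_half k; lra.
    by have := delta_half k; have := delta_gt0 k.+1; lra.
  rewrite -nneseriesZl; last by move=> j _; apply: integral_ge0 => d _; rewrite lee_fin.
  by apply: lee_nneseries.
rewrite lte_mul_pinfty ?lee_fin ?(ltW c0)//; apply: le_lt_trans fin.
apply: ge0_subset_integral => //; first exact: bigcup_measurable.
- by apply/measurable_EFinP.
- by move=> d _; rewrite lee_fin.
Qed.

End modulus_scale.

Theorem theorem3 (R : realType) (omega : R -> R)
  (omega_nd : {in `[0, +oo[ &, {homo omega : s t / s <= t}})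
  (omega_cont : {within `[0, +oo[, continuous omega})
  (omega0 : omega 0 = 0)
  (omega2 : \forall delta \near (0 : R)^'+, omega (2 * delta) < 2 * omega delta) :
  exists D : set (R * R),
    [/\ domain D /\ bounded_set D,
        C1_omega_boundary omega D,
        (forall p : R, 1 < p < 2 ->
           (\int[lebesgue_measure]_(delta in `]0%R, 1%R])
              (delta `^ (2 * p - 3) / omega delta `^ (2 - p))%R%:E < +oo)%E ->
           A_ p%:E (distr_of (char_fun D))) &
        (forall x y : R * R, x != y -> ~ (segment x y `<=` boundary D))].
Proof.
have [e e0 he] : exists2 e : R, 0 < e & forall d, 0 < d -> d < e -> omega (2 * d) < 2 * omega d.
  move: omega2 => [e /= e0 he]; exists e => // d d0 de; apply: he => //=.
  by rewrite sub0r normrN gtr0_norm.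
(* Below the threshold of the hypothesis on omega, and at most 1 so that all scales lie in the
   interval of integration. *)
pose rho := Num.min (e / 2) 1.
have rho0 : 0 < rho by rewrite lt_min ltr01 divr_gt0.
have rho1 : rho <= 1 by rewrite ge_min lexx orbT.
have rhoe : rho < e by rewrite /rho gt_min ltr_pdivrMr// ltr_pMr// ltr1n.
have [omega_gt0 [delta [delta_gt0 delta_rho omega_delta delta_half]]] :=
  dyadic_levels omega_nd omega_cont omega0 rho0 (fun d d0 dr => he d d0 (le_lt_trans dr rhoe)).
have delta_le1 j : delta j <= 1 := le_trans (delta_rho j) rho1.
have orho : 0 < omega rho by exact: omega_gt0.
have [phi [phi0 dphi]] := continuous_antiderivative (oslope_continuous delta_gt0 delta_half).
have fphi : profile (2 * delta 0) (oslope delta) phi.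
  split => //.
  - by rewrite mulr_gt0.
  - exact: oslope_continuous.
  - exact: oslopeN.
  - by move=> x y; exact: oslope_nd.
  - exact: oslope1.
  - exact: oslope_lt.
exists (region (2 * delta 0) phi); split.
- by split; [exact: region_domain fphi | exact: region_bounded fphi].
- split; first by move=> x; exact: region_graph fphi x.
  (* The 8 of [oslope_modulus] times the 2 of [normal_modulus_region]. *)
  apply/eqO_exP; exists (16 / omega rho); first by rewrite divr_gt0.
  near=> d.
  have d0 : 0 < d by near: d; exact: nbhs_right_gt.
  have d1 : d < delta 0 by near: d; exact: nbhs_right_lt.
  have od := omega_gt0 d d0.
  have m := oslope_modulus omega_nd delta_gt0 delta_half omega_delta orho d0 d1.
  have /andP[n0 n1] := normal_modulus_region fphi (ltW d0) m.
  rewrite /= [`|normal_modulus _ _|]ger0_norm// [`|omega d|]gtr0_norm//.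
  by apply: le_trans n1 _; rewrite mulrA; apply: ler_wpM2r; [exact: ltW | lra].
- move=> p /andP[p1 p2] fin; apply: (A_region fphi); first by rewrite (lt_trans ltr01).
  apply: (slope_region_integral delta_gt0 delta_half fphi p1 p2).
  exact: (omega_summable omega_nd delta_gt0 delta_half omega_delta orho delta_le1 p1 p2 fin).
- move=> x y; exact: region_no_segment fphi x y.
Unshelve. all: by end_near. Qed.
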